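(* Let $\Omega=(-1,1)$ and let $u,u',\dots,u^{(k-1)}\in\mathrm{AC}([-1,1])$ with $k\in\mathbb N$, $k\ge1$. (i) Let $\mu\in(k-1,k)$ and $\theta\in(-1,1)$, and suppose ${}^{C}\!D_{\theta+}^{\mu}u\in\mathrm{BV}([\theta,1])$ and ${}^{C}\!D_{\theta-}^{\mu}u\in\mathrm{BV}([-1,\theta])$. Put $$U_\theta^{(\mu)}:=V_{[-1,\theta]}[{}^{C}\!D_{\theta-}^{\mu}u]+V_{[\theta,1]}[{}^{C}\!D_{\theta+}^{\mu}u]+|({}^{C}\!D_{\theta-}^{\mu}u)(\theta-)|+|({}^{C}\!D_{\theta+}^{\mu}u)(\theta+)|.$$ Then, if $\mu>1/2$, for all integers $N\ge\mu$, $$\|u-\pi_N^Lu\|_{L^\infty(\Omega)}\le\frac{1}{2^{\mu-1}(\mu-1/2)\sqrt\pi}\,\frac{\Gamma((N-\mu+1)/2)}{\Gamma((N+\mu)/2)}\,U_\theta^{(\mu)},\qquad (A)$$ and for all integers $N\ge\mu$, $$\big\|(1-x^2)^{1/4}(u-\pi_N^Lu)\big\|_{L^\infty(\Omega)}\le\frac{1}{2^{\mu-1}\mu\,\pi}\,\frac{\Gamma((N-\mu+1)/2)}{\Gamma((N+\mu+1)/2)}\,U_\theta^{(\mu)}.\qquad (B)$$ (ii) If $u^{(k)}\in\mathrm{BV}([-1,1])$, then for all integers $N\ge k$ the estimates (A) and (B) hold with $\mu=k$ and with $U_\theta^{(\mu)}$ replaced by the total variation $V_{[-1,1]}[u^{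(k)}]$.
   Context: $P_n$ is the Legendre polynomial of degree $n$, $\hat u_n^L=\frac{2n+1}{2}\int_{-1}^1u(x)P_n(x)\,\mathrm dx$, and $\pi_N^Lu=\sum_{n=0}^N\hat u_n^LP_n$ is the $L^2(-1,1)$-orthogonal projection onto polynomials of degree at most $N$. $\mathrm{AC}$ and $\mathrm{BV}$ denote absolutely continuous functions and functions of bounded variation on the indicated closed interval; $V_{[c,d]}[h]$ is the total variation of $h$ on $[c,d]$; $h(c\pm)$ are one-sided limits. Fractional integrals: for $\rho>0$ and $f\in L^1(a,b)$, $(I_{a+}^\rho f)(x)=\frac1{\Gamma(\rho)}\int_a^x\frac{f(y)}{(x-y)^{1-\rho}}\,\mathrm dy$ and $(I_{b-}^\rho f)(x)=\frac1{\Gamma(\rho)}\int_x^b\frac{f(y)}{(y-x)^{1-\rho}}\,\mathrm dy$; $I^0$ is the identity. Caputo derivatives: for $\mu\in(k-1,k]$, $({}^{C}\!D_{a+}^{\mu}f)(x)=(I_{a+}^{k-\mu}f^{(k)})(x)$ and $({}^{C}\!D_{b-}^{\mu}f)(x)=(-1)^k(I_{b-}^{k-\mu}f^{(k)})(x)$. These (and $u^{(k)}$) are defined almost everywhere; saying that such a function is in BV means it agrees a.e. with a BV function, with which it is then identified. *)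

(* Defs.v *)
From HB Require Import structures.
From mathcomp Require Import all_boot all_order all_algebra.
From mathcomp Require Import all_classical all_reals all_analysis.

Set Implicit Arguments.
Unset Strict Implicit.
Unset Printing Implicit Defensive.

Import Order.TTheory GRing.Theory Num.Theory.
Import numFieldNormedType.Exports.

Local Open Scope classical_set_scope.
Local Open Scope ring_scope.

Section definitions.
Context {R : realType}.
Implicit Types (u f g : R -> R) (a b x mu rho theta : R) (k n N : nat).

Notation leb := (@lebesgue_measure R).

(* Euler's integral; it is only ever used at s > 0. *)
Definition Gamma (s : R) : R :=
  \int[leb]_(t in `]0, +oo[) (t `^ (s - 1) * expR (- t)).

(* Rodrigues' formula. *)
Definition legendre n : {poly R} :=
  (2 ^+ n * n`!%:R)^-1 *: derivn n (('X^2 - 1) ^+ n).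

Definition legendre_coef u n : R :=
  (2 * n%:R + 1) / 2 * \int[leb]_(x in `[-1, 1]) (u x * (legendre n).[x]).

Definition legendre_proj N u : R -> R :=
  fun x => \sum_(n < N.+1) legendre_coef u n * (legendre n).[x].

(* Extending by 0 outside ]-1, 1[ does not change the essential supremum of the
   absolute value, so this is the norm of L^oo(-1, 1). *)
Definition Linfty_norm f : \bar R :=
  'N[leb]_+oo%E[EFin \o (f \_ `]-1, 1[)].

Definition abs_cont a b f : Prop :=
  forall e : R, 0 < e -> exists2 d : R, 0 < d &
    forall n (x y : 'I_n -> R),
      (forall i, [/\ a <= x i, x i < y i & y i <= b]) ->
      trivIset setT (fun i => `]x i, y i[%classic) ->
      \sum_i (y i - x i) < d ->
      \sum_i `|f (y i) - f (x i)| < e.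

(* u, u', ..., u^(k-1) are in AC([a, b]), for k >= 1. The library's derivatives
   are two-sided, hence on [a, b] meaningful only at interior points, where they
   do not depend on the values of u outside [a, b]. The derivative u^(j+1) must
   exist everywhere on ]a, b[ and be the restriction of an AC([a, b]) function
   g; by continuity, g a and g b are then the one-sided derivatives of u^(j). *)
Definition AC_derivatives a b k u : Prop :=
  abs_cont a b u /\
  forall j, (j.+1 < k)%N ->
    {in `]a, b[, forall x, derivable (derive1n j u) x 1} /\
    exists2 g, abs_cont a b g & {in `]a, b[, derive1n j.+1 u =1 g}.

(* Where (x - y) `^ (1 - rho) vanishes, at y = x, the division returns 0: this
   affects only a null set. *)
Definition frac_int_left rho a f : R -> R := fun x =>
  if rho == 0 then f x
  else (Gamma rho)^-1 * \int[leb]_(y in `[a, x]) (f y / (x - y) `^ (1 - rho)).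

Definition frac_int_right rho b f : R -> R := fun x =>
  if rho == 0 then f x
  else (Gamma rho)^-1 * \int[leb]_(y in `[x, b]) (f y / (y - x) `^ (1 - rho)).

(* The integer k is the one with k - 1 < mu <= k. When u^(k-1) is absolutely
   continuous, derive1n k u is the almost everywhere defined u^(k), with
   unspecified values where u^(k-1) is not derivable; in the same way, the
   functions below are meaningful almost everywhere. *)
Definition caputo_left k mu a u : R -> R :=
  frac_int_left (k%:R - mu) a (derive1n k u).

Definition caputo_right k mu b u : R -> R :=
  fun x => (-1) ^+ k * frac_int_right (k%:R - mu) b (derive1n k u) x.

(* f, defined almost everywhere, is in BV([a, b]) and is identified with g; the
   total variation and one-sided limits of f are then those of g. *)
Definition BV_version a b f g : Prop :=
  bounded_variation a b g /\ f = g %[ae leb in `[a, b]%classic].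

(* U_theta^(mu), where h and g are the versions of bounded variation of the
   right and left Caputo derivatives on [-1, theta] and [theta, 1]. *)
Definition Utheta theta (h g : R -> R) : \bar R :=
  (total_variation (-1) theta h + total_variation theta 1 g
   + `|lim (h x @[x --> theta^'-])|%:E + `|lim (g x @[x --> theta^'+])|%:E)%E.

Definition estimateA mu N u (V : \bar R) : Prop :=
  (Linfty_norm (fun x => (u x - legendre_proj N u x)%R) <=
   (1 / (2 `^ (mu - 1) * (mu - 1 / 2) * Num.sqrt pi) *
    (Gamma ((N%:R - mu + 1) / 2) / Gamma ((N%:R + mu) / 2)))%:E * V)%E.

Definition estimateB mu N u (V : \bar R) : Prop :=
  (Linfty_norm
     (fun x => ((1 - x ^+ 2) `^ (1 / 4) * (u x - legendre_proj N u x))%R) <=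
   (1 / (2 `^ (mu - 1) * mu * pi) *
    (Gamma ((N%:R - mu + 1) / 2) / Gamma ((N%:R + mu + 1) / 2)))%:E * V)%E.

End definitions.

(* Main.v *)
(* Integrating by parts k times against P_n and applying Fubini, the n-th
   Legendre coefficient of u becomes an integral of the Caputo derivatives of u
   against the Riemann-Liouville integral of order mu of P_n, started at 1 on
   the right of theta and, after a reflection, at -1 on its left. One more
   integration by parts, against a function of bounded variation, bounds the
   coefficient by U times the supremum of the integral y of order s = mu + 1.
   In the variable t = 1 - x, y solves
     t (2 - t) y'' - 2 (s - 1) (1 - t) y' + c y = 0,  c = (n + s) (n + 1 - s),
   so Sonin's function y^2 + t (2 - t) y'^2 / c is maximal at t = 1, where y and
   y' are explicit quotients of Gamma values: this yields
     |y| <= Gamma((n + 1 - s) / 2) / (2^s sqrt(pi) Gamma((n + s + 2) / 2)).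
   With |P_n| <= 1 for (A), and Bernstein's inequality
   (1 - x^2)^(1/4) |P_n(x)| <= sqrt(2 / (pi n)) for (B), the tail of the Legendre
   series is dominated by a telescoping sum of quotients of Gamma values. That
   the series converges to u on ]-1, 1[ follows by testing its remainders, which
   are orthogonal to all polynomials of low degree, against powers of a quadratic
   polynomial that concentrate at a point. *)
Require Import Defs.
From HB Require Import structures.
From mathcomp Require Import all_boot all_order all_algebra.
From mathcomp Require Import all_classical all_reals all_analysis.
From mathcomp Require Import measurable_realfun ess_sup_inf.
From mathcomp Require Import ring lra.

Set Implicit Arguments.
Unset Strict Implicit.
Unset Printing Implicit Defensive.

Import Order.TTheory GRing.Theory Num.Theory.
Import numFieldNormedType.Exports.

Local Open Scope classical_set_scope.
Local Open Scope ring_scope.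

(** * Calculus on the real line *)

Section calculus.
Context {R : realType}.
Notation leb := (@lebesgue_measure R).
Implicit Types (f g F : R -> R) (a b x : R).

(** The constants depend on exact values at the midpoint t = 1, hence on the reflection and
    duplication formulas for Euler's integral. Both follow one pattern: an expression invariant
    under unit shifts is identified by its limit at infinity, and Wendel's inequality supplies the
    asymptotics. Recurrences in n and in s then reduce the values at t = 1 to n = 0, 1 and -1 < s <=
    1. A second obstacle is that u^(k) exists only almost everywhere, with unspecified values
    elsewhere. It is therefore replaced under every integral by an integrable density of u^(k-1).
    The density comes from the fundamental theorem for absolutely continuous functions, proved by
    Jordan decomposition, Stieltjes measures and Radon-Nikodym. Finally, the tail sums bound the
    remainder only once the series is known to converge to u. The summability of the coefficients
    behind (A) needs mu > 1/2; Bernstein's weight gives locally uniform control for every mu > 0, so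
    convergence rests on it for both estimates, and what remains is to show that the limit is u. *)

Lemma is_derive_continuous F x (d : R) : is_derive x 1 F d -> {for x, continuous F}.
Proof.
by move=> dF; apply/differentiable_continuous/derivable1_diffP; exact: ex_derive.
Qed.

Lemma within_continuous_derive F f (D : set R) :
  (forall x : R, D x -> is_derive x 1 F (f x)) -> {within D, continuous F}.
Proof.
move=> dF; apply: continuous_in_subspaceT => x /set_mem Dx.
exact: is_derive_continuous (dF _ Dx).
Qed.

Lemma within_continuousD (D : set R) f g : {within D, continuous f} ->
  {within D, continuous g} -> {within D, continuous (fun x => f x + g x)}.
Proof.
move=> /subspace_continuousP cf /subspace_continuousP cg.
by apply/subspace_continuousP => x Dx; apply: cvgD; [exact: cf|exact: cg].
Qed.

Lemma within_continuousM (D : set R) f g : {within D, continuous f} ->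
  {within D, continuous g} -> {within D, continuous (fun x => f x * g x)}.
Proof.
move=> /subspace_continuousP cf /subspace_continuousP cg.
by apply/subspace_continuousP => x Dx; apply: cvgM; [exact: cf|exact: cg].
Qed.

Lemma within_continuous_cst (D : set R) (c : R) : {within D, continuous (fun=> c)}.
Proof. by apply: continuous_subspaceT => x; exact: cvg_cst. Qed.

Lemma derive_nondecreasing F f a b : a <= b ->
  {in `]a, b[, forall x : R, is_derive x 1 F (f x)} ->
  {in `]a, b[, forall x : R, 0 <= f x} ->
  {within `[a, b], continuous F} -> F a <= F b.
Proof.
rewrite le_eqVlt => /predU1P[->//|ab] dF f0 cF.
have [c cab FF] := @MVT R F f a b ab dF cF.
by rewrite -subr_ge0 FF mulr_ge0 ?f0// subr_ge0 ltW.
Qed.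

Lemma within_continuous_integrable f a b :
  {within `[a, b], continuous f} -> leb.-integrable `[a, b] (EFin \o f).
Proof. by move=> cf; apply: continuous_compact_integrable => //; exact: segment_compact. Qed.

Lemma continuous_integrable f a b : (forall x, {for x, continuous f}) ->
  leb.-integrable `[a, b] (EFin \o f).
Proof. by move=> cf; apply: within_continuous_integrable; exact: continuous_subspaceT. Qed.

Lemma Rintegral_FTC F f a b : a <= b ->
  (forall x : R, a <= x <= b -> is_derive x 1 F (f x)) ->
  {within `[a, b], continuous f} ->
  \int[leb]_(x in `[a, b]) f x = F b - F a.
Proof.
rewrite le_eqVlt => /predU1P[-> _ _|ab dF cf].
  by rewrite set_itv1 Rintegral_set1 subrr.
rewrite /Rintegral (@continuous_FTC2 _ f F)//.
- have dFx x : a <= x <= b -> {for x, continuous F}.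
    by move=> /dF; exact: is_derive_continuous.
  split.
  + move=> x; rewrite in_itv/= => /andP[x1 x2].
    have dx : a <= x <= b by rewrite !ltW.
    by have := dF _ dx => ?; exact: ex_derive.
  + by apply: cvg_at_right_filter; apply: dFx; rewrite lexx ltW.
  + by apply: cvg_at_left_filter; apply: dFx; rewrite lexx ltW.
- move=> x; rewrite in_itv/= => /andP[x1 x2]; rewrite derive1E.
  have dx : a <= x <= b by rewrite !ltW.
  by have := dF _ dx => ?; rewrite derive_val.
Qed.

End calculus.

(** * Integration on intervals *)

Section change_of_variables.
Context {R : realType}.
Notation leb := (@lebesgue_measure R).

(** The pushforward of Lebesgue measure under x |-> r x + c, scaled by r, gives half-open intervals
    their length; uniqueness of Lebesgue measure does the rest. *)
Lemma ge0_integral_affine (r c : R) (D : set R) (f : R -> \bar R) :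
  0 < r -> measurable D -> measurable_fun D f ->
  {in D, forall x, (0 <= f x)%E} ->
  (\int[leb]_(x in D) f x =
   r%:E * \int[leb]_(x in [set x | D (r * x + c)%R]) f (r * x + c)%R)%E.
Proof.
move=> r0 mD mf f0.
pose phi (x : measurableTypeR R) : measurableTypeR R := r * x + c.
have mphi : measurable_fun setT phi.
  by apply: measurable_funD => //; exact: measurable_funM.
rewrite -(ge0_integral_pushforward mphi leb mD mf f0).
pose pf : {measure set (measurableTypeR R) -> \bar R} :=
  measure_function_pushforward__canonical__measure_function_Measure leb mphi.
pose m1 := mscale (NngNum (ltW r0)) pf.
have -> : (\int[pushforward leb phi]_(y in D) f y = \int[pf]_(y in D) f y)%E by [].
rewrite -[X in _ = (X * _)%E]/((NngNum (ltW r0))%:num%:E).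
rewrite -ge0_integral_mscale //; last by move=> x Dx; apply: f0; rewrite inE.
apply: eq_measure_integral => A mA AD.
have := (@lebesgue_measure_unique R m1) => H; apply: H => // _ [[a b]] _ <- /=.
rewrite /m1 /mscale/= /pushforward.
have -> : phi @^-1` `]a, b] = `](a - c) / r, (b - c) / r]%classic.
  apply/seteqP; split => x /=; rewrite !in_itv/= /phi => /andP[h1 h2].
    by rewrite ltr_pdivrMr// ler_pdivlMr//; apply/andP; split; lra.
  by move: h1 h2; rewrite ltr_pdivrMr// ler_pdivlMr// => h1 h2; apply/andP; split; lra.
rewrite !lebesgue_measure_itv/= !lte_fin ltr_pM2r ?invr_gt0// ltrD2r.
case: ifPn => ab; rewrite ?mule0// -!EFinD -EFinM; congr EFin.
by field; rewrite gt_eqF.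
Qed.

Lemma ge0_integral_oppr (D : set R) (f : R -> \bar R) :
  measurable D -> measurable_fun D f ->
  {in D, forall x, (0 <= f x)%E} ->
  (\int[leb]_(x in D) f x = \int[leb]_(x in [set x | D (- x)%R]) f (- x)%R)%E.
Proof.
move=> mD mf f0.
have mphi : measurable_fun setT (-%R : measurableTypeR R -> measurableTypeR R) by [].
rewrite -(ge0_integral_pushforward mphi leb mD mf f0).
by apply: eq_measure_integral => A mA AD; exact: (esym (lebesgue_measureN mA)).
Qed.

(** The region [A] is described by its sections in both directions, so that an exchange of variables
    needs two set equivalences and no indicator functions in the iterated integrals. *)
Lemma tonelli_region (h : R -> R -> R) (A : set (R * R)) (D E : set R)
    (Dx Ey : R -> set R) :
  measurable A -> measurable_fun setT (fun z : R * R => h z.1 z.2) ->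
  (forall z, A z -> 0 <= h z.1 z.2) ->
  (forall x y, A (x, y) <-> D x /\ Dx x y) ->
  (forall x y, A (x, y) <-> E y /\ Ey y x) ->
  (\int[leb]_(x in D) \int[leb]_(y in Dx x) (h x y)%:E =
   \int[leb]_(y in E) \int[leb]_(x in Ey y) (h x y)%:E)%E.
Proof.
move=> mA mh h0 AD AE.
pose f : R * R -> \bar R := (fun z : R * R => (h z.1 z.2)%:E) \_ A.
have mf : measurable_fun setT f.
  apply/(measurable_restrictT _ mA) => //=.
  by apply/measurable_EFinP; exact: measurable_funTS.
have f0 z : (0 <= f z)%E.
  by rewrite /f patchE; case: ifPn => // /set_mem /h0; rewrite lee_fin.
have := @fubini_tonelli _ _ _ _ _ leb leb f mf f0; rewrite /f => H.
transitivity (\int[leb]_x \int[leb]_y f (x, y))%E.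
  rewrite integral_mkcond; apply: eq_integral => x _; rewrite patchE.
  case: ifPn => [/set_mem Dxx|/negP xD].
    rewrite integral_mkcond; apply: eq_integral => y _; rewrite /f !patchE.
    congr (if _ then _ else _); apply/idP/idP => /set_mem H1; apply/mem_set.
      exact: ((AD x y).2 (conj Dxx H1)).
    exact: ((AD x y).1 H1).2.
  rewrite integral0_eq => [//|y _]; rewrite /f patchE; case: ifPn => [/set_mem h1|_]; last by [].
  by exfalso; apply: xD; apply/mem_set; exact: ((AD x y).1 h1).1.
rewrite H [RHS]integral_mkcond; apply: eq_integral => y _; rewrite [RHS]patchE.
case: ifPn => [/set_mem Eyy|/negP yE].
  rewrite [RHS]integral_mkcond; apply: eq_integral => x _; rewrite !patchE.
  congr (if _ then _ else _); apply/idP/idP => /set_mem H1; apply/mem_set.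
    exact: ((AE x y).1 H1).2.
  exact: ((AE x y).2 (conj Eyy H1)).
rewrite integral0_eq => [//|x _]; rewrite patchE; case: ifPn => [/set_mem h1|_]; last by [].
by exfalso; apply: yE; apply/mem_set; exact: ((AE x y).1 h1).1.
Qed.

(* The integrand may be singular at a. *)
Lemma ge0_FTC_oc (f F : R -> R) (a b : R) : a < b ->
  {in `]a, b], forall x, {for x, continuous f}} ->
  {in `]a, b], forall x, 0 <= f x} ->
  {in `]a, b], forall x : R, is_derive x 1 F (f x)} ->
  F x @[x --> a^'+] --> F a ->
  (\int[leb]_(x in `]a, b]) (f x)%:E = (F b - F a)%:E)%E.
Proof.
move=> ab cf f0 dF Fa.
(* The segments [[e n, b]] exhaust []a, b]]. On each the usual theorem applies, and monotone
   convergence passes to the limit, so integrability near a is obtained rather than assumed. *)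
pose e n : R := a + (b - a) / n.+1%:R.
have eab n : a < e n /\ e n <= b.
  rewrite /e; split; first by rewrite ltrDl divr_gt0// subr_gt0.
  rewrite -lerBrDl ler_pdivrMr// ler_peMr ?ler1n//.
  by rewrite subr_ge0 ltW.
pose I n := `[e n, b]%classic.
have UI : \bigcup_n I n = `]a, b]%classic.
  apply/seteqP; split => [x [n _]|x].
    by rewrite /I /= !in_itv/= => /andP[h ->]; rewrite (lt_le_trans (eab n).1 h).
  rewrite /= in_itv/= => /andP[ax xb].
  have xa : 0 < x - a by rewrite subr_gt0.
  have [n Hn] : exists n : nat, (b - a) / (x - a) < n%:R.
    by exists (Num.truncn ((b - a) / (x - a))).+1; exact: truncnS_gt.
  exists n => //; rewrite /I /= in_itv/= xb andbT /e -lerBrDl.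
  rewrite ler_pdivrMr//; move: Hn; rewrite ltr_pdivrMr// => /ltW /le_trans; apply.
  by rewrite mulrC ler_pM2l// ler_nat.
have ndI : nondecreasing_seq I.
  move=> m n mn; apply/subsetPset => x; rewrite /I /= !in_itv/= => /andP[h ->].
  rewrite andbT (le_trans _ h)// lerD2l ler_pM2l ?subr_gt0// lef_pV2 ?posrE//.
  by rewrite ler_nat.
have Isub n : I n `<=` `]a, b]%classic by rewrite -UI; exact: bigcup_sup.
have cfI n : {within I n, continuous f}.
  apply: continuous_in_subspaceT => x /set_mem xI; apply: cf.
  by have := Isub n _ xI.
have mfI n : measurable_fun (I n) (EFin \o f).
  apply/measurable_EFinP; apply: subspace_continuous_measurable_fun => //.
  exact: measurable_itv.
have := @ge0_nondecreasing_set_cvg_integral _ (measurableTypeR R) R I (EFin \o f) leb ndI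
  (fun i => measurable_itv _) mfI.
rewrite UI => H.
have {}H : ((\int[leb]_(x in I i) (f x)%:E)%E @[i --> \oo] -->
  (\int[leb]_(x in `]a, b]) (f x)%:E)%E).
  by apply: H => i x /Isub /= xab; rewrite lee_fin; exact: f0.
rewrite -(cvg_lim _ H)//; apply/cvg_lim => //.
have -> : (fun i => \int[leb]_(x in I i) (EFin \o f) x)%E =
   (fun i => (F b - F (e i))%:E).
  apply/funext => i; have [aei] := eab i; rewrite le_eqVlt => /predU1P[eib|eib].
    by rewrite /I eib subrr set_itv1 integral_set1.
  rewrite /I (@continuous_FTC2 _ f F)//.
  - exact: cfI.
  - have dFx x : x \in `]a, b] -> {for x, continuous F}.
      move=> /dF dFx; apply/differentiable_continuous/derivable1_diffP.
      exact: ex_derive.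
    split.
    + move=> x; rewrite in_itv/= => /andP[x1 x2]; apply: ex_derive.
      by apply: dF; rewrite in_itv/= (lt_trans aei)//= ltW.
    + by apply: cvg_at_right_filter; apply: dFx; rewrite in_itv/= aei ltW.
    + by apply: cvg_at_left_filter; apply: dFx; rewrite in_itv/= ab lexx.
  - move=> x; rewrite in_itv/= => /andP[x1 x2]; rewrite derive1E.
    have := dF x; rewrite in_itv/= (lt_trans aei x1) (ltW x2) => /(_ isT) dFx.
    by rewrite derive_val.
apply: cvg_EFin; first by apply: nearW.
apply: cvgB; first exact: cvg_cst.
move/cvg_at_rightP : Fa; apply => //; split => [n|]; first by have [] := eab n.
rewrite -[X in _ --> X]addr0; apply: cvgD; first exact: cvg_cst.
rewrite -[X in _ --> X](mulr0 (b - a)); apply: cvgMr.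
exact: cvg_harmonic.
Qed.

End change_of_variables.

Section measurable_comparison.
Context {d : measure_display} {T : measurableType d} {R : realType}.

Lemma measurable_lt (f g : T -> R) :
  measurable_fun setT f -> measurable_fun setT g ->
  measurable [set x | f x < g x].
Proof.
move=> mf mg; have := measurable_fun_ltr mf mg.
move=> /(_ measurableT [set true]) H; rewrite -[X in measurable X]setTI.
rewrite (_ : [set x | f x < g x] = (fun x => f x < g x) @^-1` [set true])//.
exact: H.
Qed.

Lemma measurable_le (f g : T -> R) :
  measurable_fun setT f -> measurable_fun setT g ->
  measurable [set x | f x <= g x].
Proof.
move=> mf mg; have := measurable_fun_ler mf mg.
move=> /(_ measurableT [set true]) H; rewrite -[X in measurable X]setTI.
rewrite (_ : [set x | f x <= g x] = (fun x => f x <= g x) @^-1` [set true])//.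
exact: H.
Qed.

End measurable_comparison.

Lemma gt0_powRD (R : realType) (x r s : R) :
  0 < x -> x `^ (r + s) = x `^ r * x `^ s.
Proof. by move=> x0; rewrite powRD // (gt_eqF x0) implybT. Qed.

(** * The Gamma function *)

Section gamma_integral.
Context {R : realType}.
Notation leb := (@lebesgue_measure R).

(** Extended-real valued: the functional equation and Wendel's inequality are proved before
    finiteness and serve to prove it. *)
Definition eGamma (s : R) : \bar R :=
  (\int[leb]_(t in `]0%R, +oo[) (t `^ (s - 1) * expR (- t))%:E)%E.

Lemma measurable_powR_expRN (D : set (measurableTypeR R)) (p : R) :
  measurable_fun D (fun t : R => t `^ p * expR (- t)).
Proof.
apply: measurable_funTS; apply: measurable_funM; first exact: measurable_powR.
exact: measurableT_comp.
Qed.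

Lemma integral_powR (s t : R) : 0 < s -> 0 < t ->
  (\int[leb]_(r in `]0%R, t]) (s * r `^ (s - 1))%:E = (t `^ s)%:E)%E.
Proof.
move=> s0 t0; rewrite (@ge0_FTC_oc _ _ (fun r => r `^ s))//.
- by rewrite powR0 ?gt_eqF// subr0.
- move=> x; rewrite in_itv/= => /andP[x0 _].
  apply: continuousM; first exact: cvg_cst.
  apply/differentiable_continuous/derivable1_diffP.
  by apply: derivable_powR; rewrite in_itv/= x0.
- by move=> x _; rewrite mulr_ge0 ?powR_ge0 ?ltW.
- by move=> x; rewrite in_itv/= => /andP[x0 _]; exact: is_derive1_powR.
- by rewrite powR0 ?gt_eqF//; exact: powR_cvg0.
Qed.

Lemma integral_expRN (r : R) :
  (\int[leb]_(t in `[r, +oo[) (expR (- t))%:E = (expR (- r))%:E)%E.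
Proof.
have d (x : R) : is_derive x 1 (fun t : R => - expR (- t)) (expR (- x)).
  by apply: is_derive_eq; rewrite /GRing.scale/=; ring.
have c (x : R) : {for x, continuous (fun t : R => - expR (- t))}.
  by apply/differentiable_continuous/derivable1_diffP; exact: ex_derive.
rewrite (@ge0_continuous_FTC2y _ _ (fun t : R => - expR (- t)) r 0)//.
- by rewrite sub0e EFinN oppeK.
- apply: continuous_subspaceT => x; apply: continuous_comp; first exact: continuousN.
  exact: continuous_expR.
- rewrite -oppr0; apply: cvgN; exact: cvgr_expR.
- by apply: cvg_at_right_filter; exact: c.
- by move=> x _; rewrite derive1E derive_val.
Qed.

Lemma eGamma1 : eGamma 1 = 1%E.
Proof.
have := integral_expRN 0; rewrite oppr0 expR0 => <-.
rewrite /eGamma -integral_itv_obnd_cbnd; last first.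
  by apply/measurable_EFinP/measurable_funTS; exact: measurableT_comp.
by apply: eq_integral => t _; rewrite subrr powRr0 mul1r.
Qed.

(** Writing t^s as the integral of s r^(s-1) over r <= t and exchanging by Tonelli leaves the
    integral of exp(-t) over t >= r. This replaces an integration by parts and requires no
    finiteness. *)
Lemma eGammaS (s : R) : 0 < s -> eGamma (s + 1) = (s%:E * eGamma s)%E.
Proof.
move=> s0.
transitivity (\int[leb]_(t in `]0%R, +oo[) \int[leb]_(r in `]0%R, t])
    (s * r `^ (s - 1) * expR (- t))%:E)%E.
  apply: eq_integral => t; rewrite inE/= in_itv/= andbT => t0.
  under eq_integral do rewrite EFinM.
  rewrite ge0_integralZr//; last 2 first.
  - by apply/measurable_EFinP/measurable_funTS/measurable_funM => //; exact: measurable_powR.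
  - by move=> x _; rewrite lee_fin mulr_ge0 ?powR_ge0 ?ltW.
  by rewrite integral_powR// addrK -EFinM.
pose A := [set z : R * R | 0 < z.2 /\ z.2 <= z.1].
rewrite (@tonelli_region _ (fun t r => s * r `^ (s - 1) * expR (- t)) A _
   `]0, +oo[ _ (fun r => `[r, +oo[%classic)); last 5 first.
- rewrite (_ : A = [set z : R * R | 0 < z.2] `&` [set z | z.2 <= z.1])//.
  by apply: measurableI; [exact: measurable_lt|exact: measurable_le].
- apply: measurable_funM.
    by apply: measurable_funM => //; exact: (measurableT_comp (@measurable_powR R _)).
  have m : measurable_fun setT (fun t : R => expR (- t)) by exact: measurableT_comp.
  exact: (measurableT_comp m).
- by move=> z _; rewrite mulr_ge0 ?expR_ge0// mulr_ge0 ?powR_ge0 ?ltW.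
- move=> x y; rewrite /A/= !in_itv/= andbT; split=> [[y0 yx]|[x0 /andP[]]//].
  by rewrite y0 yx (lt_le_trans y0 yx).
- by move=> x y; rewrite /A/= !in_itv/= !andbT.
rewrite /eGamma -ge0_integralZl//; last 3 first.
- by apply/measurable_EFinP; exact: measurable_powR_expRN.
- by move=> x _; rewrite lee_fin mulr_ge0 ?powR_ge0 ?expR_ge0.
- by rewrite lee_fin ltW.
apply: eq_integral => r _.
under eq_integral do rewrite EFinM.
rewrite ge0_integralZl//; last 2 first.
- by apply/measurable_EFinP/measurable_funTS; exact: measurableT_comp.
- by rewrite lee_fin mulr_ge0 ?powR_ge0 ?ltW.
by rewrite integral_expRN -!EFinM mulrA.
Qed.

(** Concavity of y^z, the line being the tangent at y = 1. It is Young's inequality with exponents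
    1/z and 1/(1-z), the degenerate cases z = 0 and z = 1 being set apart. *)
Lemma powR_le_affine (y z : R) : 0 < y -> 0 <= z <= 1 -> y `^ z <= 1 - z + z * y.
Proof.
move=> y0 /andP[z0 z1].
have [->|zn0] := eqVneq z 0; first by rewrite powRr0 subr0 mul0r addr0 lexx.
have [->|zn1] := eqVneq z 1; first by rewrite (powRr1 (ltW y0)) subrr add0r mul1r lexx.
have zp : 0 < z by rewrite lt_def zn0.
have zl : 0 < 1 - z by rewrite subr_gt0 lt_def eq_sym zn1.
have := @conjugate_powR R (y `^ z) 1 z^-1 (1 - z)^-1 (powR_ge0 _ _) ler01.
rewrite !invr_gt0 !invrK => /(_ zp zl).
rewrite addrC subrK => /(_ erefl).
by rewrite mulr1 -powRrM mulfV// (powRr1 (ltW y0)) powR1 mul1r => H; lra.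
Qed.

(** The tangent bound for t^z at t = x, integrated against t^(x-1) exp(-t). The extended-real form
    allows it to bound a value not yet known to be finite. *)
Lemma eGamma_Wendel (x z : R) : 0 < x -> 0 <= z <= 1 ->
  (eGamma (x + z) <= (x `^ z * (1 - z))%:E * eGamma x +
     (x `^ z * (z / x))%:E * eGamma (x + 1))%E.
Proof.
move=> x0 /andP[z0 z1].
have c1 : 0 <= x `^ z * (1 - z) by rewrite mulr_ge0 ?powR_ge0 ?subr_ge0.
have c2 : 0 <= x `^ z * (z / x) by rewrite mulr_ge0 ?powR_ge0// divr_ge0// ltW.
have h p (t : R) : (0 <= (t `^ p * expR (- t))%:E)%E.
  by rewrite lee_fin mulr_ge0 ?powR_ge0 ?expR_ge0.
have m p : measurable_fun (`]0%R, +oo[%classic : set (measurableTypeR R)) (fun t : R => (t `^ p * expR (- t))%:E).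
  by apply/measurable_EFinP; exact: measurable_powR_expRN.
rewrite /eGamma -!ge0_integralZl//; try by rewrite ?lee_fin.
rewrite -ge0_integralD//; try by
  [move=> *; apply: mule_ge0; [rewrite lee_fin|exact: h]|apply: measurable_funeM].
apply: ge0_le_integral => //; try by
  [apply: m|move=> *; apply: adde_ge0; (apply: mule_ge0; [by rewrite lee_fin|exact: h])|
   apply: emeasurable_funD; apply: measurable_funeM].
move=> t; rewrite /= in_itv/= andbT => t0.
rewrite -!EFinM -EFinD lee_fin !mulrA -mulrDl ler_wpM2r ?expR_ge0//.
have -> : x + 1 - 1 = (x - 1) + 1 by ring.
have -> : x + z - 1 = (x - 1) + z by ring.
rewrite !(@gt0_powRD _ _ (x - 1))// (powRr1 (ltW t0)).
have -> : t `^ z = x `^ z * (t / x) `^ z.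
  by rewrite -powRM ?(ltW x0) ?(ltW (divr_gt0 t0 x0))// mulrC divfK ?gt_eqF.
have H := @powR_le_affine (t / x) z (divr_gt0 t0 x0).
rewrite z0 z1 in H; have {}H := H isT.
have p : 0 <= t `^ (x - 1) * x `^ z by rewrite mulr_ge0 ?powR_ge0.
have := ler_wpM2l p H; lra.
Qed.

Lemma eGamma_ge (s : R) : 0 < s -> ((expR (-1) / s)%:E <= eGamma s)%E.
Proof.
move=> s0.
have m p (D : set (measurableTypeR R)) :
    measurable_fun D (fun t : R => (t `^ p * expR (- t))%:E).
  by apply/measurable_EFinP; exact: measurable_powR_expRN.
have H : (\int[leb]_(t in `]0%R, 1%R]) (t `^ (s - 1) * expR (- t))%:E <= eGamma s)%E.
  apply: ge0_subset_integral => //.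
  - by move=> x _; rewrite lee_fin mulr_ge0 ?powR_ge0 ?expR_ge0.
  - by move=> x /=; rewrite !in_itv/= => /andP[->].
apply: le_trans H.
have -> : (expR (-1) / s)%:E = (\int[leb]_(t in `]0%R, 1%R])
    ((expR (-1) / s)%:E * (s * t `^ (s - 1))%:E))%E.
  rewrite ge0_integralZl//.
  - by rewrite integral_powR// powR1 mule1.
  - by apply/measurable_EFinP/measurable_funTS/measurable_funM => //; exact: measurable_powR.
  - by move=> x _; rewrite lee_fin mulr_ge0 ?powR_ge0 ?ltW.
  - by rewrite lee_fin divr_ge0 ?expR_ge0 ?ltW.
apply: ge0_le_integral => //.
- by move=> x _; rewrite -EFinM lee_fin mulr_ge0 ?divr_ge0 ?expR_ge0 ?mulr_ge0 ?powR_ge0 ?ltW.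
- apply: emeasurable_funM => //; apply/measurable_EFinP/measurable_funTS.
  by apply: measurable_funM => //; exact: measurable_powR.
move=> t; rewrite /= in_itv/= => /andP[t0 t1].
rewrite -EFinM lee_fin mulrA divfK ?gt_eqF// mulrC ler_wpM2l ?powR_ge0//.
by rewrite ler_expR lerN2.
Qed.

Lemma eGamma_fin (s : R) : 0 < s -> eGamma s \is a fin_num.
Proof.
have ge0 t : (0 <= eGamma t)%E.
  by apply: integral_ge0 => x _; rewrite lee_fin mulr_ge0 ?powR_ge0 ?expR_ge0.
have sm z : 0 < z <= 1 -> eGamma z \is a fin_num.
  move=> /andP[z0 z1]; rewrite ge0_fin_numE//.
  (* As z Gamma(z) = Gamma(1 + z), Wendel's inequality at x = 1 bounds this by the values at 1 and
     2. *)
  have : (z%:E * eGamma z < +oo)%E.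
    rewrite -eGammaS// addrC; apply: le_lt_trans (@eGamma_Wendel 1 z _ _) _ => //.
      by rewrite z1 ltW.
    by rewrite eGammaS// eGamma1 !mule1 -EFinD ltry.
  case: (eGamma z) (ge0 z) => [r| |] //; first by move=> *; rewrite ltry.
  by move=> _; rewrite gt0_muley ?lte_fin.
move=> s0.
have [n sn] : exists n : nat, s <= n.+1%:R.
  by exists (Num.truncn s); apply/ltW/truncnS_gt.
elim: n s s0 sn => [|n IH] s s0 sn; first by apply: sm; rewrite s0.
have [s1|s1] := leP s 1; first by apply: sm; rewrite s0.
rewrite -(subrK 1 s) eGammaS ?subr_gt0// fin_numM// IH ?subr_gt0//.
by rewrite lerBlDr natr1.
Qed.

End gamma_integral.

(* Locked, so that unification never unfolds the integral. *)
HB.lock Definition gam (R : realType) (s : R) : R := Gamma s.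

Section gamma_function.
Context {R : realType}.
Notation leb := (@lebesgue_measure R).

Lemma GammaE (s : R) : 0 < s -> (gam s)%:E = eGamma s.
Proof. by move=> s0; rewrite gam.unlock /Gamma /Rintegral fineK//; exact: eGamma_fin. Qed.

Lemma Gamma_gt0 (s : R) : 0 < s -> 0 < gam s.
Proof.
move=> s0; rewrite -lte_fin GammaE//; apply: lt_le_trans (eGamma_ge s0).
by rewrite lte_fin divr_gt0 ?expR_gt0.
Qed.

Lemma Gamma1 : gam 1 = 1 :> R.
Proof. by apply: EFin_inj; rewrite GammaE// eGamma1. Qed.

Lemma GammaS (s : R) : 0 < s -> gam (s + 1) = s * gam s.
Proof. by move=> s0; apply: EFin_inj; rewrite EFinM !GammaE ?addr_gt0// eGammaS. Qed.

Lemma Gamma_Wendel (x z : R) : 0 < x -> 0 <= z <= 1 ->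
  gam (x + z) <= x `^ z * gam x.
Proof.
move=> x0 z01; have /andP[z0 z1] := z01; rewrite -lee_fin GammaE ?ltr_wpDr//.
apply: (le_trans (eGamma_Wendel x0 z01)).
rewrite -!GammaE ?addr_gt0// GammaS// -!EFinM -EFinD lee_fin.
have -> : x `^ z * (z / x) * (x * gam x) = x `^ z * z * gam x.
  by field; rewrite gt_eqF.
lra.
Qed.

Lemma integral_beta (a b r : R) : 0 < a -> 0 < b -> 0 < r ->
  (\int[leb]_(s in `]0%R, r[) (s `^ (a - 1) * (r - s) `^ (b - 1))%:E =
   (r `^ (a + b - 1) * (gam a * gam b / gam (a + b)))%:E)%E.
Proof.
move=> a0 b0.
have mk (D : set (measurableTypeR R)) r' :
    measurable_fun D (fun s : R => (s `^ (a - 1) * (r' - s) `^ (b - 1))%:E).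
  apply/measurable_EFinP/measurable_funTS/measurable_funM; first exact: measurable_powR.
  by apply: (measurableT_comp (@measurable_powR R _)) => //; exact: measurable_funB.
pose B := (\int[leb]_(s in `]0%R, 1%R[) (s `^ (a - 1) * (1 - s) `^ (b - 1))%:E)%E.
have scal r' : 0 < r' ->
  (\int[leb]_(s in `]0%R, r'[) (s `^ (a - 1) * (r' - s) `^ (b - 1))%:E =
   (r' `^ (a + b - 1))%:E * B)%E.
  move=> r0; rewrite (ge0_integral_affine 0 r0 (measurable_itv _) (mk _ _)); last first.
    by move=> x _; rewrite lee_fin mulr_ge0 ?powR_ge0.
  have -> : [set x | `]0, r'[%classic (r' * x + 0)] = `]0, 1[%classic.
    apply/seteqP; split => x /=; rewrite !in_itv/= addr0 pmulr_rgt0// gtr_pMr//.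
  have -> : (\int[leb]_(x in `]0%R, 1%R[)
      ((r' * x + 0) `^ (a - 1) * (r' - (r' * x + 0)) `^ (b - 1))%:E =
    \int[leb]_(x in `]0%R, 1%R[) ((r' `^ (a - 1 + (b - 1)))%:E *
       (x `^ (a - 1) * (1 - x) `^ (b - 1))%:E))%E.
    apply: eq_integral => x; rewrite inE/= in_itv/= => /andP[x0 x1].
    rewrite -!EFinM; congr EFin; rewrite addr0.
    have -> : r' - r' * x = r' * (1 - x) by ring.
    rewrite (powRM _ (ltW r0) (ltW x0)).
    have x10 : 0 <= 1 - x by rewrite subr_ge0 ltW.
    rewrite (powRM _ (ltW r0) x10) (gt0_powRD (a - 1) _ r0); ring.
  rewrite (ge0_integralZl leb (measurable_itv _) (mk _ _)); last 2 first.
  - by move=> x _; rewrite lee_fin mulr_ge0 ?powR_ge0.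
  - by rewrite lee_fin powR_ge0.
  rewrite muleA -EFinM; congr (_%:E * _)%E.
  have -> : a + b - 1 = 1 + (a - 1 + (b - 1)) by ring.
  by rewrite (gt0_powRD 1 _ r0) (powRr1 (ltW r0)).
(* In the product of the two integrals, q = s + t replaces t and s is integrated first, over ]0, q[.
   By homogeneity ([scal]) the inner integral is q^(a+b-1) times [B]. *)
have key : (eGamma a * eGamma b = B * eGamma (a + b))%E.
  pose g s q := s `^ (a - 1) * (q - s) `^ (b - 1) * expR (- q).
  transitivity (\int[leb]_(s in `]0%R, +oo[) \int[leb]_(q in `]s, +oo[) (g s q)%:E)%E.
    rewrite -ge0_integralZr//; last 3 first.
    - by apply/measurable_EFinP; exact: measurable_powR_expRN.
    - by move=> x _; rewrite lee_fin mulr_ge0 ?powR_ge0 ?expR_ge0.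
    - by apply: integral_ge0 => x _; rewrite lee_fin mulr_ge0 ?powR_ge0 ?expR_ge0.
    apply: eq_integral => s; rewrite inE/= in_itv/= andbT => s0.
    rewrite -ge0_integralZl//; last 3 first.
    - by apply/measurable_EFinP; exact: measurable_powR_expRN.
    - by move=> x _; rewrite lee_fin mulr_ge0 ?powR_ge0 ?expR_ge0.
    - by rewrite lee_fin mulr_ge0 ?powR_ge0 ?expR_ge0.
    rewrite [RHS](@ge0_integral_affine _ 1 s)//; last 2 first.
    - apply/measurable_EFinP/measurable_funTS/measurable_funM; last exact: measurableT_comp.
      apply: measurable_funM => //.
      by apply: (measurableT_comp (@measurable_powR R _)) => //; exact: measurable_funB.
    - by move=> x _; rewrite lee_fin mulr_ge0 ?expR_ge0// mulr_ge0 ?powR_ge0.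
    rewrite mul1e; have -> : [set x | `]s, +oo[%classic (1 * x + s)] = `]0, +oo[%classic.
      by apply/seteqP; split => x /=; rewrite !in_itv/= !andbT mul1r ltrDr.
    apply: eq_integral => t _; rewrite -EFinM mul1r /g addrK; congr EFin.
    by rewrite opprD expRD; ring.
  pose A := [set z : R * R | 0 < z.1 /\ z.1 < z.2].
  rewrite (@tonelli_region _ g A _ `]0, +oo[ _ (fun q => `]0, q[%classic)); last 5 first.
  - rewrite (_ : A = [set z : R * R | 0 < z.1] `&` [set z | z.1 < z.2])//.
    by apply: measurableI; exact: measurable_lt.
  - apply: measurable_funM.
      apply: measurable_funM; first exact: (measurableT_comp (@measurable_powR R _)).
      by apply: (measurableT_comp (@measurable_powR R _)) => //; exact: measurable_funB.
    have m : measurable_fun setT (fun t : R => expR (- t)) by exact: measurableT_comp.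
    exact: (measurableT_comp m).
  - by move=> z _; rewrite mulr_ge0 ?expR_ge0// mulr_ge0 ?powR_ge0.
  - by move=> x y; rewrite /A/= !in_itv/= !andbT.
  - move=> x y; rewrite /A/= !in_itv/= andbT; split=> [[x0 xy]|[y0 /andP[]]//].
    by rewrite x0 xy (lt_trans x0 xy).
  rewrite muleC -ge0_integralZr//; last 3 first.
  - by apply/measurable_EFinP; exact: measurable_powR_expRN.
  - by move=> x _; rewrite lee_fin mulr_ge0 ?powR_ge0 ?expR_ge0.
  - by apply: integral_ge0 => x _; rewrite lee_fin mulr_ge0 ?powR_ge0.
  apply: eq_integral => q; rewrite inE/= in_itv/= andbT => q0.
  rewrite /g; under eq_integral do rewrite EFinM.
  rewrite ge0_integralZr//; last first.
    by move=> x _; rewrite lee_fin mulr_ge0 ?powR_ge0.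
  by rewrite scal// EFinM muleAC.
move=> r0; rewrite (scal _ r0).
have ab0 : 0 < a + b by rewrite addr_gt0.
suff -> : B = (gam a * gam b / gam (a + b))%:E by rewrite -EFinM.
move: key; rewrite -!GammaE// -EFinM.
have B0 : (0 <= B)%E by apply: integral_ge0 => x _; rewrite lee_fin mulr_ge0 ?powR_ge0.
have := Gamma_gt0 ab0.
case: B B0 {scal} => [B| |] // _ g0.
  by rewrite -EFinM => -[->]; rewrite mulfK// gt_eqF.
by rewrite gt0_mulye.
Qed.
End gamma_function.

(** * Asymptotics of quotients of Gamma values *)

Section gamma_asymptotics.
Context {R : realType}.
Implicit Types (x y z : R) (n m : nat).

Lemma cvgM_seq (u v : nat -> R) (a b : R) : u n @[n --> \oo] --> a ->
  v n @[n --> \oo] --> b -> u n * v n @[n --> \oo] --> a * b.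
Proof. by move=> ua vb; exact: cvgM. Qed.

Lemma eq_cvg_seq (u v : nat -> R) (a : R) : (forall n, u n = v n) ->
  u n @[n --> \oo] --> a -> v n @[n --> \oo] --> a.
Proof. by move=> uv; rewrite (_ : u = v)//; exact/funext. Qed.

Lemma cvgS_seq (u : nat -> R) (a : R) : u n @[n --> \oo] --> a ->
  u n.+1 @[n --> \oo] --> a.
Proof. by move=> ua; have := cvg_shiftS u (nbhs a) => ->. Qed.

Lemma cvgV_seq (u : nat -> R) (a : R) : a != 0 -> u n @[n --> \oo] --> a ->
  (u n)^-1 @[n --> \oo] --> a^-1.
Proof. by move=> a0 ua; exact: cvgV. Qed.

(** From x + z to x + 1 the step is 1 - z, so Wendel's inequality started at x + z gives the
    matching lower bound. *)
Lemma Gamma_Wendel_lower x z : 0 < x -> 0 <= z <= 1 ->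
  x * gam x <= (x + z) `^ (1 - z) * gam (x + z).
Proof.
move=> x0 /andP[z0 z1]; rewrite -GammaS//.
have -> : x + 1 = (x + z) + (1 - z) by ring.
by apply: Gamma_Wendel; [rewrite ltr_wpDr|apply/andP; split; lra].
Qed.

Lemma cvg_powR_ratio (a b c : R) : 0 < a -> 0 < b ->
  ((b + n%:R) / (a + n%:R)) `^ c @[n --> \oo] --> (1 : R).
Proof.
move=> a0 b0.
have H : (b + n%:R) / (a + n%:R) @[n --> \oo] --> (1 : R).
  rewrite -[X in _ --> X](addr0 1).
  have -> : (fun n : nat => (b + n%:R) / (a + n%:R)) =
      (fun n : nat => 1 + (b - a) * (a + n%:R)^-1).
    by apply/funext => n; field; rewrite gt_eqF// ltr_wpDr.
  apply: cvgD; first exact: cvg_cst.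
  rewrite -[X in _ --> X](mulr0 (b - a)); apply: cvgMr.
  apply/gtr0_cvgV0; first by apply: nearW => n; rewrite ltr_wpDr.
  under eq_cvg do rewrite addrC.
  apply/cvgryPge => A; near=> n; rewrite -[leLHS]addr0 lerD ?(ltW a0)//.
  by near: n; exact: nbhs_infty_ger.
have -> : (fun n : nat => ((b + n%:R) / (a + n%:R)) `^ c) =
    (fun n : nat => expR (c * ln ((b + n%:R) / (a + n%:R)))).
  apply/funext => n; rewrite /powR ifF//; apply/negbTE.
  by rewrite mulf_neq0 ?invr_eq0// gt_eqF// ltr_wpDr.
have E : 1 = expR (c * ln 1) :> R by rewrite ln1 mulr0 expR0.
rewrite [X in _ --> X]E; apply: continuous_cvg; first exact: continuous_expR.
apply: cvgMr; apply: continuous_cvg => //.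
exact: continuous_ln.
Unshelve. all: by end_near. Qed.

(** Gauss's limit: the two Wendel inequalities squeeze the quotient between a power of (x + n) / (x
    + z + n) and 1. *)
Lemma cvg_Gamma_ratio x z : 0 < x -> 0 <= z <= 1 ->
  gam (x + z + n%:R) / ((x + n%:R) `^ z * gam (x + n%:R)) @[n --> \oo]
  --> (1 : R).
Proof.
move=> x0 /andP[z0 z1].
have xn n : 0 < x + n%:R by rewrite ltr_wpDr.
have xzn n : 0 < x + z + n%:R by rewrite ltr_wpDr// ltr_wpDr.
have d n : 0 < (x + n%:R) `^ z * gam (x + n%:R) by rewrite mulr_gt0 ?powR_gt0 ?Gamma_gt0.
apply: (@squeeze_cvgr _ _ _ _ (fun n : nat => ((x + n%:R) / (x + z + n%:R)) `^ (1 - z)) (cst 1)).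
- apply: nearW => n; apply/andP; split; last first.
    rewrite ler_pdivrMr// mul1r -addrA (addrC z) addrA.
    by apply: Gamma_Wendel => //; rewrite z0.
  rewrite ler_pdivlMr//.
  have H := @Gamma_Wendel_lower (x + n%:R) z (xn n).
  rewrite z0 z1 in H; have {H} := H isT.
  rewrite -addrA (addrC _ z) addrA => H.
  have -> : ((x + n%:R) / (x + z + n%:R)) `^ (1 - z) =
     (x + n%:R) `^ (1 - z) / (x + z + n%:R) `^ (1 - z).
    rewrite powRM ?(ltW (xn n)) ?invr_ge0 ?(ltW (xzn n))//; congr (_ * _).
    by rewrite -powR_inv1 ?(ltW (xzn n))// powRAC powR_inv1 ?powR_ge0.
  have p : 0 < (x + z + n%:R) `^ (1 - z) by rewrite powR_gt0.
  rewrite mulrAC ler_pdivrMr// mulrA -gt0_powRD// subrK powRr1 ?(ltW (xn n))//.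
  by rewrite [leRHS]mulrC.
- by apply: cvg_powR_ratio => //; rewrite ltr_wpDr.
- exact: cvg_cst.
Qed.

(* The two Gauss limits at x and x + z' combine into this one. *)
Lemma cvg_Gamma_ratio2 x z : 0 < x -> 0 <= z <= 1 ->
  gam (x + n%:R) * (x + n%:R) `^ z / gam (x + z + n%:R) @[n --> \oo]
  --> (1 : R).
Proof.
move=> x0 z01; have := cvg_Gamma_ratio x0 z01.
move=> /cvgV; rewrite invr1 => /(_ (oner_neq0 _)).
apply: cvg_trans; apply: near_eq_cvg; apply: nearW => n.
by rewrite /= invfM invrK mulrC (mulrC (gam _)).
Qed.

Lemma cvg_nat_even (u : nat -> R) (l : R) : u n @[n --> \oo] --> l ->
  u (2 * n)%N @[n --> \oo] --> l.
Proof.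
move=> ul; apply: (@cvg_comp _ _ _ (fun n => (2 * n)%N) u \oo \oo) => //.
apply/cvgnyPge => A; near=> n; rewrite (@leq_trans n)//; last by rewrite leq_pmull.
by near: n; exact: nbhs_infty_ge.
Unshelve. all: by end_near. Qed.

End gamma_asymptotics.

(** * Cosine moments, the source of the sine in the reflection formula *)

Section cosine_moments.
Context {R : realType}.
Notation leb := (@lebesgue_measure R).
Implicit Types (z t : R) (n m : nat).

Lemma sin_le_id t : 0 <= t -> sin t <= t.
Proof.
move=> t0; have := @derive_nondecreasing R (fun t => t - sin t) (fun t => 1 - cos t) 0 t t0.
rewrite sin0 subr0 subr_ge0; apply.
- by move=> x _; apply: is_derive_eq.
- by move=> x _; rewrite subr_ge0 cos_le1.
- by apply: (@within_continuous_derive _ _ (fun t => 1 - cos t)) => x _; apply: is_derive_eq.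
Qed.

Lemma mul_cos_le_sin t : 0 <= t <= pi -> t * cos t <= sin t.
Proof.
move=> /andP[t0 t1].
have d (x : R) : is_derive x 1 (fun t : R => sin t - t * cos t) (x * sin x).
  by apply: is_derive_eq; rewrite /GRing.scale/=; ring.
have := @derive_nondecreasing R (fun t => sin t - t * cos t) (fun t => t * sin t) 0 t t0.
rewrite sin0 mul0r subr0 subr_ge0; apply.
- by move=> x _.
- move=> x; rewrite in_itv/= => /andP[x0 xt]; rewrite mulr_ge0 ?(ltW x0)// sin_ge0_pi//.
  by rewrite (ltW x0) (le_trans (ltW xt)).
- by apply: (@within_continuous_derive _ _ (fun t => t * sin t)).
Qed.

(** Cauchy's integral, whose value is pi Gamma(n+1) / (2^(n+1) Gamma(n/2+1+z) Gamma(n/2+1-z)). Only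
    its recurrence in n, its value at n = 0 and its behaviour for large n are used; they replace the
    infinite product of the sine. *)
Definition cos_moment n z : R :=
  \int[leb]_(t in `[0, pi / 2]) (cos t ^+ n * cos (2 * z * t)).

Lemma is_derive_sinZ (a x : R) : is_derive x 1 (fun t => sin (a * t)) (a * cos (a * x)).
Proof.
have H : is_derive x 1 (fun t : R => a * t) a.
  by apply: is_derive_eq; rewrite /GRing.scale/=; ring.
rewrite mulrC; exact: (is_derive1_comp (is_derive_sin (a * x)) H).
Qed.

Lemma is_derive_cosZ (a x : R) : is_derive x 1 (fun t => cos (a * t)) (- a * sin (a * x)).
Proof.
have H : is_derive x 1 (fun t : R => a * t) a.
  by apply: is_derive_eq; rewrite /GRing.scale/=; ring.
rewrite mulNr -mulrN mulrC; exact: (is_derive1_comp (is_derive_cos (a * x)) H).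
Qed.

Lemma is_derive_cosX n (x : R) :
  is_derive x 1 (fun t => cos t ^+ n.+1) (n.+1%:R * cos x ^+ n * - sin x).
Proof.
have -> : (fun t : R => cos t ^+ n.+1) = cos ^+ n.+1 by apply/funext => t; rewrite fctE.
exact: is_deriveX.
Qed.

Let cont_integrand n z t : {for t, continuous (fun t : R => cos t ^+ n * cos (2 * z * t))}.
Proof.
apply: continuousM; last exact: is_derive_continuous (is_derive_cosZ _ _).
case: n => [|n]; first exact: cvg_cst.
exact: is_derive_continuous (is_derive_cosX _ _).
Qed.

Let integrand_integrable n z :
  leb.-integrable `[0, pi / 2] (EFin \o (fun t : R => cos t ^+ n * cos (2 * z * t))).
Proof.
by apply: continuous_integrable => t; exact: cont_integrand.
Qed.

Let pihalf_ge0 : 0 <= pi / 2 :> R.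
Proof. by rewrite divr_ge0// pi_ge0. Qed.

Lemma cos_moment_rec n z :
  n.+2%:R * n.+1%:R * cos_moment n z = (n.+2%:R ^+ 2 - 4 * z ^+ 2) * cos_moment n.+2 z.
Proof.
(* The Wronskian of cos(2 z t) and cos(t)^(n+2). It vanishes at 0 and at pi / 2, and its derivative
   is the difference of the two integrands. *)
pose W (t : R) := n.+2%:R * cos t ^+ n.+1 * (- sin t) * cos (2 * z * t)
  + 2 * z * cos t ^+ n.+2 * sin (2 * z * t).
pose w (t : R) := n.+2%:R * n.+1%:R * (cos t ^+ n * cos (2 * z * t))
  - (n.+2%:R ^+ 2 - 4 * z ^+ 2) * (cos t ^+ n.+2 * cos (2 * z * t)).
have dW t : is_derive t 1 W (w t).
  have ? := is_derive_sinZ (2 * z) t; have ? := is_derive_cosZ (2 * z) t.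
  have ? := is_derive_cosX n t; have ? := is_derive_cosX n.+1 t.
  rewrite /W /w; apply: is_derive_eq; rewrite /GRing.scale/= !exprS.
  have cs : sin t * sin t = 1 - cos t * cos t by rewrite -[1](cos2Dsin2 t); ring.
  rewrite -[n.+2%:R]natr1 -[n.+1%:R]natr1 !expr0 !mulr1; move: (n%:R : R) (cos t ^+ n) cs => N p.
  move: (cos (2 * z * t)) (sin (2 * z * t)) (cos t) (sin t) => E S c s cs.
  transitivity ((N + 1 + 1) * (N + 1) * p * (s * s) * E - (N + 1 + 1) * c * c * p * E
    + 4 * z * z * c * c * p * E); first by ring.
  by rewrite cs; ring.
have cw t : {for t, continuous w}.
  apply: continuousB; (apply: continuousM; first exact: cvg_cst);
    exact: cont_integrand.
have := @Rintegral_FTC R W w 0 (pi / 2) pihalf_ge0 (fun t _ => dW t) (continuous_subspaceT cw).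
rewrite /W cos_pihalf sin0 mulr0 sin0 !expr0n/= !(mulr0, mul0r, oppr0, addr0, subr0).
rewrite /w RintegralB//=; last 2 first.
- apply: continuous_integrable => t.
  by apply: continuousM; [exact: cvg_cst|exact: cont_integrand].
- apply: continuous_integrable => t.
  by apply: continuousM; [exact: cvg_cst|exact: cont_integrand].
rewrite !RintegralZl//; [|exact: integrand_integrable..].
by move/eqP; rewrite subr_eq0 => /eqP.
Qed.

Lemma cos_moment00 : cos_moment 0 0 = pi / 2.
Proof.
have d (t : R) : 0 <= t <= pi / 2 -> is_derive t 1 id (cos t ^+ 0 * cos (2 * 0 * t)).
  by rewrite expr0 mul1r mulr0 mul0r cos0 => _; exact: is_derive_id.
rewrite /cos_moment (Rintegral_FTC pihalf_ge0 d) ?subr0//.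
by apply: continuous_subspaceT => t; exact: cont_integrand.
Qed.

Lemma cos_moment0 z : z != 0 -> cos_moment 0 z = sin (pi * z) / (2 * z).
Proof.
move=> z0.
have d (t : R) : 0 <= t <= pi / 2 ->
    is_derive t 1 (fun t => (2 * z)^-1 * sin (2 * z * t)) (cos t ^+ 0 * cos (2 * z * t)).
  move=> _; have ? := is_derive_sinZ (2 * z) t.
  by apply: is_derive_eq; rewrite /GRing.scale/= expr0; field.
rewrite /cos_moment (Rintegral_FTC pihalf_ge0 d).
  by rewrite mulr0 sin0 mulr0 subr0 mulrC; congr (sin _ / _); field.
by apply: continuous_subspaceT => t; exact: cont_integrand.
Qed.

Lemma cos_moment_gt0 m : 0 < cos_moment (2 * m) 0.
Proof.
elim: m => [|m IH]; first by rewrite muln0 cos_moment00 divr_gt0 ?pi_gt0.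
have := cos_moment_rec (2 * m) 0; rewrite expr0n/= mulr0 subr0 mulnS !add2n => H.
have : 0 < (2 * m).+2%:R ^+ 2 * cos_moment (2 * m).+2 0 by rewrite -H !mulr_gt0.
by rewrite pmulr_rgt0// exprn_gt0.
Qed.

(** Pointwise, 1 - cos(2 z t) = 2 sin(z t)^2 <= 2 (z t)^2, and t cos t <= sin t. A factor cos(t)^2
    therefore brings the defect below 2 z^2 (1 - cos(t)^2), which integrates to a difference of
    consecutive moments. *)
Lemma cos_moment_near n z : 0 <= z <= 1 ->
  0 <= cos_moment n.+2 0 - cos_moment n.+2 z <= 2 * z ^+ 2 * (cos_moment n 0 - cos_moment n.+2 0).
Proof.
move=> /andP[z0 z1].
have icos k y : leb.-integrable `[0, pi / 2] (EFin \o (fun t : R => cos t ^+ k * cos (2 * y * t))).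
  exact: integrand_integrable.
have -> : cos_moment n.+2 0 - cos_moment n.+2 z =
   \int[leb]_(t in `[0, pi / 2]) (cos t ^+ n.+2 * cos (2 * 0 * t) - cos t ^+ n.+2 * cos (2 * z * t)).
  by rewrite RintegralB.
have -> : 2 * z ^+ 2 * (cos_moment n 0 - cos_moment n.+2 0) =
   \int[leb]_(t in `[0, pi / 2]) (2 * z ^+ 2 * (cos t ^+ n * cos (2 * 0 * t) - cos t ^+ n.+2 * cos (2 * 0 * t))).
  rewrite RintegralZl//; first by rewrite RintegralB.
  apply: continuous_integrable => t.
  by apply: continuousB; exact: cont_integrand.
have pt t : 0 <= t <= pi / 2 -> 0 <= 1 - cos (2 * z * t) /\
    cos t ^+ 2 * (1 - cos (2 * z * t)) <= 2 * z ^+ 2 * (1 - cos t ^+ 2).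
  move=> /andP[t0 t1].
  have -> : 1 - cos (2 * z * t) = 2 * sin (z * t) ^+ 2.
    have -> : 2 * z * t = (z * t) *+ 2 by ring.
    by have := cos2Dsin2 (z * t); rewrite cos_mulr2n; lra.
  split; first by rewrite mulr_ge0// sqr_ge0.
  have zt0 : 0 <= z * t by rewrite mulr_ge0.
  have tp : t <= pi by rewrite (le_trans t1)// ler_pdivrMr// ler_peMr ?pi_ge0// ler1n.
  have s1 : sin (z * t) ^+ 2 <= (z * t) ^+ 2.
    rewrite ler_sqr ?nnegrE// ?sin_le_id// sin_ge0_pi// zt0/=.
    by rewrite (le_trans _ tp)// ler_piMl.
  have c0 : 0 <= cos t.
    by apply: cos_ge0_pihalf; rewrite t1 andbT (le_trans _ t0)// oppr_le0.
  have s2 : (t * cos t) ^+ 2 <= sin t ^+ 2.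
    have m := mul_cos_le_sin; have {m} m : t * cos t <= sin t by apply: m; rewrite t0.
    by rewrite ler_sqr ?nnegrE ?mulr_ge0// (le_trans _ m)// mulr_ge0.
  have <- : sin t ^+ 2 = 1 - cos t ^+ 2 by rewrite -(cos2Dsin2 t); ring.
  apply: (@le_trans _ _ (2 * z ^+ 2 * (t * cos t) ^+ 2)); last first.
    by rewrite ler_wpM2l// mulr_ge0// sqr_ge0.
  have -> : 2 * z ^+ 2 * (t * cos t) ^+ 2 = cos t ^+ 2 * (2 * (z * t) ^+ 2) by ring.
  by rewrite ler_wpM2l ?sqr_ge0// ler_wpM2l.
have cn t k : 0 <= t <= pi / 2 -> 0 <= cos t ^+ k.
  move=> /andP[t0 t1]; apply: exprn_ge0; apply: cos_ge0_pihalf.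
  by rewrite t1 andbT (le_trans _ t0)// oppr_le0.
apply/andP; split.
  apply: Rintegral_ge0 => t; rewrite /= in_itv/= => tI.
  by rewrite mulr0 mul0r cos0 -mulrBr mulr_ge0 ?cn//; case: (pt t tI).
apply: le_Rintegral => //.
- apply: continuous_integrable => t.
  by apply: continuousB; exact: cont_integrand.
- apply: continuous_integrable => t.
  apply: continuousM; first exact: cvg_cst.
  by apply: continuousB; exact: cont_integrand.
move=> t; rewrite /= in_itv/= => tI; have [_ H] := pt t tI.
rewrite mulr0 mul0r cos0 -!mulrBr !mulr1.
have -> : cos t ^+ n.+2 = cos t ^+ n * cos t ^+ 2 by rewrite -exprD addn2.
have := ler_wpM2l (cn t n tI) H; lra.
Qed.

Lemma cvg_cos_moment z : 0 <= z <= 1 ->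
  cos_moment (2 * m.+1) z / cos_moment (2 * m.+1) 0 @[m --> \oo] --> (1 : R).
Proof.
move=> z01.
apply: (@squeeze_cvgr _ _ _ _ (fun m : nat => 1 - 2 * m.+1%:R^-1) (cst 1)).
- apply: nearW => m; have p := cos_moment_gt0 m.+1.
  rewrite mulnS add2n in p *.
  have /andP[h1 h2] := cos_moment_near (2 * m) z01.
  have := cos_moment_rec (2 * m) 0; rewrite expr0n/= mulr0 subr0 => H.
  have {}H : (2 * m).+1%:R * cos_moment (2 * m) 0 = (2 * m).+2%:R * cos_moment (2 * m).+2 0.
    apply: (@mulfI _ (2 * m).+2%:R) => //; rewrite mulrA H; ring.
  apply/andP; split; last by rewrite ler_pdivrMr// mul1r -subr_ge0.
  rewrite ler_pdivlMr//.
  set B := cos_moment (2 * m).+2 0 in p h1 h2 H *.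
  set A := cos_moment (2 * m) 0 in h2 H.
  set C := cos_moment _ z in h1 h2 *.
  (* Consecutive even moments at z = 0 differ by a relative 1/(2m+1), which makes the relative
     defect of the moment at z tend to 0. *)
  have e1 : (2 * m).+1%:R * (A - B) = B.
    rewrite mulrBr H -mulrBl -[X in X - _]natr1 addrAC subrr add0r mul1r.
    by [].
  have q : (0 : R) < (2 * m).+1%:R by [].
  have e2 : A - B = B / (2 * m).+1%:R by rewrite -[X in _ = X / _]e1 mulrAC mulfV ?mul1r// gt_eqF.
  have z2 : z ^+ 2 <= 1 by case/andP: z01 => z0 z1; rewrite expr_le1.
  have i1 : (2 * m).+1%:R^-1 <= m.+1%:R^-1 :> R.
    by rewrite lef_pV2 ?posrE// ler_nat ltnS leq_pmull.
  have h3 : 2 * z ^+ 2 * (A - B) <= 2 * m.+1%:R^-1 * B.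
    have v0 : 0 <= B / (2 * m).+1%:R by rewrite divr_ge0 ?ltW.
    have v1 : B / (2 * m).+1%:R <= m.+1%:R^-1 * B by rewrite mulrC ler_wpM2r ?(ltW p).
    rewrite e2; have := ler_wpM2r v0 z2; rewrite mul1r => v2.
    rewrite -!mulrA ler_pM2l// !mulrA; apply: (le_trans _ v1).
    by rewrite -mulrA.
  by have h4 := le_trans h2 h3; rewrite mulrBl mul1r lerBlDr -lerBlDl.
- rewrite -[X in _ --> X]subr0; apply: cvgB; first exact: cvg_cst.
  rewrite -[X in _ --> X](mulr0 (2 : R)); apply: cvgMr; exact: cvg_harmonic.
- exact: cvg_cst.
Qed.

End cosine_moments.

(** * Reflection, duplication and half-step inequalities *)

Section gamma_identities.
Context {R : realType}.
Implicit Types (x y z a b : R) (n m : nat).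

Lemma cvg_Gamma_reflection z : 0 <= z < 1 ->
  gam (1 + z + m%:R) * gam (1 - z + m%:R) / gam (1 + m%:R) ^+ 2 @[m --> \oo]
  --> (1 : R).
Proof.
move=> /andP[z0 z1]; have z01 : 0 <= z <= 1 by rewrite z0 ltW.
have y0 : 0 < 1 - z by rewrite subr_gt0.
have h1 := @cvg_Gamma_ratio R 1 z ltr01 z01.
have h2 := @cvg_Gamma_ratio2 R (1 - z) z y0 z01.
have h3 := @cvg_powR_ratio R (1 - z) 1 z y0 ltr01.
have := cvgM_seq (cvgM_seq h1 h2) h3; rewrite !mulr1 subrK => H.
apply: eq_cvg_seq H => n.
have p1 : 0 < 1 + n%:R :> R by rewrite ltr_wpDr.
have p2 : 0 < 1 - z + n%:R by rewrite ltr_wpDr.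
rewrite (powRM _ (ltW p1)) ?invr_ge0 ?(ltW p2)//.
have -> : (1 - z + n%:R)^-1 `^ z = ((1 - z + n%:R) `^ z)^-1.
  by rewrite -(powR_inv1 (ltW p2)) powRAC powR_inv1 ?powR_ge0.
have q1 : (1 + n%:R) `^ z != 0 by rewrite gt_eqF// powR_gt0.
have q2 : (1 - z + n%:R) `^ z != 0 by rewrite gt_eqF// powR_gt0.
have q3 : gam (1 + n%:R) != 0 :> R by rewrite gt_eqF// Gamma_gt0.
move: q1 q2 q3; move: (_ `^ z) (_ `^ z) (gam (1 + n%:R)) => A B C q1 q2 q3.
by field; rewrite q1 q2 q3.
Qed.

(** The product [g m * r m] does not depend on m: the functional equation of Gamma compensates the
    recurrence of the moments. Its limit is 1, and its value at m = 0 is the quotient of the two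
    sides. *)
Lemma Gamma_reflection z : 0 < z < 1 ->
  gam (1 + z) * gam (1 - z) * sin (pi * z) = pi * z.
Proof.
move=> /andP[z0 z1].
have z01 : 0 <= z <= 1 by rewrite !ltW.
pose r m := cos_moment (2 * m) z / cos_moment (2 * m) 0.
pose g m := gam (1 + z + m%:R) * gam (1 - z + m%:R) / gam (1 + m%:R) ^+ 2.
have p0 m : 0 < 1 + m%:R :> R by rewrite ltr_wpDr.
have p1 m : 0 < 1 + z + m%:R by rewrite ltr_wpDr// ltr_wpDr// ltW.
have p2 m : 0 < 1 - z + m%:R by rewrite ltr_wpDr// subr_gt0.
have cst m : g m * r m = g 0%N * r 0%N.
  elim: m => // m <-.
  have e1 : r m = (1 - z ^+ 2 / (1 + m%:R) ^+ 2) * r m.+1.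
    rewrite /r; have c0 := cos_moment_gt0 (R := R) m.
    have c1 := cos_moment_gt0 (R := R) m.+1.
    have := cos_moment_rec (2 * m) z; have := cos_moment_rec (2 * m) (0 : R).
    rewrite mulnS !add2n in c1 *.
    rewrite expr0n/= mulr0 subr0 => h0 h1.
    have k1 : (2 * m).+2%:R = 2 * (1 + m%:R) :> R.
      by rewrite -add2n natrD natrM; ring.
    rewrite k1 in h0 h1.
    have k2 : 0 < (2 * m).+1%:R :> R by [].
    have c0' := lt0r_neq0 c0; have c1' := lt0r_neq0 c1.
    have k2' := lt0r_neq0 k2; have p0' := lt0r_neq0 (p0 m).
    move: c0' c1' k2' p0' h0 h1 {c0 c1 k1 k2}; move: (cos_moment _.+2 z) (cos_moment _.+2 0).
    move: (cos_moment _ z) (cos_moment _ 0) (_.+1%:R) (1 + m%:R) => A B K M C D B0 D0 K0 M0 h0 h1.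
    have -> : A = ((2 * M) ^+ 2 - 4 * z ^+ 2) * C / (2 * M * K).
      by rewrite -h1; field; rewrite K0 M0.
    have -> : B = (2 * M) ^+ 2 * D / (2 * M * K).
      by rewrite -h0; field; rewrite K0 M0.
    by field; rewrite D0 K0 M0.
  rewrite e1 /g -natr1 !addrA !GammaS//.
  have q1 := lt0r_neq0 (p0 m); have q2 := lt0r_neq0 (Gamma_gt0 (p0 m)).
  have -> : 1 + z + m%:R = z + (1 + m%:R) by ring.
  have -> : 1 - z + m%:R = (1 + m%:R) - z by ring.
  move: q1 q2; move: (1 + m%:R) => M; move: (gam M) (gam (z + M)) (gam (M - z)) (r _).
  by move=> A B C D q1 q2; field; rewrite q1 q2.
have cg : g m @[m --> \oo] --> (1 : R) by apply: cvg_Gamma_reflection; rewrite z1 ltW.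
have cr : r m.+1 @[m --> \oo] --> (1 : R) by exact: cvg_cos_moment.
have cgS : g m.+1 @[m --> \oo] --> (1 : R) by exact: (cvgS_seq cg).
have : g m.+1 * r m.+1 @[m --> \oo] --> (1 * 1 : R) by exact: cvgM.
have -> : (fun m => g m.+1 * r m.+1) = (fun=> g 0%N * r 0%N) by apply/funext => m.
move=> /(cvg_lim _); rewrite lim_cst// mulr1 => /(_ (@Rhausdorff R)).
rewrite /g /r muln0 cos_moment00 cos_moment0 ?gt_eqF// !addr0 Gamma1 expr1n divr1 => H.
have pp : pi != 0 :> R by rewrite gt_eqF// pi_gt0.
have zz : z != 0 by rewrite gt_eqF.
rewrite -[RHS]mulr1 -[X in _ = _ * X]H.
move: pp; move: (gam (1 + z)) (gam (1 - z)) (sin (pi * z)) => A B C.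
by move: (pi : R) => p pp; field; rewrite ?pp ?zz.
Qed.

Lemma Gamma_half_sqr : gam (1 / 2) ^+ 2 = pi :> R.
Proof.
have h : (0 < (1 / 2 : R)) && ((1 / 2 : R) < 1) by apply/andP; split; lra.
have := Gamma_reflection h.
have -> : pi * (1 / 2) = pi / 2 :> R by rewrite mulrA mulr1.
rewrite sin_pihalf mulr1 addrC GammaS; last lra.
have -> : 1 - 1 / 2 = 1 / 2 :> R by field.
by move=> H; have -> : pi = 2 * (pi / 2) :> R; [field|rewrite -H; field].
Qed.

Lemma Gamma_half : gam (1 / 2) = Num.sqrt pi :> R.
Proof.
have g : 0 < gam (1 / 2) :> R by apply: Gamma_gt0; lra.
by rewrite -Gamma_half_sqr sqrtr_sqr gtr0_norm.
Qed.

(** Reduces the duplication formula to the segment [1, 2], where Gauss's limit with 0 <= z <= 1 is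
    available. *)
Lemma shift_invariant_eq (D : R -> R) :
  (forall x, 0 < x -> D (x + 1) = D x) ->
  (forall z, 0 <= z <= 1 -> D (1 + z) = D 1) ->
  forall x, 0 < x -> D x = D 1.
Proof.
move=> D1 Dz x x0.
have [n xn] : exists n : nat, x <= n.+1%:R.
  by exists (Num.truncn x); apply/ltW/truncnS_gt.
elim: n x x0 xn => [|n IH] x x0 xn.
  by rewrite -D1// addrC Dz// (ltW x0) xn.
have [x1|x1] := leP x 1; first by rewrite -D1// addrC Dz// (ltW x0) x1.
rewrite -(subrK 1 x) D1 ?subr_gt0// IH ?subr_gt0//.
by rewrite lerBlDr natr1.
Qed.

Lemma Gamma_duplication x : 0 < x ->
  2 `^ x * (gam (x / 2) * gam ((x + 1) / 2)) = 2 * Num.sqrt pi * gam x.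
Proof.
move=> x0.
pose D x := 2 `^ x * (gam (x / 2) * gam ((x + 1) / 2)) / gam x.
have t0 : 0 < 2 :> R by [].
have DS y : 0 < y -> D (y + 1) = D y.
  move=> y0; rewrite /D GammaS// (gt0_powRD _ _ t0) powRr1//.
  have -> : (y + 1 + 1) / 2 = y / 2 + 1 by field.
  rewrite GammaS ?divr_gt0//; have g := lt0r_neq0 (Gamma_gt0 y0); have y' := lt0r_neq0 y0.
  by field; rewrite g y'.
have D1 : D 1 = 2 * Num.sqrt pi.
  rewrite /D Gamma1 divr1 powRr1// Gamma_half.
  by have -> : (1 + 1) / 2 = 1 :> R; [field|rewrite Gamma1 mulr1].
have Dz z : 0 <= z <= 1 -> D (1 + z) = D 1.
  move=> z01; have /andP[z0 z1] := z01.
  (* The shifts are even because they move the halved arguments by n. The quotient of D(1 + z) and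
     D(1) then equals its own limit along these shifts, in which all the powers cancel. *)
  have Dm y n : 0 < y -> D (y + (2 * n)%:R) = D y.
    move=> y0; elim: (2 * n)%N => [|k IH]; first by rewrite addr0.
    by rewrite -natr1 addrA DS ?ltr_wpDr.
  have zh : 0 <= z / 2 <= 1 by apply/andP; split; lra.
  have hp : 0 < 1 / 2 :> R by lra.
  have a1 := @cvg_Gamma_ratio R (1 / 2) (z / 2) hp zh.
  have a2 := @cvg_Gamma_ratio R 1 (z / 2) ltr01 zh.
  have a3 := cvg_nat_even (@cvg_Gamma_ratio2 R 1 z ltr01 z01).
  have a4 := @cvg_powR_ratio R (1 / 2) 1 (z / 2) hp ltr01.
  have : D (1 + z + (2 * n)%:R) / D (1 + (2 * n)%:R) @[n --> \oo] --> (1 : R).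
    have := cvgM_seq (cvgM_seq (cvgM_seq a1 a2) a3) a4; rewrite !mulr1 => H.
    apply: eq_cvg_seq H => n.
    have p1 : 0 < 1 + n%:R :> R by rewrite ltr_wpDr.
    have p2 : 0 < 1 / 2 + n%:R :> R by rewrite ltr_wpDr.
    have p3 : 0 < 1 + (2 * n)%:R :> R by rewrite ltr_wpDr.
    have p4 : 0 < 1 + z + (2 * n)%:R :> R by rewrite ltr_wpDr// ltr_wpDr.
    rewrite /D.
    have -> : (1 + z + (2 * n)%:R) / 2 = 1 / 2 + z / 2 + n%:R by rewrite natrM; field.
    have -> : (1 + z + (2 * n)%:R + 1) / 2 = 1 + z / 2 + n%:R by rewrite natrM; field.
    have -> : (1 + (2 * n)%:R) / 2 = 1 / 2 + n%:R :> R by rewrite natrM; field.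
    have -> : (1 + (2 * n)%:R + 1) / 2 = 1 + n%:R :> R by rewrite natrM; field.
    have -> : 2 `^ (1 + z + (2 * n)%:R) = 2 `^ z * 2 `^ (1 + (2 * n)%:R).
      by rewrite -gt0_powRD//; congr (_ `^ _); ring.
    rewrite (powRM _ (ltW p1)) ?invr_ge0 ?(ltW p2)//.
    have -> : (1 / 2 + n%:R)^-1 `^ (z / 2) = ((1 / 2 + n%:R) `^ (z / 2))^-1.
      by rewrite -(powR_inv1 (ltW p2)) powRAC powR_inv1 ?powR_ge0.
    have e : (1 + (2 * n)%:R) `^ z =
        2 `^ z * ((1 / 2 + n%:R) `^ (z / 2)) ^+ 2.
      rewrite -[_ ^+ 2]powR_mulrn ?powR_ge0// -powRrM.
      have -> : z / 2 * 2%:R = z by field.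
      rewrite -powRM ?ler0n// ?(ltW p2)//; congr (_ `^ _).
      by rewrite natrM; field.
    rewrite e.
    have q1 := lt0r_neq0 (Gamma_gt0 p1); have q2 := lt0r_neq0 (Gamma_gt0 p2).
    have q3 := lt0r_neq0 (Gamma_gt0 p3); have q4 := lt0r_neq0 (Gamma_gt0 p4).
    have q5 : 2 `^ z != 0 by rewrite gt_eqF// powR_gt0.
    have q6 : 2 `^ (1 + (2 * n)%:R) != 0 :> R by rewrite gt_eqF// powR_gt0.
    have q7 : (1 / 2 + n%:R) `^ (z / 2) != 0 by rewrite gt_eqF// powR_gt0.
    have q8 : (1 + n%:R) `^ (z / 2) != 0 by rewrite gt_eqF// powR_gt0.
    move: q1 q2 q3 q4 q5 q6 q7 q8.
    move: (gam (1 + n%:R)) (gam (1 / 2 + n%:R)) (gam (1 + (2 * n)%:R)) (gam (1 + z + (2 * n)%:R)).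
    move: (2 `^ z) (2 `^ (1 + _)) ((1 / 2 + n%:R) `^ (z / 2)) ((1 + n%:R) `^ (z / 2)).
    move: (gam (1 / 2 + z / 2 + n%:R)) (gam (1 + z / 2 + n%:R)).
    move=> A B C1 C2 C3 C4 C5 C6 C7 C8 H1 H2 H3 H4 H5 H6 H7 H8.
    by field; rewrite H1 H2 H3 H4 ?H5 H6 H7 H8.
  have z1' : 0 < 1 + z by rewrite ltr_wpDr.
  have -> : (fun n => D (1 + z + (2 * n)%:R) / D (1 + (2 * n)%:R)) = fun=> D (1 + z) / D 1.
    by apply/funext => n; rewrite !Dm.
  move=> /(cvg_lim _); rewrite lim_cst// => /(_ (@Rhausdorff R)) H.
  have d1 : D 1 != 0 by rewrite D1 mulf_neq0// gt_eqF// sqrtr_gt0 pi_gt0.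
  by rewrite -[LHS](divfK d1) H mul1r.
have := shift_invariant_eq DS Dz x0; rewrite D1 /D => <-.
by rewrite divfK// gt_eqF// Gamma_gt0.
Qed.

(** Normalised to tend to 1 along x + n. A unit step multiplies it by the rational factor 1 + 1/(4 x
    (x+1)), and the half-step inequalities below result from comparing it with this limit. *)
Definition gamma_quot x : R := gam (x + 1 / 2) ^+ 2 / (x * gam x ^+ 2).

Lemma gamma_quot_gt0 x : 0 < x -> 0 < gamma_quot x.
Proof.
by move=> x0; rewrite divr_gt0 ?mulr_gt0 ?exprn_gt0 ?Gamma_gt0 ?addr_gt0.
Qed.

Lemma gamma_quotS x : 0 < x -> gamma_quot (x + 1) = (1 + (4 * x * (x + 1))^-1) * gamma_quot x.
Proof.
move=> x0; rewrite /gamma_quot addrAC !GammaS//; last by rewrite addr_gt0.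
have h1 := lt0r_neq0 x0; have h2 := lt0r_neq0 (Gamma_gt0 x0).
have h3 : x + 1 != 0 by rewrite gt_eqF// addr_gt0.
by field; rewrite h1 h2 h3.
Qed.

Lemma cvg_gamma_quot x : 0 < x -> gamma_quot (x + n%:R) @[n --> \oo] --> (1 : R).
Proof.
move=> x0.
have hz : (0 <= (1 / 2 : R)) && ((1 / 2 : R) <= 1) by apply/andP; split; lra.
have h := cvg_Gamma_ratio x0 hz.
have := cvgM_seq h h; rewrite mulr1 => H; apply: eq_cvg_seq H => n.
have p : 0 < x + n%:R by rewrite ltr_wpDr.
rewrite /gamma_quot addrAC.
have e : (x + n%:R) = ((x + n%:R) `^ (1 / 2)) ^+ 2.
  by rewrite -[_ ^+ 2]powR_mulrn ?powR_ge0// -powRrM divfK// powRr1// ltW.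
rewrite [X in _ = _ / (X * _)]e.
have h2 := lt0r_neq0 (Gamma_gt0 p).
have h3 : (x + n%:R) `^ (1 / 2) != 0 by rewrite gt_eqF// powR_gt0.
by field; rewrite h2 h3.
Qed.

(** The unit-step factor decreases in x, so the quotient of the values at a + n and b + n increases
    with n towards its limit 1. *)
Lemma gamma_quot_le a b : 0 < a -> a <= b -> gamma_quot a <= gamma_quot b.
Proof.
move=> a0 ab; have b0 := lt_le_trans a0 ab.
pose u n := gamma_quot (a + n%:R) / gamma_quot (b + n%:R).
have pa n : 0 < a + n%:R by rewrite ltr_wpDr.
have pb n : 0 < b + n%:R by rewrite ltr_wpDr.
have cu : u n @[n --> \oo] --> (1 : R).
  have := cvgM_seq (cvg_gamma_quot a0) (cvgV_seq (oner_neq0 _) (cvg_gamma_quot b0)).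
  by rewrite invr1 mulr1.
have nd : nondecreasing_seq u.
  apply/nondecreasing_seqP => n; rewrite /u -natr1 !addrA !gamma_quotS//.
  have ga := gamma_quot_gt0 (pa n); have gb := gamma_quot_gt0 (pb n).
  have : a + n%:R <= b + n%:R by rewrite lerD2r.
  move: (pa n) (pb n) ga gb; move: (a + n%:R) (b + n%:R) (gamma_quot (a + n%:R)) (gamma_quot (b + n%:R)).
  move=> x y g h x0 y0 g0 h0 xy.
  have px : 0 < 4 * x * (x + 1) by rewrite !mulr_gt0// addr_gt0.
  have py : 0 < 4 * y * (y + 1) by rewrite !mulr_gt0// addr_gt0.
  have le : 1 + (4 * y * (y + 1))^-1 <= 1 + (4 * x * (x + 1))^-1.
    by rewrite lerD2l lef_pV2 ?posrE//; nra.
  have : 0 < 1 + (4 * y * (y + 1))^-1 by rewrite addr_gt0// invr_gt0.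
  move: le; move: (1 + _) (1 + _) => X Y le Y0.
  have -> : X * g / (Y * h) = (X / Y) * (g / h) by field; rewrite !gt_eqF.
  by rewrite ler_peMl ?divr_ge0 ?(ltW g0) ?(ltW h0)// ler_pdivlMr// mul1r.
have := nondecreasing_cvgn_le nd (cvgP _ cu) 0%N.
by rewrite (cvg_lim _ cu)// /u !addr0 ler_pdivrMr ?mul1r// gamma_quot_gt0.
Qed.

Lemma Gamma_half_ratio_le a b : 0 < a -> a <= b ->
  gam (a + 1 / 2) / gam a <= gam (b + 1 / 2) / gam b.
Proof.
move=> a0 ab; have b0 := lt_le_trans a0 ab.
have e x : 0 < x -> (gam (x + 1 / 2) / gam x) ^+ 2 = x * gamma_quot x.
  move=> x0; rewrite /gamma_quot; have h1 := lt0r_neq0 x0; have h2 := lt0r_neq0 (Gamma_gt0 x0).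
  by field; rewrite h1 h2.
have p x : 0 < x -> 0 <= gam (x + 1 / 2) / gam x.
  by move=> x0; rewrite divr_ge0 ?ltW ?Gamma_gt0// addr_gt0.
rewrite -ler_sqr ?nnegrE ?p// !e// ler_pM ?(ltW a0) ?gamma_quot_le//.
by rewrite ltW// gamma_quot_gt0.
Qed.

(** The constant 1/4 is the asymptotic one: Gamma(x+1/2)^2 / Gamma(x)^2 = x - 1/4 + o(1). Divided by
    x - 1/4, the left side of this expansion decreases to 1 along x + n. *)
Lemma Gamma_half_ratio_lower x : 1 / 4 < x ->
  (x - 1 / 4) * gam x ^+ 2 <= gam (x + 1 / 2) ^+ 2.
Proof.
move=> x4; have x0 : 0 < x by lra.
pose u n := gamma_quot (x + n%:R) * ((x + n%:R) / (x - 1 / 4 + n%:R)) `^ 1.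
have y0 : 0 < x - 1 / 4 by lra.
have p n : 0 < x + n%:R by rewrite ltr_wpDr.
have q n : 0 < x - 1 / 4 + n%:R by rewrite ltr_wpDr.
have cu : u n @[n --> \oo] --> (1 : R).
  rewrite -[X in _ --> X](mulr1 1).
  by apply: cvgM; [exact: cvg_gamma_quot|exact: cvg_powR_ratio].
have ni : nonincreasing_seq u.
  apply/nonincreasing_seqP => n; rewrite /u !powRr1 ?divr_ge0 ?(ltW (p _)) ?(ltW (q _))//.
  rewrite -natr1 !addrA gamma_quotS//.
  have g0 := gamma_quot_gt0 (p n).
  have -> : x - 1 / 4 + n%:R = (x + n%:R) - 1 / 4 by ring.
  have := q n; have -> : x - 1 / 4 + n%:R = (x + n%:R) - 1 / 4 by ring.
  move: (p n) g0; move: (x + n%:R) (gamma_quot (x + n%:R)) => y g y1 g1 y2.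
  rewrite [leLHS](_ : _ = g * ((y + 1) / (y - 1 / 4 + 1) * (1 + (4 * y * (y + 1))^-1))); last first.
    by move: ((y + 1) / _) (1 + _) => a b; ring.
  rewrite ler_pM2l//.
  have y3 : 0 < y - 1 / 4 + 1 by rewrite addr_gt0.
  have y4 : 0 < y + 1 by rewrite addr_gt0.
  rewrite -subr_ge0.
  have -> : y / (y - 1 / 4) - (y + 1) / (y - 1 / 4 + 1) * (1 + (4 * y * (y + 1))^-1) =
     (16 * y * (y - 1 / 4) * (y - 1 / 4 + 1))^-1.
    by field; apply/and4P; split; apply: lt0r_neq0 => //; lra.
  by rewrite invr_ge0 !mulr_ge0 ?ltW.
have := nonincreasing_cvgn_ge ni (cvgP _ cu) 0%N.
rewrite (cvg_lim _ cu)// /u !addr0 powRr1 ?divr_ge0 ?(ltW x0) ?(ltW y0)//.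
rewrite /gamma_quot mulrA ler_pdivlMr// mul1r.
have g0 := Gamma_gt0 x0; have g0' := lt0r_neq0 g0; have x0' := lt0r_neq0 x0.
have -> : gam (x + 1 / 2) ^+ 2 / (x * gam x ^+ 2) * x = gam (x + 1 / 2) ^+ 2 / gam x ^+ 2.
  by field; rewrite g0' x0'.
by rewrite ler_pdivlMr ?exprn_gt0// !mul1r.
Qed.

End gamma_identities.

(** * Fractional integrals of Legendre polynomials *)

Section legendre_coefficients.
Context {R : realType}.
Implicit Types (n i k : nat) (p q : {poly R}) (s t : R).

(** Coefficient of t^i in P_n(1 - t) = 2F1(-n, n+1; 1; t/2), through the ratio of consecutive
    terms. *)
Fixpoint lcoef n i : R :=
  if i is i'.+1 then
    - ((n%:R - i'%:R) * (n%:R + i'%:R + 1)) / (2 * (i'%:R + 1) ^+ 2) * lcoef n i'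
  else 1.

Lemma nat1_neq0 k : k%:R + 1 != 0 :> R.
Proof. by rewrite natr1 pnatr_eq0. Qed.

Lemma lcoefS n i : 2 * (i%:R + 1) ^+ 2 * lcoef n i.+1 =
  - ((n%:R - i%:R) * (n%:R + i%:R + 1)) * lcoef n i.
Proof. by rewrite /= -/lcoef; have h := nat1_neq0 i; field; rewrite h. Qed.

Lemma lcoef_gt n i : (n < i)%N -> lcoef n i = 0.
Proof.
elim: i => // i IH; rewrite ltnS leq_eqVlt => /predU1P[->|/IH /= ->]; last by rewrite mulr0.
by rewrite /= subrr mul0r oppr0 !mul0r.
Qed.

(** A common factor for three consecutive degrees. Quotients of coefficients would break down for
    large i, where they vanish; through [w] the contiguous relations become rational identities
    valid for all i. *)
Lemma lcoef3 n i : exists w,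
  [/\ lcoef n i = (n%:R + 1 - i%:R) * (n%:R + 2 - i%:R) * w,
      lcoef n.+1 i = (n%:R + 1 + i%:R) * (n%:R + 2 - i%:R) * w &
      lcoef n.+2 i = (n%:R + 1 + i%:R) * (n%:R + 2 + i%:R) * w].
Proof.
have e1 : n.+1%:R = n%:R + 1 :> R by rewrite natr1.
have e2 : n.+2%:R = n%:R + 2 :> R by rewrite -addn2 natrD.
have h1 : n%:R + 1 != 0 :> R by exact: nat1_neq0.
have h2 : n%:R + 2 != 0 :> R by rewrite -e2 pnatr_eq0.
elim: i => [|i [w [E0 E1 E2]]].
  by exists ((n%:R + 1) * (n%:R + 2))^-1 => /=; split; rewrite !(subr0, addr0); field; rewrite h1 h2.
have hi := nat1_neq0 i.
exists (- ((n%:R + i%:R + 1) * (n%:R + 2 - i%:R)) / (2 * (i%:R + 1) ^+ 2) * w).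
rewrite /= E0 E1 E2 e1 e2 -!natr1; move: (n%:R : R) (i%:R : R) hi => N I hi.
by split; field; rewrite hi.
Qed.

Lemma lcoef_deriv n i : (i%:R + 1) * (lcoef n.+2 i.+1 - lcoef n i.+1) =
  - (2 * n%:R + 3) * lcoef n.+1 i.
Proof.
have [w [E0 E1 E2]] := lcoef3 n i.
have e2 : n.+2%:R = n%:R + 2 :> R by rewrite -addn2 natrD.
rewrite /= E0 E1 E2 e2; have := nat1_neq0 i; move: (n%:R : R) (i%:R : R) => N I hi.
by field; rewrite hi.
Qed.

Lemma lcoef_mulX n i : (2 * n%:R + 3) * (lcoef n.+1 i.+1 - lcoef n.+1 i) =
  (n%:R + 2) * lcoef n.+2 i.+1 + (n%:R + 1) * lcoef n i.+1.
Proof.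
have [w [E0 E1 E2]] := lcoef3 n i.
have e1 : n.+1%:R = n%:R + 1 :> R by rewrite natr1.
have e2 : n.+2%:R = n%:R + 2 :> R by rewrite -addn2 natrD.
rewrite /= E0 E1 E2 e1 e2; have := nat1_neq0 i; move: (n%:R : R) (i%:R : R) => N I hi.
by field; rewrite hi.
Qed.

(* The Legendre polynomial in the variable t = 1 - x. *)
Definition legq n : {poly R} := \poly_(i < n.+1) lcoef n i.

Lemma coef_legq n i : (legq n)`_i = lcoef n i.
Proof. by rewrite coef_poly; case: ltnP => // ni; rewrite lcoef_gt. Qed.

Lemma legq0 : legq 0 = 1.
Proof. by apply/polyP => i; rewrite coef_legq coef1; case: i => // i; rewrite lcoef_gt. Qed.

Lemma legq1 : legq 1 = 1 - 'X.
Proof.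
apply/polyP => i; rewrite coef_legq coefB coef1 coefX.
case: i => [|[|i]]; first by rewrite subr0.
  by rewrite /= sub0r; field.
by rewrite lcoef_gt// subr0.
Qed.

Lemma legq_deriv n : (legq n.+2 - legq n)^`() = - (2 * n%:R + 3) *: legq n.+1.
Proof.
by apply/polyP => i; rewrite coef_deriv coefB coefZ !coef_legq -lcoef_deriv natr1 mulr_natl.
Qed.

Lemma legq_mulX n : (2 * n%:R + 3) *: ((1 - 'X) * legq n.+1) =
  (n%:R + 2) *: legq n.+2 + (n%:R + 1) *: legq n.
Proof.
apply/polyP => i; rewrite mulrBl mul1r coefZ coefB coefXM coefD !coefZ !coef_legq.
case: i => [|i]; first by rewrite /= subr0; ring.
by rewrite -lcoef_mulX.
Qed.

Lemma legq_at0 n : (legq n).[0] = 1.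
Proof. by rewrite horner_coef0 coef_legq. Qed.

Lemma legq_ode n : 'X * (2%:P - 'X) * (legq n)^`()^`() + 2 *: ((1 - 'X) * (legq n)^`())
  + (n%:R * (n%:R + 1)) *: legq n = 0.
Proof.
have cXd (q : {poly R}) i : ('X * q^`())`_i = i%:R * q`_i.
  by rewrite coefXM; case: i => [|i]; rewrite ?mul0r// coef_deriv mulr_natl.
set p := legq n.
have -> : 'X * (2%:P - 'X) * p^`()^`() + 2 *: ((1 - 'X) * p^`()) =
    2 *: ('X * p^`()^`()) - 'X * ('X * p^`())^`() - 'X * p^`() + 2 *: p^`().
  rewrite derivM derivX mul1r -!mul_polyC; ring.
apply/polyP => i; rewrite coef0 !(coefD, coefN, coefZ) !cXd.
have -> : p^`()`_i = (i%:R + 1) * p`_i.+1 by rewrite coef_deriv natr1 mulr_natl.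
rewrite !coef_legq; have := lcoefS n i.
move: (lcoef n i.+1) (lcoef n i) (i%:R : R) (n%:R : R) => A B I N H.
have -> : 2 * (I * ((I + 1) * A)) - I * (I * B) - I * B + 2 * ((I + 1) * A) + N * (N + 1) * B =
  2 * (I + 1) ^+ 2 * A + (N - I) * (N + I + 1) * B by ring.
by rewrite H; ring.
Qed.

End legendre_coefficients.

Section fractional_integral_poly.
Context {R : realType}.
Implicit Types (n i k : nat) (p q : {poly R}) (s t : R).

(* The Riemann-Liouville integral of order s of p from 0 to t. *)
Definition fracp s p t : R :=
  \sum_(i < size p) p`_i * i`!%:R / gam (i%:R + 1 + s) * t `^ (i%:R + s).

Lemma fracpE N s p t : (size p <= N)%N ->
  fracp s p t = \sum_(i < N) p`_i * i`!%:R / gam (i%:R + 1 + s) * t `^ (i%:R + s).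
Proof.
move=> pN; rewrite /fracp; set F := fun i : nat => p`_i * i`!%:R / gam (i%:R + 1 + s) * t `^ (i%:R + s).
rewrite (big_ord_widen N F pN) [RHS](bigID (fun i : 'I_N => (i < size p)%N))/=.
rewrite [X in _ = _ + X]big1 ?addr0// => i; rewrite -leqNgt => pi.
by rewrite nth_default// !mul0r.
Qed.

Lemma fracpD s p q t : fracp s (p + q) t = fracp s p t + fracp s q t.
Proof.
pose N := maxn (size p) (size q).
rewrite (@fracpE N _ (p + q)) ?size_polyD// (@fracpE N _ p) ?leq_maxl// (@fracpE N _ q) ?leq_maxr//.
by rewrite -big_split/=; apply: eq_bigr => i _; rewrite coefD; ring.
Qed.

Lemma fracpZ s a p t : fracp s (a *: p) t = a * fracp s p t.
Proof.
rewrite (@fracpE (size p)) ?size_scale_leq// /fracp big_distrr/=.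
by apply: eq_bigr => i _; rewrite coefZ -!mulrA.
Qed.

Lemma fracpB s p q t : fracp s (p - q) t = fracp s p t - fracp s q t.
Proof. by rewrite fracpD -scaleN1r fracpZ mulN1r. Qed.

Lemma Gamma_nat i : gam (i%:R + 1) = i`!%:R :> R.
Proof.
elim: i => [|i IH]; first by rewrite add0r Gamma1.
by rewrite -natr1 GammaS ?ltr_wpDl// IH factS natrM natr1.
Qed.

Lemma fracp0 p t : 0 <= t -> fracp 0 p t = p.[t].
Proof.
move=> t0; rewrite horner_coef; apply: eq_bigr => i _.
rewrite !addr0 Gamma_nat powR_mulrn// mulfK// pnatr_eq0 -lt0n fact_gt0//.
Qed.

Lemma fracp_deriv s p t : p.[0] = 0 -> fracp (s + 1) p^`() t = fracp s p t.
Proof.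
rewrite horner_coef0 => p0.
rewrite (@fracpE (size p) (s + 1)); last first.
  by rewrite (leq_trans (size_poly _ _))// leq_pred.
rewrite (@fracpE (size p).+1 s p)// big_ord_recl p0 !mul0r add0r.
apply: eq_bigr => i _; rewrite coef_deriv lift0 factS natrM -[_ *+ i.+1]mulr_natl -natr1.
have -> : i%:R + 1 + (s + 1) = i%:R + 1 + 1 + s by ring.
have -> : i%:R + (s + 1) = i%:R + 1 + s by ring.
by congr (_ / _ * _); ring.
Qed.

Lemma fracp_at0 s p : 0 < s -> fracp s p 0 = 0.
Proof.
move=> s0; rewrite /fracp big1// => i _; rewrite powR0 ?mulr0//.
by rewrite gt_eqF// ltr_wpDl.
Qed.

(** At t = 1 the factor 1 - y merges with the kernel: (1-y) (1-y)^(s-1) / Gamma(s) = s (1-y)^s /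
    Gamma(s+1). The termwise proof also covers -1 < s <= 0, where the sum still makes sense. *)
Lemma fracp_mul1X s p : -1 < s ->
  fracp s ((1 - 'X) * p) 1 = s * fracp (s + 1) p 1.
Proof.
move=> s1.
have -> : (1 - 'X) * p = p - 'X * p by rewrite mulrBl mul1r.
rewrite fracpB (@fracpE (size p).+1 _ ('X * p)); last first.
  by have [->|p0] := eqVneq p 0; rewrite ?mulr0 ?size_poly0// mulrC size_mulX.
rewrite big_ord_recl coefXM/= !mul0r add0r /fracp -sumrB big_distrr/=.
apply: eq_bigr => i _; rewrite !powR1 !mulr1 coefXM/= /bump/= add1n factS natrM -natr1.
have -> : i%:R + 1 + 1 + s = i%:R + 1 + s + 1 by ring.
have -> : i%:R + 1 + (s + 1) = i%:R + 1 + s + 1 by ring.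
have g0 : 0 < i%:R + 1 + s by rewrite -addrA ltr_wpDl//; lra.
rewrite GammaS//; have g1 := lt0r_neq0 (Gamma_gt0 g0); have g2 := lt0r_neq0 g0.
move: g1 g2; move: (gam _) => G g1 g2.
rewrite add0n; move: (i`!%:R : R) (i%:R : R) g2 => F I g2; field.
by rewrite ?g1 ?g2.
Qed.

Lemma fracp_is_derive s p t : 0 < s -> 0 < t ->
  is_derive t 1 (fracp s p) (fracp (s - 1) p t).
Proof.
move=> s0 t0.
have -> : fracp s p = \sum_(i < size p) ((p`_i * i`!%:R / gam (i%:R + 1 + s)) \*: (fun t => t `^ (i%:R + s))).
  by apply/funext => x; rewrite fct_sumE.
apply: (@is_derive_eq _ _ _ _ _ _ _ (\sum_(i < size p) (p`_i * i`!%:R / gam (i%:R + 1 + s)) *: ((i%:R + s) * t `^ (i%:R + s - 1)))).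
  apply: is_derive_sum => i; apply: is_deriveZ; exact: is_derive1_powR.
apply: eq_bigr => i _; rewrite /GRing.scale/=.
have g0 : 0 < i%:R + s by rewrite ltr_wpDl.
have -> : i%:R + 1 + s = i%:R + s + 1 by ring.
have -> : i%:R + 1 + (s - 1) = i%:R + s by ring.
rewrite GammaS// -addrA mulrA; congr (_ * _).
have g1 := lt0r_neq0 (Gamma_gt0 g0); have g2 := lt0r_neq0 g0.
by move: (i%:R + s) (gam (i%:R + s)) g1 g2 => y G g1 g2; field; rewrite g1 g2.
Qed.

Lemma continuous_powR_gt0 (a t : R) : 0 < t -> {for t, continuous (fun t => t `^ a)}.
Proof. by move=> t0; exact: is_derive_continuous (is_derive1_powR a t0). Qed.

Lemma fracp_continuous s p b : 0 < s -> {within `[0, b], continuous (fracp s p)}.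
Proof.
move=> s0.
have [b0|b0] := ltP 0 b; last first.
  move: b0; rewrite le_eqVlt => /predU1P[->|b0]; first by rewrite set_itv1; exact: continuous_subspace1.
  by rewrite set_itv_ge -?leNgt ?bnd_simp//; exact: continuous_subspace0.
apply/continuous_within_itvP => //; split.
- move=> x; rewrite in_itv/= => /andP[x0 _].
  exact: is_derive_continuous (fracp_is_derive p s0 x0).
- rewrite fracp_at0// /fracp.
  pose F (i : 'I_(size p)) t := p`_i * i`!%:R / gam (i%:R + 1 + s) * t `^ (i%:R + s).
  rewrite -/F; elim: (index_enum 'I_(size p)) => [|i r IH].
    rewrite (_ : (fun t => _) = fun=> 0); first exact: cvg_cst.
    by apply/funext => t; rewrite big_nil.
  rewrite (_ : (fun t => _) = (fun t => F i t + \sum_(j <- r) F j t)); last first.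
    by apply/funext => t; rewrite big_cons.
  have Fi : F i t @[t --> 0^'+] --> (0 : R).
    rewrite -[X in _ --> X](mulr0 (p`_i * i`!%:R / gam (i%:R + 1 + s))).
    by apply: cvgMr; apply: powR_cvg0; rewrite ltr_wpDl.
  by rewrite -[X in _ --> X](addr0 0); apply: cvgD.
- apply: cvg_at_left_filter; exact: is_derive_continuous (fracp_is_derive p s0 b0).
Qed.

Lemma fracp_legq_ode n s t : 1 < s -> 0 < t ->
  t * (2 - t) * fracp (s - 2) (legq n) t - 2 * (s - 1) * (1 - t) * fracp (s - 1) (legq n) t
  + (n%:R + s) * (n%:R + 1 - s) * fracp s (legq n) t = 0.
Proof.
move=> s1 t0.
have sz : (size (@legq R n) <= n.+1)%N by exact: size_poly.
rewrite !(fracpE _ _ sz) !big_distrr/= -sumrN -!big_split/=.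
pose e i := lcoef n i * i`!%:R / gam (i%:R + 1 + s).
(* The terms of index i combine into a difference [T i - T i.+1]. The first end vanishes through the
   factor i, the last because the coefficient of degree n + 1 is zero. *)
pose T i := e i * 2 * (i%:R + s) * i%:R * t `^ (i%:R + s - 1).
have -> : \sum_(i < n.+1) (t * (2 - t) * ((legq n)`_i * i`!%:R / gam (i%:R + 1 + (s - 2)) * t `^ (i%:R + (s - 2)))
   - 2 * (s - 1) * (1 - t) * ((legq n)`_i * i`!%:R / gam (i%:R + 1 + (s - 1)) * t `^ (i%:R + (s - 1)))
   + (n%:R + s) * (n%:R + 1 - s) * ((legq n)`_i * i`!%:R / gam (i%:R + 1 + s) * t `^ (i%:R + s)))
  = \sum_(i < n.+1) (T i - T i.+1).
  apply: eq_bigr => i _; rewrite coef_legq /T /e.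
  have g0 : 0 < i%:R + s - 1 by rewrite -addrA ltr_wpDl// subr_gt0.
  have g1 : 0 < i%:R + s by lra.
  have g2 : 0 < i%:R + s + 1 by lra.
  have -> : i%:R + 1 + (s - 2) = i%:R + s - 1 by ring.
  have -> : i%:R + 1 + (s - 1) = i%:R + s by ring.
  have -> : i.+1%:R + 1 + s = i%:R + s + 1 + 1 by rewrite -natr1; ring.
  have -> : i%:R + 1 + s = i%:R + s + 1 by ring.
  have G1 : gam (i%:R + s) = (i%:R + s - 1) * gam (i%:R + s - 1).
    by rewrite -GammaS// subrK.
  rewrite (GammaS g2) (GammaS g1) G1.
  have P0 : i%:R + (s - 2) = i%:R + s - 2 by ring.
  have P1 : t `^ (i%:R + s - 1) = t `^ (i%:R + s - 2) * t.
    by rewrite (_ : _ - 1 = i%:R + s - 2 + 1) ?gt0_powRD ?powRr1 ?(ltW t0)//; ring.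
  have P2 : t `^ (i%:R + s) = t `^ (i%:R + s - 2) * t ^+ 2.
    by rewrite -(powR_mulrn 2 (ltW t0)) -(gt0_powRD _ _ t0); congr (_ `^ _); ring.
  have P3 : i%:R + (s - 1) = i%:R + s - 1 by ring.
  have P4 : i.+1%:R + s - 1 = i%:R + s by rewrite -natr1; ring.
  rewrite P0 P3 P4 P1 P2 factS natrM -[i.+1%:R]natr1.
  have L : lcoef n i.+1 = - ((n%:R - i%:R) * (n%:R + i%:R + 1)) * lcoef n i / (2 * (i%:R + 1) ^+ 2) :> R.
    by rewrite -lcoefS; have h := @nat1_neq0 R i; field; rewrite h.
  rewrite L.
  have h0 := lt0r_neq0 g0; have h1 := lt0r_neq0 g1; have h2 := lt0r_neq0 g2.
  have h3 := lt0r_neq0 (Gamma_gt0 g0); have h4 := @nat1_neq0 R i.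
  move: h0 h1 h2 h3 h4 {L P0 P1 P2 P3 P4 G1 g0 g1 g2}.
  move: (i%:R : R) (i`!%:R : R) (n%:R : R) (lcoef n i) (t `^ _) => I F N L P.
  move: (gam _) => G h0 h1 h2 h3 h4.
  by field; rewrite ?h0 ?h1 ?h2 ?h3 ?h4.
have -> N : \sum_(i < N) (T i - T i.+1) = T 0%N - T N.
  by elim: N => [|N IH]; rewrite ?big_ord0 ?subrr// big_ord_recr/= IH; ring.
by rewrite /T /e (lcoef_gt (ltnSn n)) !(mul0r, mulr0) subr0.
Qed.

End fractional_integral_poly.

(** * Values at the midpoint and Sonin's bound *)

Section values_at_one.
Context {R : realType}.
Implicit Types (n i k m : nat) (s t : R).

Notation a n s := (fracp s (legq n) 1).

(** Both contiguous relations involve the integral of order s + 1 of the middle polynomial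
    [legq n.+1]; eliminating it leaves a two-step recurrence in n. *)
Lemma legq_value_rec n s : -1 < s ->
  (n%:R + 2 + s) * a n.+2 s = - (n%:R + 1 - s) * a n s.
Proof.
move=> s1.
have d : a n.+2 s - a n s = - (2 * n%:R + 3) * fracp (s + 1) (legq n.+1) 1.
  rewrite -fracpB -fracp_deriv; last by rewrite hornerD hornerN !legq_at0 subrr.
  by rewrite legq_deriv fracpZ.
have m : (2 * n%:R + 3) * (s * fracp (s + 1) (legq n.+1) 1) =
    (n%:R + 2) * a n.+2 s + (n%:R + 1) * a n s.
  by rewrite -fracp_mul1X// -fracpZ legq_mulX fracpD !fracpZ.
move: d m; move: (n%:R : R) (a n.+2 s) (a n s) (fracp (s + 1) (legq n.+1) 1) => N A B C d m.
have : (N + 2) * A + (N + 1) * B = - s * (A - B) by rewrite d -m; ring.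
move=> h; have : (N + 2) * A + (N + 1) * B + s * (A - B) = 0 by rewrite h; ring.
by move=> {h}h; apply/eqP; rewrite -subr_eq0; apply/eqP; rewrite -h; ring.
Qed.

(** The first-order term of the differential equation vanishes at the midpoint, which links the
    orders s and s - 2 for fixed n. *)
Lemma legq_value_rec2 n s : 1 < s ->
  a n (s - 2) = - ((n%:R + s) * (n%:R + 1 - s)) * a n s.
Proof.
move=> s1; have := @fracp_legq_ode R n s 1 s1 ltr01.
by rewrite subrr mulr0 mul0r => H; apply/eqP; rewrite -subr_eq0; apply/eqP; rewrite -H; ring.
Qed.

Lemma legq_value0 s : a 0 s = (gam (1 + s))^-1.
Proof.
rewrite legq0 /fracp size_poly1 big_ord1 coef1 powR1 /= fact0 add0r.
by rewrite mulr1 mulr1 mul1r.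
Qed.

Lemma legq_value1 s : -1 < s -> a 1 s = s / gam (s + 2).
Proof.
move=> s1; rewrite legq1 fracpB.
have := legq_value0 s; rewrite legq0 => ->.
have S2 (F : nat -> R) : \sum_(i < 2) F i = F 0%N + F 1%N.
  by rewrite big_ord_recr big_ord1.
have -> : fracp s 'X 1 = (gam (1 + 1 + s))^-1.
  rewrite (@fracpE _ 2) ?size_polyX//.
  rewrite (S2 (fun i => ('X : {poly R})`_i * i`!%:R / gam (i%:R + 1 + s) * 1 `^ (i%:R + s))).
  by rewrite !coefX !powR1 !mul0r add0r !mulr1 mul1r.
have -> : 1 + 1 + s = 1 + s + 1 by ring.
have -> : s + 2 = 1 + s + 1 by ring.
have g0 : 0 < 1 + s by lra.
rewrite GammaS//; have h0 := lt0r_neq0 (Gamma_gt0 g0); have h1 := lt0r_neq0 g0.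
by move: (gam _) h0 => G h0; field; rewrite h0 h1.
Qed.

(** The value at t = 1 is this amplitude times a sine ([legq_value]). At s = mu + 1 it is the bound
    from which the constants of the estimates derive. *)
Definition legq_amp n s : R :=
  (2 `^ s * Num.sqrt pi)^-1 * (gam ((n%:R + 1 - s) / 2) / gam ((n%:R + s + 2) / 2)).

Lemma sqrt_pi_gt0 : 0 < Num.sqrt pi :> R.
Proof. by rewrite sqrtr_gt0 pi_gt0. Qed.

Lemma legq_amp_gt0 n s : -1 < s -> s < n%:R + 1 -> 0 < legq_amp n s.
Proof.
move=> s1 sn; have n0 : 0 <= n%:R :> R by [].
apply: mulr_gt0; first by rewrite invr_gt0 mulr_gt0 ?powR_gt0 ?sqrt_pi_gt0.
by apply: divr_gt0; apply: Gamma_gt0; lra.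
Qed.

Lemma Gamma_reflection_abs (z : R) : -1 < z < 1 ->
  gam (1 + z) * gam (1 - z) * sin (pi * z) = pi * z.
Proof.
move=> /andP[z1 z2]; have [z0|z0|->] := ltgtP z 0.
- have := @Gamma_reflection R (- z); rewrite oppr_gt0 z0 ltrNl z1 => /(_ isT).
  by rewrite opprK mulrN sinN => H; rewrite (mulrC (gam _)); lra.
- by apply: Gamma_reflection; rewrite z0.
- by rewrite mulr0 sin0 mulr0.
Qed.

(** Reflection at (s+1)/2 produces the sine; duplication at s + 1 produces the power of 2 and
    sqrt(pi). *)
Lemma legq_value_base0 s : -1 < s < 1 ->
  a 0 s = legq_amp 0 s * sin (pi * ((s + 1) / 2)).
Proof.
move=> /andP[s1 s2]; rewrite legq_value0 /legq_amp.
have z0 : 0 < (s + 1) / 2 by lra.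
have zI : -1 < (s + 1) / 2 < 1 by apply/andP; split; lra.
have r := Gamma_reflection_abs zI.
have d := @Gamma_duplication R (1 + s); have {d} d := d ltac:(lra).
move: r d; rewrite (addrC 1 ((s + 1) / 2)) GammaS//.
have -> : 1 - (s + 1) / 2 = (0 + 1 - s) / 2 by field.
have -> : (1 + s) / 2 = (s + 1) / 2 by field.
have -> : (1 + s + 1) / 2 = (0 + s + 2) / 2 by field.
rewrite (@gt0_powRD _ _ 1 s)// powRr1//.
have h1 : gam ((0 + 1 - s) / 2) != 0 by rewrite gt_eqF// Gamma_gt0//; lra.
have h2 : gam ((0 + s + 2) / 2) != 0 by rewrite gt_eqF// Gamma_gt0//; lra.
have h3 : gam ((s + 1) / 2) != 0 by rewrite gt_eqF// Gamma_gt0//; lra.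
have h4 : gam (1 + s) != 0 by rewrite gt_eqF// Gamma_gt0//; lra.
have h5 : 2 `^ s != 0 by rewrite gt_eqF// powR_gt0.
have h6 := lt0r_neq0 sqrt_pi_gt0; have h7 : (s + 1) / 2 != 0 by rewrite gt_eqF.
have p2 : pi = Num.sqrt pi ^+ 2 :> R by rewrite sqr_sqrtr// pi_ge0.
move=> r d; move: (sin _) r => S r; rewrite p2 in r; move: h1 h2 h3 h4 h5 h6 h7 r d {p2 zI z0}.
move: ((s + 1) / 2) (gam (1 + s)) (2 `^ s) (Num.sqrt pi) (gam ((0 + 1 - s) / 2)) (gam ((0 + s + 2) / 2)) (gam ((s + 1) / 2)).
move=> z G4 S2 p G1 G2 G3 h1 h2 h3 h4 h5 h6 h7 r d.
have e1 : G1 * S = p ^+ 2 / G3.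
  rewrite (_ : G1 * S = (z * G3 * G1 * S) / (z * G3)); last by field; rewrite h3 h7.
  by rewrite r; field; rewrite h3 h7.
have e3 : G4 = S2 * (G3 * G2) / p.
  have e2 : p * G4 = S2 * (G3 * G2) by lra.
  by rewrite -e2; field; rewrite h6.
transitivity ((S2 * p * G2)^-1 * (G1 * S)); last by field; rewrite ?h2 ?h5 ?h6.
by rewrite e1 e3; field; rewrite ?h2 ?h3 ?h5 ?h6.
Qed.

Lemma legq_value_base1 s : -1 < s <= 1 ->
  a 1 s = legq_amp 1 s * sin (pi * (s / 2)).
Proof.
move=> /andP[s1 s2]; rewrite legq_value1// /legq_amp.
have zI : -1 < s / 2 < 1 by apply/andP; split; lra.
have r := Gamma_reflection_abs zI.
have d := @Gamma_duplication R (s + 2); have {d} d := d ltac:(lra).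
move: r d.
have -> : 1 - s / 2 = (1 + 1 - s) / 2 by field.
have -> : 1 + s / 2 = (s + 2) / 2 by field.
have -> : (s + 2 + 1) / 2 = (1 + s + 2) / 2 by field.
have p4 : 2 `^ 2 = 4 :> R by rewrite powR_mulrn//; ring.
rewrite (@gt0_powRD _ _ s 2)// p4.
have h1 : gam ((1 + 1 - s) / 2) != 0 by rewrite gt_eqF// Gamma_gt0//; lra.
have h2 : gam ((1 + s + 2) / 2) != 0 by rewrite gt_eqF// Gamma_gt0//; lra.
have h3 : gam ((s + 2) / 2) != 0 by rewrite gt_eqF// Gamma_gt0//; lra.
have h4 : gam (s + 2) != 0 by rewrite gt_eqF// Gamma_gt0//; lra.
have h5 : 2 `^ s != 0 by rewrite gt_eqF// powR_gt0.
have h6 := lt0r_neq0 sqrt_pi_gt0.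
have p2 : pi = Num.sqrt pi ^+ 2 :> R by rewrite sqr_sqrtr// pi_ge0.
move=> r d; move: (sin _) r => S r; rewrite p2 in r; move: h1 h2 h3 h4 h5 h6 r d {p2 p4 zI}.
move: (gam (s + 2)) (2 `^ s) (Num.sqrt pi) (gam ((1 + 1 - s) / 2)) (gam ((1 + s + 2) / 2)) (gam ((s + 2) / 2)).
move=> G4 S2 p G1 G2 G3 h1 h2 h3 h4 h5 h6 r d.
have e1 : G1 * S = p ^+ 2 * (s / 2) / G3 by rewrite -r; field; rewrite h3.
have e3 : G4 = 2 * S2 * (G3 * G2) / p.
  have e2 : p * G4 = 2 * S2 * (G3 * G2) by lra.
  by rewrite -e2; field; rewrite h6.
transitivity ((S2 * p * G2)^-1 * (G1 * S)); last by field; rewrite ?h2 ?h5 ?h6.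
by rewrite e1 e3; field; rewrite ?h2 ?h3 ?h5 ?h6.
Qed.

Lemma legq_ampSS n s : -1 < s -> s < n%:R + 1 ->
  (n%:R + 2 + s) * legq_amp n.+2 s = (n%:R + 1 - s) * legq_amp n s.
Proof.
move=> s1 sn; rewrite /legq_amp.
have n0 : 0 <= n%:R :> R by [].
have g1 : 0 < (n%:R + 1 - s) / 2 by lra.
have g2 : 0 < (n%:R + s + 2) / 2 by lra.
have -> : (n.+2%:R + 1 - s) / 2 = (n%:R + 1 - s) / 2 + 1 by rewrite -addn2 natrD; field.
have -> : (n.+2%:R + s + 2) / 2 = (n%:R + s + 2) / 2 + 1 by rewrite -addn2 natrD; field.
rewrite !GammaS//.
have h1 := lt0r_neq0 (Gamma_gt0 g2); have h2 := lt0r_neq0 g2.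
move: (_^-1) (gam ((n%:R + 1 - s) / 2)) (gam ((n%:R + s + 2) / 2)) h1 => C A B h1.
have h3 : n%:R + s + 2 != 0 by rewrite gt_eqF//; lra.
by field; rewrite ?h1 ?h3.
Qed.

Lemma legq_amp_sub2 n s : 1 < s -> s < n%:R + 1 ->
  legq_amp n (s - 2) = (n%:R + s) * (n%:R + 1 - s) * legq_amp n s.
Proof.
move=> s1 sn; rewrite /legq_amp.
have n0 : 0 <= n%:R :> R by [].
have g1 : 0 < (n%:R + 1 - s) / 2 by lra.
have g2 : 0 < (n%:R + s) / 2 by lra.
have -> : (n%:R + 1 - (s - 2)) / 2 = (n%:R + 1 - s) / 2 + 1 by field.
have -> : (n%:R + s + 2) / 2 = (n%:R + s) / 2 + 1 by field.
have -> : (n%:R + (s - 2) + 2) / 2 = (n%:R + s) / 2 by congr (_ / _); ring.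
have p4 : 2 `^ s = 2 `^ (s - 2) * 4 :> R.
  have -> : 4 = 2 `^ 2 :> R by rewrite powR_mulrn//; ring.
  by rewrite -gt0_powRD// subrK.
rewrite !GammaS// p4.
have h1 := lt0r_neq0 (Gamma_gt0 g2).
have h5 : 2 `^ (s - 2) != 0 :> R by rewrite gt_eqF// powR_gt0.
have h6 := lt0r_neq0 sqrt_pi_gt0.
have h3 : n%:R + s != 0 by rewrite gt_eqF//; lra.
move: (2 `^ _) (Num.sqrt pi) (gam ((n%:R + 1 - s) / 2)) (gam ((n%:R + s) / 2)) h1 h5 h6 => C p A B h1 h5 h6.
by field; rewrite ?h1 ?h3 ?h5 ?h6.
Qed.

Lemma sin_shift (x : R) : sin (pi * (x - 1)) = - sin (pi * x).
Proof.
have := sinDpi (pi * (x - 1)); have -> : pi * (x - 1) + pi = pi * x by ring.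
by move=> ->; rewrite opprK.
Qed.

Lemma legq_value_strip n s : -1 < s <= 1 -> s < n%:R + 1 ->
  a n s = legq_amp n s * sin (pi * ((s + 1 - n%:R) / 2)).
Proof.
move=> s11; have /andP[s1 s2] := s11.
elim/ltn_ind: n => -[|[|n]] IH sn.
- by rewrite subr0 legq_value_base0// s1/=; move: sn; rewrite add0r.
- by rewrite addrK legq_value_base1.
have n0 : 0 <= n%:R :> R by [].
have c0 : n%:R + 2 + s != 0 by rewrite gt_eqF//; lra.
apply: (mulfI c0); rewrite legq_value_rec//.
have -> : (s + 1 - n.+2%:R) / 2 = (s + 1 - n%:R) / 2 - 1 by rewrite -addn2 natrD; field.
have [sn1|sn1] := ltP s (n%:R + 1).
  have H := legq_ampSS s1 sn1; rewrite IH// sin_shift.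
  move: H; move: (legq_amp n.+2 s) (legq_amp n s) (sin _) => X Y S H.
  transitivity (- ((n%:R + 1 - s) * Y) * S); first by ring.
  by rewrite -H; ring.
(* This case is n = 0 and s = 1. The induction hypothesis would involve Gamma at 0, but the
   coefficient of the recurrence and the sine are both zero. *)
have ns : n%:R + 1 = s by apply/eqP; rewrite eq_le sn1/=; lra.
have -> : (s + 1 - n%:R) / 2 = 1 by rewrite -ns; field.
by rewrite subrr mulr0 sin0 mulr0 mulr0 ns subrr oppr0 mul0r.
Qed.

(** Each use of [legq_value_rec2] lowers s by 2 until the strip is reached; the sign it introduces
    is that of a half-period shift of the sine. *)
Lemma legq_value n s : -1 < s -> s < n%:R + 1 ->
  a n s = legq_amp n s * sin (pi * ((s + 1 - n%:R) / 2)).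
Proof.
move=> s1 sn.
have [m sm] : exists m : nat, s <= 1 + 2 * m%:R.
  exists n; have n0 : 0 <= n%:R :> R by []; lra.
elim: m s s1 sn sm => [|m IH] s s1 sn sm.
  by apply: legq_value_strip => //; rewrite s1/=; lra.
have [s2|s2] := leP s 1; first by apply: legq_value_strip => //; rewrite s1 s2.
have n0 : 0 <= n%:R :> R by [].
have c0 : (n%:R + s) * (n%:R + 1 - s) != 0 by rewrite gt_eqF// mulr_gt0//; lra.
apply: (mulfI c0).
have -> : (n%:R + s) * (n%:R + 1 - s) * a n s = - a n (s - 2).
  by rewrite legq_value_rec2// mulNr opprK.
rewrite IH; [|lra|lra|by rewrite -natr1 in sm; lra].
rewrite legq_amp_sub2//.
have -> : (s - 2 + 1 - n%:R) / 2 = (s + 1 - n%:R) / 2 - 1 by field.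
by rewrite sin_shift; ring.
Qed.

(** Monotonicity of [gamma_quot] between (n+1-s)/2 and (n+s)/2, once the powers of 2 and pi are
    cancelled. *)
Lemma legq_amp_pred n s : 1 < s -> s < n%:R + 1 ->
  legq_amp n (s - 1) ^+ 2 <= (n%:R + s) * (n%:R + 1 - s) * legq_amp n s ^+ 2.
Proof.
move=> s1 sn; rewrite /legq_amp.
have n0 : 0 <= n%:R :> R by [].
pose al := (n%:R + 1 - s) / 2; pose be := (n%:R + s) / 2.
have a0 : 0 < al by rewrite /al; lra.
have b0 : 0 < be by rewrite /be; lra.
have -> : (n%:R + 1 - (s - 1)) / 2 = al + 1 / 2 by rewrite /al; field.
have -> : (n%:R + (s - 1) + 2) / 2 = be + 1 / 2 by rewrite /be; field.
have -> : (n%:R + s + 2) / 2 = be + 1 by rewrite /be; field.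
have -> : n%:R + s = 2 * be by rewrite /be; field.
rewrite -/al; have -> : n%:R + 1 - s = 2 * al by rewrite /al; field.
have -> : 2 `^ s = 2 `^ (s - 1) * 2 :> R.
  by rewrite -[X in _ * X](@powRr1 R 2)// -gt0_powRD// subrK.
rewrite GammaS//.
have := @gamma_quot_le R al be a0 ltac:(rewrite /al /be; lra); rewrite /gamma_quot.
have g1 := Gamma_gt0 a0; have g2 := Gamma_gt0 b0.
have g3 : 0 < gam (be + 1 / 2) by rewrite Gamma_gt0//; lra.
have g4 : 0 < 2 `^ (s - 1) :> R by rewrite powR_gt0.
have g5 := sqrt_pi_gt0.
move: (2 `^ _) (Num.sqrt pi) (gam (al + 1 / 2)) (gam (be + 1 / 2)) (gam al) (gam be) g1 g2 g3 g4 g5.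
move: al be a0 b0 => x y x0 y0 C p A B G H g1 g2 g3 g4 g5.
rewrite ler_pdivrMr ?mulr_gt0 ?exprn_gt0// => K.
have -> : ((C * p)^-1 * (A / B)) ^+ 2 = (C * p * B) ^- 2 * A ^+ 2 by field; rewrite !gt_eqF.
have -> : 2 * y * (2 * x) * ((C * 2 * p)^-1 * (G / (y * H))) ^+ 2 =
  (C * p * B) ^- 2 * (B ^+ 2 / (y * H ^+ 2) * (x * G ^+ 2)) by field; rewrite !gt_eqF.
by rewrite ler_wpM2l// invr_ge0 exprn_ge0// !mulr_ge0// ltW.
Qed.

(** Lowering the order by 1 shifts the sine by a quarter of its period, so the two values are a sine
    and a cosine of the same angle, and [legq_amp_pred] compares their amplitudes. *)
Lemma legq_value_sonin n s : 1 < s -> s < n%:R + 1 ->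
  a n s ^+ 2 + a n (s - 1) ^+ 2 / ((n%:R + s) * (n%:R + 1 - s)) <= legq_amp n s ^+ 2.
Proof.
move=> s1 sn; have n0 : 0 <= n%:R :> R by [].
rewrite !legq_value; [|lra..].
have -> : (s + 1 - n%:R) / 2 = (s - 1 + 1 - n%:R) / 2 + 1 / 2 by field.
rewrite mulrDr (_ : pi * (1 / 2) = pi / 2); last by rewrite mulrA mulr1.
rewrite sinDpihalf; move: (pi * _) => x.
have := cos2Dsin2 x; have := legq_amp_pred s1 sn.
have c0 : 0 < (n%:R + s) * (n%:R + 1 - s) by rewrite mulr_gt0//; lra.
move: (legq_amp n (s - 1)) (legq_amp n s) c0 => B' A'.
rewrite !exprMn; move: (B' ^+ 2) (A' ^+ 2) => B A {B' A'}.
move: (_ * (n%:R + 1 - s)) => c c0 BA cs.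
rewrite [leRHS](_ : A = A * cos x ^+ 2 + A * sin x ^+ 2); last by rewrite -mulrDr cs mulr1.
rewrite lerD2l mulrAC ler_wpM2r ?sqr_ge0//.
by rewrite ler_pdivrMr// mulrC.
Qed.

(* Sonin's function y^2 + t (2 - t) y'^2 / c is maximal at t = 1. *)
Lemma fracp_legq_bound n s t : 1 < s -> s < n%:R + 1 -> 0 <= t <= 2 ->
  `|fracp s (legq n) t| <= legq_amp n s.
Proof.
move=> s1 sn /andP[t0 t2]; have n0 : 0 <= n%:R :> R by [].
pose c := (n%:R + s) * (n%:R + 1 - s).
have c0 : 0 < c by rewrite mulr_gt0//; lra.
have s0 : 0 < s by lra. have s10 : 0 < s - 1 by lra.
pose y x := fracp s (legq n) x; pose y1 x := fracp (s - 1) (legq n) x.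
pose S x := y x ^+ 2 + x * (2 - x) * y1 x ^+ 2 / c.
(* The differential equation removes y'' and, with it, the products y y'. Only y'^2 remains, with
   the sign of 1 - x because 4 s - 2 > 0. *)
pose dS (x : R) := (1 - x) * (4 * s - 2) * y1 x ^+ 2 / c.
have dSE (x : R) : 0 < x -> is_derive x 1 S (dS x).
  move=> x0.
  have d1 : is_derive x 1 y (y1 x) by exact: fracp_is_derive.
  have d2 : is_derive x 1 y1 (fracp (s - 2) (legq n) x).
    by have := @fracp_is_derive R (s - 1) (legq n) x s10 x0; rewrite -addrA -opprD.
  have ode := @fracp_legq_ode R n s x s1 x0.
  rewrite /S; apply: is_derive_eq; rewrite /GRing.scale/= /dS.
  rewrite -/(y x) -/(y1 x) -/c in ode.
  move: (fracp (s - 2) _ _) (y x) (y1 x) ode => y2 z z1 ode.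
  have e : x * (2 - x) * y2 = 2 * (s - 1) * (1 - x) * z1 - c * z by lra.
  transitivity (2 * z * z1 + (2 * (1 - x) * z1 ^+ 2 + 2 * z1 * (x * (2 - x) * y2)) / c).
    by move: (c) (lt0r_neq0 c0) => c' h; field; rewrite h.
  by rewrite e; move: (c) (lt0r_neq0 c0) => c' h; field; rewrite h.
have cS b : {within `[0, b], continuous S}.
  have cy := @fracp_continuous R s (legq n) b s0.
  have cy1 := @fracp_continuous R (s - 1) (legq n) b s10.
  have cp : {within `[0, b], continuous (fun x : R => x * (2 - x))}.
    apply: (@within_continuous_derive _ _ (fun x => 2 - 2 * x)) => x _.
    by apply: is_derive_eq; rewrite /GRing.scale/=; ring.
  have -> : S = (fun x => y x * y x + x * (2 - x) * (y1 x * y1 x) * c^-1) by [].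
  apply: within_continuousD; first exact: within_continuousM.
  apply: within_continuousM; last exact: within_continuous_cst.
  by apply: within_continuousM => //; exact: within_continuousM.
have Smax : S t <= S 1.
  have [t1|t1] := leP t 1.
    apply: (@derive_nondecreasing R S dS t 1 t1).
    - by move=> x; rewrite in_itv/= => /andP[x0 _]; apply: dSE; exact: le_lt_trans x0.
    - move=> x; rewrite in_itv/= => /andP[_ x1]; rewrite /dS divr_ge0 ?(ltW c0)//.
      by rewrite mulr_ge0 ?sqr_ge0// mulr_ge0//; lra.
    - by apply: continuous_subspaceW (cS 1) => x/=; rewrite !in_itv/= => /andP[tx ->]; rewrite (le_trans t0).
  have := @derive_nondecreasing R (- S) (- dS) 1 t (ltW t1); rewrite lerN2; apply.
  - move=> x; rewrite in_itv/= => /andP[x0 _].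
    by apply: is_deriveN; apply: dSE; apply: lt_trans x0.
  - move=> x; rewrite in_itv/= => /andP[x1 _].
    have -> : (- dS) x = (x - 1) * (4 * s - 2) * (y1 x ^+ 2 / c) by rewrite fctE /dS; ring.
    by rewrite mulr_ge0 ?divr_ge0 ?sqr_ge0 ?(ltW c0)// mulr_ge0//; lra.
  - apply: (@continuous_subspaceW _ _ _ `[0, t]).
      by move=> x/=; rewrite !in_itv/= => /andP[tx ->]; rewrite (le_trans _ tx).
    by move=> x; apply: cvgN; exact: cS.
rewrite -ler_sqr ?nnegrE ?normr_ge0 ?(ltW (legq_amp_gt0 _ _))//; last lra.
rewrite real_normK ?num_real//.
apply: le_trans (legq_value_sonin s1 sn); rewrite -/c.
apply: (@le_trans _ _ (S t)).
  by rewrite lerDl divr_ge0 ?(ltW c0)// mulr_ge0 ?sqr_ge0// mulr_ge0//; lra.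
by apply: (le_trans Smax); rewrite /S mul1r (_ : 2 - 1 = 1) ?mul1r//; ring.
Qed.

End values_at_one.

(** * Absolutely continuous functions *)

Section interval_families.
Context {R : realType}.
Implicit Types (f : R -> R) (a b d e : R) (s L : seq (R * R)).

Definition disj_itv (p q : R * R) : bool := (p.2 <= q.1) || (q.2 <= p.1).

Definition itv_family a b s : bool :=
  all (fun p => [&& a <= p.1, p.1 < p.2 & p.2 <= b]) s && pairwise disj_itv s.

(** With lists an interval can be replaced by the pieces of a partition, and the non-strict [<= e]
    survives the passage to suprema. *)
Definition ac_seq a b f := forall e, 0 < e -> exists2 d, 0 < d &
  forall s, itv_family a b s -> \sum_(p <- s) (p.2 - p.1) < d ->
    \sum_(p <- s) `|f p.2 - f p.1| <= e.

Lemma disj_itv_sym p q : disj_itv p q = disj_itv q p.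
Proof. by rewrite /disj_itv orbC. Qed.

Lemma abs_cont_ac_seq a b f : abs_cont a b f -> ac_seq a b f.
Proof.
move=> acf e /acf[d d0 H]; exists d => // s /andP[/all_nthP sab /(pairwiseP (0, 0)) sd] lt.
have := H (size s) (fun i => (nth (0, 0) s i).1) (fun i => (nth (0, 0) s i).2).
rewrite !(big_nth (0, 0)) !big_mkord in lt *; move=> K; apply/ltW/K => //.
  by move=> i; have /and3P[] := sab (0, 0) i (ltn_ord i).
move=> i j _ _ [x [/=]]; rewrite !in_itv/= => /andP[x1 x2] /andP[y1 y2].
apply/val_inj => /=; case: (ltngtP i j) => // ij.
- have := sd i j (ltn_ord i) (ltn_ord j) ij; rewrite /disj_itv => /orP[] h.
    by have := lt_trans y1 (lt_le_trans x2 h); rewrite ltxx.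
  by have := lt_trans x1 (lt_le_trans y2 h); rewrite ltxx.
- have := sd j i (ltn_ord j) (ltn_ord i) ij; rewrite /disj_itv => /orP[] h.
    by have := lt_trans x1 (lt_le_trans y2 h); rewrite ltxx.
  by have := lt_trans y1 (lt_le_trans x2 h); rewrite ltxx.
Qed.

Fixpoint pieces a (s : seq R) : seq (R * R) :=
  if s is x :: s' then (a, x) :: pieces x s' else [::].

Lemma sum_pieces_zip a (s : seq R) f :
  \sum_(x <- zip s (a :: s)) `|f x.1 - f x.2| = \sum_(p <- pieces a s) `|f p.2 - f p.1|.
Proof. by elim: s a => [|x s IH] a; rewrite /= ?big_nil// !big_cons -IH. Qed.

Lemma sum_pieces_len a (s : seq R) : \sum_(p <- pieces a s) (p.2 - p.1) = last a s - a.
Proof.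
by elim: s a => [|x s IH] a /=; rewrite ?big_nil ?subrr// big_cons IH /=; lra.
Qed.

Lemma path_le_last a (s : seq R) : path <%O a s -> a <= last a s.
Proof. by elim: s a => //= x s IH a /andP[/ltW ax /IH]; exact: le_trans. Qed.

Lemma pieces_family a (s : seq R) : path <%O a s -> itv_family a (last a s) (pieces a s).
Proof.
elim: s a => //= x s IH a /andP[ax xs]; have /andP[h1 h2] := IH _ xs.
rewrite /itv_family /= lexx ax path_le_last//= h2 andbT; apply/andP; split.
  by apply: sub_all h1 => p /and3P[xp -> ->]; rewrite (le_trans (ltW ax) xp).
by apply: sub_all h1 => p /and3P[xp _ _]; rewrite /disj_itv /= xp.
Qed.

Lemma itv_family_cat a b s L : itv_family a b (s ++ L) =
  [&& itv_family a b s, itv_family a b L & allrel disj_itv s L].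
Proof.
rewrite /itv_family all_cat pairwise_cat.
by do !case: (all _ _) => //=; do !case: (pairwise _ _); rewrite /= ?andbT ?andbF.
Qed.

Lemma itv_family1 a b s p : itv_family a b (p :: s) =
  [&& [&& a <= p.1, p.1 < p.2 & p.2 <= b], all (disj_itv p) s & itv_family a b s].
Proof. by rewrite /itv_family /=; do !case: (all _ _); rewrite /= ?andbT ?andbF. Qed.

(* A refinement of the first interval by a partition is again a disjoint family
   of the same total length: the supremum over the partitions can be taken one
   interval at a time. *)
Lemma total_variation_family a b f d e :
  (forall s, itv_family a b s -> \sum_(p <- s) (p.2 - p.1) < d ->
    \sum_(p <- s) `|f p.2 - f p.1| <= e) ->
  forall s L, itv_family a b (s ++ L) -> \sum_(p <- s ++ L) (p.2 - p.1) < d ->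
  (\sum_(p <- s) total_variation p.1 p.2 f + (\sum_(p <- L) `|f p.2 - f p.1|)%:E <= e%:E)%E.
Proof.
move=> H; elim=> [L|p s IH L].
  by rewrite big_nil add0e lee_fin => /H.
rewrite cat_cons itv_family1 => /and3P[/and3P[p1 p12 p2] dp fam]; rewrite big_cons => lend.
have len0 : 0 < p.2 - p.1 by rewrite subr_gt0.
have IHL := IH L fam; have {}IHL := IHL ltac:(lra).
have s0 : (0 <= \sum_(p <- s) total_variation p.1 p.2 f)%E.
  move: fam; rewrite itv_family_cat => /and3P[/andP[/allP sab _] _ _].
  rewrite big_seq; apply: sume_ge0 => q /sab /and3P[_ /ltW q12 _].
  exact: total_variation_ge0.
have L0 : 0 <= \sum_(p <- L) `|f p.2 - f p.1| by apply: sumr_ge0.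
have sfin : (\sum_(p <- s) total_variation p.1 p.2 f)%E \is a fin_num.
  rewrite ge0_fin_numE// (@le_lt_trans _ _ e%:E) ?ltry// (le_trans _ IHL)//.
  by rewrite leeDl// lee_fin.
rewrite big_cons; move: s0 IHL IH; rewrite -(fineK sfin); set S := fine _ => s0 IHL IH.
rewrite -addeA -leeBrDr//; apply: ge_ereal_sup => _ [_ [t [pt /eqP lt] <-] <-].
have pt' : itv_partition p.1 p.2 t by split=> //; exact/eqP.
rewrite leeBrDr// -!EFinD lee_fin (variation_zip f pt') sum_pieces_zip.
have := pieces_family pt; rewrite lt /itv_family => /andP[/allP tp td].
have := IH (pieces p.1 t ++ L); rewrite !big_cat/= sum_pieces_len lt.
rewrite big_cat/= in lend; move=> K.
have {K} : (S%:E + (\sum_(p <- pieces p.1 t) `|f p.2 - f p.1| +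
    \sum_(p <- L) `|f p.2 - f p.1|)%:E <= e%:E)%E.
  apply: K; last by lra.
  move: fam dp; rewrite !itv_family_cat all_cat => /and3P[-> -> sL] /andP[/allP ps /allP pL].
  rewrite allrel_catr sL /itv_family td/= !andbT -?andbA; apply/and3P; split.
  - by apply/allP => q /tp /and3P[q1 -> q2]; rewrite (le_trans p1 q1) (le_trans q2 p2).
  - apply/allrelP => q r /tp /and3P[q1 _ q2] /pL /orP[] h; apply/orP.
      by left; exact: le_trans h.
    by right; exact: le_trans q1.
  - apply/allrelP => q r /ps h /tp /and3P[r1 _ r2]; move: h; rewrite disj_itv_sym.
    move=> /orP[] h; apply/orP; [left; exact: le_trans r1|right; exact: le_trans h].
by rewrite -EFinD lee_fin => K; lra.
Qed.

(** With d the modulus for e = 1, each step of length d / 2 adds at most 1 to the variation. *)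
Lemma ac_seq_bounded_variation a b f : a <= b -> ac_seq a b f -> bounded_variation a b f.
Proof.
move=> ab /(_ 1 ltr01)[d d0 H].
have TV1 x y : a <= x -> x < y -> y <= b -> y - x < d -> (total_variation x y f <= 1%:E)%E.
  move=> ax xy yb xyd; have := @total_variation_family a b f d 1 H [:: (x, y)] [::].
  by rewrite /itv_family /= !big_cons !big_nil /= ax xy yb !addr0 ?adde0; apply.
have TVi (i : nat) : forall x, a <= x <= b -> x <= a + i%:R * (d / 2) ->
    (total_variation a x f <= i%:R%:E)%E.
  elim: i => [|i IH] x /andP[ax xb] xi.
    rewrite mul0r addr0 in xi; have -> : x = a by lra.
    by rewrite total_variationxx.
  have [xa|xa] := lerP (x - d / 2) a.
    have [<-|ax'] := eqVneq a x; first by rewrite total_variationxx lee_fin.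
    rewrite (@le_trans _ _ 1%:E) ?lee_fin ?ler1n//.
    by apply: TV1 => //; [rewrite lt_neqAle ax' ax|lra].
  rewrite (@total_variationD _ _ _ (x - d / 2)) ?(ltW xa)//; last by lra.
  rewrite -[i.+1%:R]natr1 EFinD leeD//; last by apply: TV1; lra.
  by apply: IH; [lra|rewrite -[i.+1%:R]natr1 in xi; lra].
apply/bounded_variationP => //; rewrite ge0_fin_numE ?total_variation_ge0//.
have [n Hn] : exists n : nat, (b - a) / (d / 2) < n%:R.
  by exists (Num.truncn ((b - a) / (d / 2))).+1; exact: truncnS_gt.
apply: (@le_lt_trans _ _ n%:R%:E); last exact: ltry.
apply: TVi; first by rewrite ab lexx.
move: Hn; rewrite ltr_pdivrMr ?divr_gt0// => h; lra.
Qed.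

(** Jordan decomposition. The point is that the variation function is absolutely continuous with the
    modulus of f, by [total_variation_family] with an empty second list. *)
Lemma ac_seq_decomposition a b f : a <= b -> ac_seq a b f ->
  exists V : R -> R, [/\ {in `[a, b] &, nondecreasing_fun V},
    {in `[a, b] &, nondecreasing_fun (fun x => V x - f x)},
    ac_seq a b V & ac_seq a b (fun x => V x - f x)].
Proof.
move=> ab acf; have bv := ac_seq_bounded_variation ab acf.
pose V x := fine (total_variation a x f).
have fin x y : a <= x -> x <= y -> y <= b -> total_variation x y f \is a fin_num.
  move=> ax xy yb; apply/bounded_variationP => //.
  by apply: (bounded_variationr ax xy); apply: (bounded_variationl (le_trans ax xy) yb).
have VB x y : a <= x -> x <= y -> y <= b -> (V y - V x)%:E = total_variation x y f.
  move=> ax xy yb; rewrite /V EFinB !fineK ?fin ?(le_trans ax xy)// ?(le_trans xy yb)//.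
  rewrite (@total_variationD _ _ _ x)// addeAC subee ?add0e ?fin//.
  exact: le_trans xy yb.
have fV x y : a <= x -> x <= y -> y <= b -> `|f y - f x| <= V y - V x.
  by move=> ax xy yb; rewrite -lee_fin VB//; exact: total_variation_ge.
have acV : ac_seq a b V.
  move=> e /acf[d d0 H]; exists d => // s sab sd.
  have := @total_variation_family a b f d e H s [::]; rewrite cats0 big_nil adde0.
  move=> /(_ sab sd); rewrite -lee_fin -sumEFin; apply: le_trans.
  rewrite [leLHS]big_seq [leRHS]big_seq; apply: lee_sum => p ps.
  have /andP[/allP /(_ _ ps) /and3P[p1 p12 p2] _] := sab.
  by rewrite ger0_norm ?VB ?(ltW p12)// (le_trans _ (fV _ _ _ _ _)) ?(ltW p12).
exists V; split => //.
- move=> x y; rewrite !in_itv/= => /andP[ax _] /andP[_ yb] xy.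
  by have := fV _ _ ax xy yb; have := normr_ge0 (f y - f x); lra.
- move=> x y; rewrite !in_itv/= => /andP[ax _] /andP[_ yb] xy.
  by have := fV _ _ ax xy yb; have := ler_norm (f y - f x); lra.
move=> e e0; have e2 : 0 < e / 2 by rewrite divr_gt0.
have [d1 d10 H1] := acf _ e2; have [d2 d20 H2] := acV _ e2.
exists (Num.min d1 d2) => [|s sab]; first by rewrite lt_min d10.
rewrite lt_min => /andP[sd1 sd2]; have := H1 _ sab sd1; have := H2 _ sab sd2.
move=> K2 K1; rewrite (@le_trans _ _ (e / 2 + e / 2))//; last by lra.
apply: le_trans (lerD K2 K1); rewrite -big_split/=; apply: ler_sum => p _.
have -> : V p.2 - f p.2 - (V p.1 - f p.1) = (V p.2 - V p.1) - (f p.2 - f p.1) by ring.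
exact: ler_normB.
Qed.

End interval_families.

(** * Stieltjes measures and the fundamental theorem for absolutely continuous functions *)

Section stieltjes.
Context {R : realType}.
Notation leb := (@lebesgue_measure R).
Implicit Types (f F : R -> R) (a b d e x y : R).

Lemma open_interval_finite (I : set R) : open I -> is_interval I ->
  (leb I < +oo)%E -> exists pq : R * R, pq.1 <= pq.2 /\ I = `]pq.1, pq.2[%classic.
Proof.
move=> oI iI fI; have II : (interior I) = I by apply/interior_id.
have [I0|/set0P/negP/negPn/eqP I0] := pselect (I !=set0); last first.
  by exists (0, 0); split => //=; rewrite I0 set_itv_ge// bnd_simp ltxx.
have ray (r : R) (c : bool) : (leb (if c then `]r, +oo[ else `]-oo, r[)%classic = +oo)%E.
  by case: c; rewrite lebesgue_measure_itv/= ?ltry ?ltNyr.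
have [lI|lI] := pselect (has_lbound I); have [uI|uI] := pselect (has_ubound I).
- have E := interval_bounded_interior iI lI uI; rewrite II in E.
  exists (inf I, sup I) => /=; split; last by rewrite {1}E; apply/seteqP; split => x /=; rewrite in_itv.
  by have [x Ix] := I0; have := Ix; rewrite {1}E /= => /andP[/ltW h /ltW]; exact: le_trans.
- have E := interval_right_unbounded_interior iI lI uI; rewrite II in E.
  exfalso; move: fI; rewrite E (_ : mkset _ = `]inf I, +oo[%classic) ?(ray _ true) ?ltxx//.
  by apply/seteqP; split => x /=; rewrite in_itv/= andbT.
- have E := interval_left_unbounded_interior iI lI uI; rewrite II in E.
  exfalso; move: fI; rewrite E (_ : mkset _ = `]-oo, sup I[%classic) ?(ray _ false) ?ltxx//.
- have E := interval_unbounded_setT iI lI uI.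
  by exfalso; move: fI; rewrite E -(set_itvNyy R) lebesgue_measure_itv/= ltxx.
Qed.

(** Retraction of the line onto [a, b]. Composition with it extends a nondecreasing function on
    [a, b] to the whole line, constant on either side. *)
Definition clamp a b x : R := Num.max a (Num.min b x).

Lemma clampE a b x : a <= b -> [\/ x <= a /\ clamp a b x = a,
  a <= x <= b /\ clamp a b x = x | b <= x /\ clamp a b x = b].
Proof.
move=> ab; have [bx|xb] := leP b x.
  by constructor 3; split => //; rewrite /clamp min_l// max_r.
have [xa|ax] := leP x a.
  by constructor 1; split => //; rewrite /clamp min_r ?(ltW xb)// max_l.
by constructor 2; rewrite (ltW ax) (ltW xb); split => //; rewrite /clamp min_r ?(ltW xb)// max_r ?(ltW ax).
Qed.

Lemma clamp_itv a b x : a <= b -> a <= clamp a b x <= b.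
Proof. by move=> ab; case: (clampE x ab) => -[h ->]; lra. Qed.

Lemma clamp_id a b x : a <= x <= b -> clamp a b x = x.
Proof. by move=> /andP[ax xb]; case: (clampE x (le_trans ax xb)) => -[h ->]; lra. Qed.

Lemma clamp_le a b x y : a <= b -> x <= y -> clamp a b x <= clamp a b y.
Proof.
by move=> ab xy; case: (clampE x ab) => -[h ->]; case: (clampE y ab) => -[h' ->]; lra.
Qed.

Lemma clamp_len a b x y : a <= b -> x <= y -> clamp a b y - clamp a b x <= y - x.
Proof.
by move=> ab xy; case: (clampE x ab) => -[h ->]; case: (clampE y ab) => -[h' ->]; lra.
Qed.

Lemma stieltjes_oc (G : cumulative R R) (p q : R) : p <= q ->
  lebesgue_stieltjes_measure G `]p, q]%classic = (G q - G p)%:E.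
Proof.
move=> pq; rewrite /lebesgue_stieltjes_measure /measure_extension.
by rewrite measurable_mu_extE/=; [rewrite wlength_itv_bnd|exact: is_ocitv].
Qed.

(** A null set lies in an open set of length < d. Its components are disjoint intervals, and the
    modulus of absolute continuity bounds each finite sum of the increments of G over them by e. *)
Lemma stieltjes_null (G : cumulative R R) a b : a <= b ->
  (forall x, G x = G (clamp a b x)) -> ac_seq a b G ->
  forall A : set (measurableTypeR R), measurable A -> leb A = 0%E ->
  lebesgue_stieltjes_measure G A = 0%E.
Proof.
move=> ab Gc acG A mA A0; set nu := lebesgue_stieltjes_measure G.
apply/eqP; rewrite eq_le measure_ge0 andbT; apply/lee_addgt0Pr => e e0; rewrite add0e.
have [d d0 H] := acG e e0.
have [U [oU AU UA]] : exists U : set R, [/\ open U, A `<=` U & (leb (U `\` A) < d%:E)%E].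
  apply: lebesgue_regularity_outer => //.
  by apply: le_lt_trans (ltry 0); rewrite le_eqVlt; apply/orP; left; apply/eqP; exact: A0.
have Ud : (leb U < d%:E)%E.
  rewrite (le_lt_trans _ UA)//; have mU : measurable (U : set (measurableTypeR R)).
    exact: open_measurable.
  have : (leb U <= leb A + leb (U `\` A))%E.
    rewrite (le_trans _ (measureU2 _ _ _))//; last exact: measurableD.
    apply: le_measure; rewrite ?inE//.
      by apply: measurableU => //; exact: measurableD.
    by move=> x Ux; have [Ax|nAx] := pselect (A x); [left|right].
  by rewrite A0 add0e.
pose I := open_disjoint_itv oU.
have oI i : open (I i) by exact: open_disjoint_itv_open.
have mI i : measurable (I i : set (measurableTypeR R)) by exact: open_measurable.
have UI : U = \bigcup_i I i by exact: open_disjoint_itv_bigcup.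
have tI : trivIset setT I by exact: open_disjoint_itv_trivIset.
have Iser : (leb U = \sum_(i <oo) leb (I i))%E.
  by rewrite UI measure_bigcup//; apply: eq_eseriesl => i; rewrite in_setT.
have Ilt n : (\sum_(0 <= i < n) leb (I i) < d%:E)%E.
  by rewrite (le_lt_trans _ Ud)// Iser; apply: nneseries_lim_ge.
have pqI i : {pq : R * R | pq.1 <= pq.2 /\ I i = `]pq.1, pq.2[%classic}.
  apply: cid; apply: open_interval_finite => //; first exact: open_disjoint_itv_is_interval.
  apply: lt_trans (ltry d); apply: le_lt_trans Ud.
  apply: le_measure; rewrite ?inE//; first exact: open_measurable.
  by rewrite UI; exact: bigcup_sup.
pose pq i := sval (pqI i).
have pqle i : (pq i).1 <= (pq i).2 by rewrite /pq; case: (pqI i) => x [].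
have Ipq i : I i = `](pq i).1, (pq i).2[%classic by rewrite /pq; case: (pqI i) => x [].
(* G is constant on either side of [a, b], so clamping preserves the increments and places the
   components inside [a, b], where the modulus applies. *)
pose c i := (clamp a b (pq i).1, clamp a b (pq i).2).
have nuI i : (nu (I i) <= (G (c i).2 - G (c i).1)%:E)%E.
  rewrite -!Gc -stieltjes_oc//; apply: le_measure; rewrite ?inE//.
  by rewrite Ipq; apply: subset_itvl; rewrite bnd_simp.
apply: (@le_trans _ _ (\sum_(i <oo) nu (I i))%E).
  apply: measure_sigma_subadditive => //.
  by rewrite -UI.
apply: lime_le; first exact: is_cvg_nneseries.
apply: nearW => n; apply: (@le_trans _ _ (\sum_(0 <= i < n) (G (c i).2 - G (c i).1)%:E)%E).
  by apply: lee_sum => i _; exact: nuI.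
have cin (p q z : R) : clamp a b p < z < clamp a b q -> p < z < q.
  by case: (clampE p ab) => -[k1 ->]; case: (clampE q ab) => -[k2 ->];
     clear -ab k1 k2; move=> ?; lra.
(* Components that clamping collapses to a point have zero increment; they are dropped, since
   [itv_family] asks for nondegenerate intervals. *)
pose s := [seq c i | i <- iota 0 n & (c i).1 < (c i).2].
have cle i : (c i).1 <= (c i).2 by exact: clamp_le.
have cab i : a <= (c i).1 /\ (c i).2 <= b.
  by have /andP[h1 _] := clamp_itv (pq i).1 ab; have /andP[_ h2] := clamp_itv (pq i).2 ab.
have clen i : (c i).2 - (c i).1 <= (pq i).2 - (pq i).1 by exact: clamp_len.
have -> : (\sum_(0 <= i < n) (G (c i).2 - G (c i).1)%:E =
    (\sum_(p <- s) `|G p.2 - G p.1|)%:E)%E.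
  rewrite sumEFin /s big_map big_filter [in RHS]big_mkcond/= /index_iota subn0; congr EFin.
  apply: eq_bigr => i _; case: ifPn => [_|]; last first.
    rewrite -leNgt => h; have -> : clamp a b (pq i).2 = clamp a b (pq i).1 by apply/le_anti/andP; split=> //; exact: cle.
    by rewrite subrr.
  rewrite ger0_norm// subr_ge0; apply: cumulative_is_nondecreasing; exact: (cle i).
rewrite lee_fin; apply: H.
  apply/andP; split.
    apply/allP => q /mapP[i]; rewrite mem_filter => /andP[ci _] ->.
    by rewrite ci; have [-> ->] := cab i.
  rewrite /s pairwise_map; apply: (@sub_in_pairwise _ [pred i | (c i).1 < (c i).2] (fun i j => i != j)).
  - move=> i j ci cj /eqP ij; have : ~ (I i `&` I j !=set0).
      by move=> h; apply: ij; exact: tI.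
    move=> ndisj; suff : disj_itv (c i) (c j) by [].
    apply/negPn/negP; rewrite /disj_itv negb_or -!ltNge => /andP[h1 h2]; apply: ndisj.
    move: ci cj; rewrite !inE => ci cj.
    pose z := (Num.max (c i).1 (c j).1 + Num.min (c i).2 (c j).2) / 2.
    have : Num.max (c i).1 (c j).1 < Num.min (c i).2 (c j).2 by rewrite gt_max !lt_min ci h1 h2 cj.
    have M1 : (c i).1 <= Num.max (c i).1 (c j).1 by rewrite le_max lexx.
    have M2 : (c j).1 <= Num.max (c i).1 (c j).1 by rewrite le_max lexx orbT.
    have m1 : Num.min (c i).2 (c j).2 <= (c i).2 by rewrite ge_min lexx.
    have m2 : Num.min (c i).2 (c j).2 <= (c j).2 by rewrite ge_min lexx orbT.
    move=> zz; have z1 : (c i).1 < z < (c i).2 by rewrite /z; lra.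
    have z2 : (c j).1 < z < (c j).2 by rewrite /z; lra.
    have sub k : (c k).1 < z < (c k).2 -> I k z.
      by rewrite Ipq/= in_itv/= /c/= => /cin.
    by exists z; split; exact: sub.
  - by apply/allP => i; rewrite mem_filter => /andP[].
  - by rewrite -uniq_pairwise filter_uniq// iota_uniq.
rewrite -lte_fin; apply: le_lt_trans (Ilt n).
rewrite /s big_map big_filter big_mkcond/= -sumEFin /index_iota subn0.
apply: lee_sum => i _; have -> : leb (I i) = ((pq i).2 - (pq i).1)%:E.
  rewrite Ipq lebesgue_measure_itv/= lte_fin; have := pqle i; rewrite le_eqVlt.
  by move=> /predU1P[->|->]; rewrite ?ltxx ?subrr// EFinB.
rewrite lee_fin; case: ifPn => _; first exact: (clen i).
by rewrite subr_ge0.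
Qed.

(** The density is the Radon-Nikodym derivative of the Stieltjes measure of F, restricted to []a,
    b]] to be finite; [stieltjes_null] supplies the domination by Lebesgue measure. *)
Lemma nondecreasing_ac_integral a b F : a < b ->
  {in `[a, b] &, nondecreasing_fun F} -> ac_seq a b F ->
  exists2 g : R -> R, leb.-integrable setT (EFin \o g) &
    forall x, a <= x <= b -> F x - F a = \int[leb]_(t in `[a, x]) g t.
Proof.
move=> ab nF acF; have ab' := ltW ab.
pose Fc x := F (clamp a b x).
have cab x : clamp a b x \in `[a, b].
  by rewrite in_itv/=; case: (clampE x ab') => -[h ->]; lra.
have cid x : a <= x <= b -> clamp a b x = x by exact: clamp_id.
have cle x y : x <= y -> clamp a b x <= clamp a b y by exact: clamp_le.
have clen x y : x <= y -> clamp a b y - clamp a b x <= y - x by exact: clamp_len.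
have nd : {homo Fc : x y / x <= y} by move=> x y xy; apply: nF => //; exact: cle.
have cc e : 0 < e -> exists2 d, 0 < d & forall x y, x <= y -> y - x < d -> Fc y - Fc x <= e.
  move=> /acF[d d0 H]; exists d => // x y xy yxd.
  have := cle _ _ xy; rewrite le_eqVlt => /predU1P[E|lt].
    have := H [::]; rewrite !big_nil => /(_ isT d0).
    by rewrite /Fc E subrr.
  have := H [:: (clamp a b x, clamp a b y)]; rewrite !big_seq1/= => K.
  apply: le_trans (ler_norm _) (K _ _); last exact: le_lt_trans (clen _ _ xy) yxd.
  by have := cab x; have := cab y; rewrite /itv_family/= !in_itv/= => /andP[_ ->] /andP[-> _]; rewrite lt.
have cFc : continuous Fc.
  move=> x; apply/cvgrPdist_le => e /cc[d d0 H]; near=> y.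
  have xyd : `|x - y| < d by near: y; apply/nbhs_ballP; exists d.
  have [xy|/ltW yx] := leP x y.
    rewrite distrC ger0_norm ?subr_ge0 ?nd// H//.
    by rewrite (le_lt_trans _ xyd)// distrC ler_norm.
  rewrite ger0_norm ?subr_ge0 ?nd// H//.
  by rewrite (le_lt_trans _ xyd)// ler_norm.
have rc : right_continuous Fc by apply: right_continuousW.
pose G : cumulative R R := HB.pack Fc (isCumulative.Build R _ R Fc nd rc).
have acG : ac_seq a b G.
  move=> e /acF[d d0 H]; exists d => // s sab sd; apply: le_trans (H s sab sd).
  rewrite [leLHS]big_seq [leRHS]big_seq; apply: ler_sum => p ps.
  have /andP[/allP /(_ _ ps) /and3P[p1 p12 p2] _] := sab.
  by rewrite /G/= /Fc !cid// ?p1 ?p2 ?(le_trans p1 (ltW p12)) ?(le_trans (ltW p12) p2).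
pose nu := lebesgue_stieltjes_measure G.
have mD : measurable (`]a, b]%classic : set (measurableTypeR R)) by [].
have nuD : (nu `]a, b]%classic < +oo)%E by rewrite /nu stieltjes_oc// ltry.
pose nuf : {finite_measure set (measurableTypeR R) -> \bar R} := mfrestr mD nuD.
have [|f [f0 ffin intf nuE]] := @radon_nikodym_sigma_finite _ _ _ leb nuf.
  move=> A A0 B mB BA; rewrite /nuf/= /mfrestr /mrestr.
  apply: (stieltjes_null ab' _ acG); [|exact: measurableI|].
  - by move=> x; rewrite /G/= /Fc (cid (clamp _ _ _))//; have := cab x; rewrite in_itv.
  - by apply: (A0 (B `&` `]a, b]%classic)); [exact: measurableI|by move=> x [/BA]].
exists (fine \o f).
  by apply: eq_integrable intf => // x _; rewrite /= fineK.
move=> x /andP[ax xb].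
have I1 : leb.-integrable `]a, x] (EFin \o (fine \o f)).
  apply: (@integrableS _ _ _ _ setT) => //.
  by apply: eq_integrable intf => // y _; rewrite /= fineK.
rewrite -Rintegral_itv_obnd_cbnd// /Rintegral.
have -> : (\int[leb]_(t in `]a, x]) (EFin ((fine \o f) t)) = nuf `]a, x]%classic)%E.
  by rewrite nuE//; apply: eq_integral => t _; rewrite /= fineK.
rewrite /nuf/= /mfrestr /mrestr setIidl; last by apply: subset_itvl; rewrite bnd_simp.
rewrite -/nu /nu stieltjes_oc//= /Fc !cid ?lexx ?ax ?ab' ?xb//.
Unshelve. all: by end_near. Qed.

Lemma abs_cont_FTC a b f : a < b -> abs_cont a b f ->
  exists g : R -> R, [/\ leb.-integrable setT (EFin \o g),
    forall x, a <= x <= b -> f x = f a + \int[leb]_(t in `[a, x]) g t &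
    {ae leb, forall x, x \in `]a, b[ -> derivable f x 1 /\ derive1 f x = g x}].
Proof.
move=> ab /abs_cont_ac_seq /(ac_seq_decomposition (ltW ab))[V [ndV ndW acV acW]].
have [g1 i1 E1] := nondecreasing_ac_integral ab ndV acV.
have [g2 i2 E2] := nondecreasing_ac_integral ab ndW acW.
have iS g : leb.-integrable setT (EFin \o g) -> forall D : set (measurableTypeR R),
    measurable D -> leb.-integrable D (EFin \o g).
  by move=> ig D mD; apply: (@integrableS _ _ _ _ setT).
pose g x := g1 x - g2 x.
have ig : leb.-integrable setT (EFin \o g).
  by have := integrableB measurableT i1 i2; apply: eq_integrable.
exists g.
have E x : a <= x <= b -> f x = f a + \int[leb]_(t in `[a, x]) g t.
  move=> axb; have -> : \int[leb]_(t in `[a, x]) g t = (V x - V a) - (V x - f x - (V a - f a)).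
    by rewrite (E1 _ axb) (E2 _ axb); apply: RintegralB => //; exact: iS.
  by ring.
split => //.
have lg : locally_integrable setT g by apply: open_integrable_locally => //; exact: openT.
(* Lebesgue differentiation applies to the integral of g. As f agrees with it, up to the constant f
   a, only on [a, b], the derivative is transferred near interior points. *)
have := @FTC1 R g (BLeft a) (fun y => iS _ ig _ (measurable_itv _)) lg.
apply: filterS; first exact: (ae_filter_ringOfSetsType leb).
move=> x /= H; rewrite in_itv/= => /andP[ax xb].
have [] := H; first by rewrite lte_fin.
set Fg := fun y => _ => dF FE.
have nr : \near x, f a + Fg x = f x.
  near=> y; rewrite [RHS]E//; apply/andP; split.
    by apply/ltW; near: y; exact: lt_nbhsr.
  by apply/ltW; near: y; exact: lt_nbhsl.
clearbody Fg; have dF1 : is_derive x 1 Fg (g x) by apply: DeriveDef => //; rewrite -derive1E.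
have : is_derive x 1 (fun y => f a + Fg y) (0 + g x) by apply: is_deriveD.
by move=> /(near_eq_is_derive nr)[]; rewrite add0r derive1E.
Unshelve. all: by end_near. Qed.

End stieltjes.

(** * Integrals up to null sets *)

Section ae_integral.
Local Open Scope ereal_scope.
Context {d : measure_display} {T : measurableType d} {R : realType}.
Context (mu : {measure set T -> \bar R}).
Import HBNNSimple.

Lemma ae_imply (P Q : set T) : (almost_everywhere mu) P -> P `<=` Q ->
  (almost_everywhere mu) Q.
Proof.
move=> [N [mN N0 sN]] PQ; exists N; split => //; apply: subset_trans sN.
by move=> x /= nQ Px; apply/nQ/PQ.
Qed.

Let ge0_ae_le_integral (f g : T -> \bar R) : (forall x, 0 <= f x) -> (forall x, 0 <= g x) ->
  {ae mu, forall x, f x = g x} -> \int[mu]_x f x <= \int[mu]_x g x.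
Proof.
move=> f0 g0 [N [mN N0 fgN]]; rewrite !ge0_integralTE//.
apply: ge_ereal_sup => _ [h hf <-].
(* A simple function below f, cut off on the exceptional null set, lies below g and keeps its
   integral. The integral of g being a supremum over such functions, measurability plays no part. *)
pose h' : {nnsfun T >-> R} := proj_nnsfun h (measurableC mN).
have -> : sintegral mu h = sintegral mu h'.
  rewrite -!integralT_nnsfun; apply: ge0_ae_eq_integral => //.
  - by apply/measurable_EFinP.
  - by apply/measurable_EFinP.
  - by move=> x _; rewrite lee_fin.
  - by move=> x _; rewrite lee_fin/= mindicE mulr_ge0.
  exists N; split => // x /= hx; apply: contrapT => Nx; apply: hx => _.
  by rewrite mindicE mem_set// mulr1.
apply: ereal_sup_ubound; exists h' => // x; rewrite /h'/= mindicE.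
have [Nx|Nx] := boolP (x \in ~` N); last by rewrite mulr0.
rewrite mulr1; have -> : g x = f x; last exact: hf.
by apply: contrapT => gf; move/set_mem: Nx; apply; apply: fgN => /= fg; apply: gf.
Qed.

(* Unlike ae_eq_integral, no measurability is required of f and g. *)
Lemma ae_eq_integralT (D : set T) (f g : T -> \bar R) :
  {ae mu, forall x, D x -> f x = g x} ->
  \int[mu]_(x in D) f x = \int[mu]_(x in D) g x.
Proof.
move=> fg; rewrite integral_mkcond [RHS]integral_mkcond.
have {fg} : {ae mu, forall x, (f \_ D) x = (g \_ D) x}.
  apply: (ae_imply fg).
  move=> x fgx; rewrite !patchE; case: ifPn => // /set_mem; exact: fgx.
move: (f \_ D) (g \_ D) => {}f {}g fg.
rewrite integralE [RHS]integralE; congr (_ - _).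
  apply/eqP; rewrite eq_le; apply/andP; split; apply: ge0_ae_le_integral => //;
    apply: (ae_imply fg);
    by move=> x fgx; rewrite !funeposE fgx.
apply/eqP; rewrite eq_le; apply/andP; split; apply: ge0_ae_le_integral => //;
    apply: (ae_imply fg);
    by move=> x fgx; rewrite !funenegE fgx.
Qed.

Lemma ae_eq_RintegralT (D : set T) (f g : T -> R) :
  {ae mu, forall x, D x -> f x = g x} ->
  (\int[mu]_(x in D) f x)%R = (\int[mu]_(x in D) g x)%R.
Proof.
move=> fg; congr fine; apply: ae_eq_integralT.
apply: (ae_imply fg).
by move=> x fgx Dx; rewrite fgx.
Qed.

End ae_integral.

Section fubini_region.
Context {R : realType}.
Notation leb := (@lebesgue_measure R).
Local Notation RT := (measurableTypeR R).

Let integral_section (phi : RT -> RT -> \bar R) (A : set (RT * RT)) (D : set RT)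
    (Dx : RT -> set RT) (x : RT) : (forall y, A (x, y) <-> D x /\ Dx x y) ->
  (\int[leb]_y (((fun z : RT * RT => phi z.1 z.2) \_ A) (x, y)) =
   ((fun x => \int[leb]_(y in Dx x) phi x y) \_ D) x)%E.
Proof.
move=> AD; rewrite [RHS]patchE; case: ifPn => [/set_mem Dxx|/negP xD].
  rewrite [RHS]integral_mkcond; apply: eq_integral => y _; rewrite !patchE.
  congr (if _ then _ else _); apply/idP/idP => /set_mem H1; apply/mem_set.
    by have /AD[] := H1.
  by apply/AD.
rewrite integral0_eq// => y _; rewrite patchE; case: ifPn => // /set_mem /AD[Hx].
by exfalso; apply: xD; apply/mem_set.
Qed.

Let integral_section' (phi : RT -> RT -> \bar R) (A : set (RT * RT)) (E : set RT)
    (Ey : RT -> set RT) (y : RT) : (forall x, A (x, y) <-> E y /\ Ey y x) ->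
  (\int[leb]_x (((fun z : RT * RT => phi z.1 z.2) \_ A) (x, y)) =
   ((fun y => \int[leb]_(x in Ey y) phi x y) \_ E) y)%E.
Proof.
move=> AD; rewrite [RHS]patchE; case: ifPn => [/set_mem Dxx|/negP xD].
  rewrite [RHS]integral_mkcond; apply: eq_integral => x _; rewrite !patchE.
  congr (if _ then _ else _); apply/idP/idP => /set_mem H1; apply/mem_set.
    by have /AD[] := H1.
  by apply/AD.
rewrite integral0_eq// => x _; rewrite patchE; case: ifPn => // /set_mem /AD[Hx].
by exfalso; apply: xD; apply/mem_set.
Qed.

(** The integral of a section can be infinite on a null set, where [fine] returns 0; this carries
    Fubini's conclusions from extended to real values. *)
Let fine_integrable (F : RT -> \bar R) (h : RT -> R) (D : set RT) : measurable D ->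
  leb.-integrable setT F -> (forall x, F x = if x \in D then F x else 0%E) ->
  (forall x, D x -> h x = fine (F x)) ->
  leb.-integrable D (EFin \o h) /\ \int[leb]_(x in D) h x = fine (\int[leb]_x F x)%E.
Proof.
move=> mD iF F0 hF.
have mF : measurable_fun setT F by exact: measurable_int iF.
have aeF : {ae leb, forall x, setT x -> F x \is a fin_num} by exact: integrable_ae iF.
have mfF : measurable_fun setT (fun x => (fine (F x))%:E).
  by apply/measurable_EFinP; exact: measurableT_comp.
have aeE : ae_eq leb setT F (fun x => (fine (F x))%:E).
  apply: (ae_imply aeF).
  by move=> x Fx Tx; rewrite fineK// Fx.
have ifF : leb.-integrable setT (fun x => (fine (F x))%:E).
  apply: le_integrable iF => // x _; case: (F x) => //=.
    by rewrite normr0 leey.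
  by rewrite normr0 leey.
split.
  apply: (@eq_integrable _ _ _ _ D mD (fun x => (fine (F x))%:E)).
    by move=> x /set_mem Dx; rewrite /= hF.
  exact: integrableS ifF.
rewrite /Rintegral; congr fine.
rewrite (@ae_eq_integral _ _ _ leb setT (fun x => (fine (F x))%:E) F)//.
rewrite integral_mkcond; apply: eq_integral => x _; rewrite patchE.
by case: ifPn => [/set_mem /hF ->//|xD]; rewrite F0 (negbTE xD).
Qed.

(** Signed counterpart of [tonelli_region]. The integrability of almost all sections is recorded
    because factors will have to be moved in and out of the inner integrals. *)
Lemma fubini_region (h : R -> R -> R) (A : set (RT * RT)) (D E : set RT)
    (Dx Ey : RT -> set RT) :
  measurable A -> measurable D -> measurable E ->
  measurable_fun setT (fun z : RT * RT => h z.1 z.2) ->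
  (forall y, measurable (Ey y)) ->
  (forall x y, A (x, y) <-> D x /\ Dx x y) ->
  (forall x y, A (x, y) <-> E y /\ Ey y x) ->
  (\int[leb]_(x in D) \int[leb]_(y in Dx x) `|h x y|%:E < +oo)%E ->
  [/\ leb.-integrable E (fun y => (\int[leb]_(x in Ey y) h x y)%:E),
      {ae leb, forall y, E y -> leb.-integrable (Ey y) (fun x => (h x y)%:E)} &
      \int[leb]_(x in D) \int[leb]_(y in Dx x) h x y =
      \int[leb]_(y in E) \int[leb]_(x in Ey y) h x y].
Proof.
move=> mA mD mE mh mEy AD AE hfin.
pose f : RT * RT -> \bar R := (fun z => (h z.1 z.2)%:E) \_ A.
have mf : measurable_fun setT f.
  by apply/(measurable_restrictT _ mA) => //=; apply/measurable_EFinP; exact: measurable_funTS.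
have iF : (leb \x leb)%E.-integrable setT f.
  apply/(integrable12ltyP leb leb mf); apply: le_lt_trans hfin.
  rewrite [leRHS]integral_mkcond le_eqVlt; apply/orP; left; apply/eqP.
  apply: eq_integral => x _.
  rewrite -(integral_section (fun x y => `|h x y|%:E) (AD x)).
  apply: eq_integral => y _; rewrite /f !patchE.
  by case: ifPn => //= _; rewrite normr0.
have FE x : fubini_F leb f x = ((fun x => \int[leb]_(y in Dx x) (h x y)%:E) \_ D)%E x.
  exact: (integral_section (fun x y => (h x y)%:E) (AD x)).
have GE y : fubini_G leb f y = ((fun y => \int[leb]_(x in Ey y) (h x y)%:E) \_ E)%E y.
  exact: (integral_section' (fun x y => (h x y)%:E) (fun x => AE x y)).
have iFF := integrable_fubini_F iF; have iGG : leb.-integrable setT (fubini_G leb f).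
  apply/integrableP; split; first exact: measurable_fubini_G iF.
  apply: le_lt_trans ((integrable21ltyP leb leb mf).1 iF).
  apply: ge0_le_integral => //.
  - by apply: measurableT_comp => //; exact: measurable_fubini_G iF.
  - apply: (@measurable_fun_fubini_tonelli_G _ _ _ _ _ leb (abse \o f)).
      exact: measurableT_comp.
    by move=> z; exact: abse_ge0.
  - move=> y _; apply: le_abse_integral => //.
    exact: measurableT_comp mf (measurable_pair2 _).
have [_ I1] := @fine_integrable _ (fun x => \int[leb]_(y in Dx x) h x y) D mD iFF
  (fun x => ltac:(by rewrite FE patchE; case: ifP))
  (fun x Dxx => ltac:(by rewrite FE patchE mem_set)).
have [I2 I3] := @fine_integrable _ (fun y => \int[leb]_(x in Ey y) h x y) E mE iGG
  (fun x => ltac:(by rewrite GE patchE; case: ifP))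
  (fun x Dxx => ltac:(by rewrite GE patchE mem_set)).
split; [exact: I2| |rewrite I1 I3; congr fine; exact: (Fubini iF)].
apply: (ae_imply (ae_integrable2 iF)).
move=> y /= iy Ey1.
have := @integrableS _ _ _ leb setT (Ey y) _ measurableT (mEy y) (@subsetT _ _) iy.
apply: eq_integrable => // x /set_mem Eyx; rewrite /f patchE mem_set//.
by apply/AE.
Qed.

End fubini_region.

(** * Legendre polynomials *)

Section legendre_relations.
Context {R : realType}.
Notation leb := (@lebesgue_measure R).
Implicit Types (p q : {poly R}) (s t x : R) (n m k : nat).

Lemma derivn_comp1X p n : derivn n (p \Po (1 - 'X)) = (-1) ^+ n *: (derivn n p \Po (1 - 'X)).
Proof.
elim: n => [|n IH]; first by rewrite !derivn0 expr0 scale1r.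
rewrite !derivnS IH derivZ deriv_comp derivB derivC derivX sub0r.
by rewrite mulrN1 scalerN exprS mulN1r scaleNr.
Qed.

(** The equation (X - 2) w' = n w, read coefficient by coefficient. *)
Lemma coef_expXsub2 n i :
  2 * (i%:R + 1) * (('X - 2%:P) ^+ n : {poly R})`_i.+1 =
  - (n%:R - i%:R) * (('X - 2%:P) ^+ n : {poly R})`_i.
Proof.
set w := _ ^+ n.
have H : ('X - 2%:P) * w^`() = n%:R *: w.
  rewrite /w deriv_exp derivB derivX derivC subr0 mul1r.
  case: n @w => [|n] w; first by rewrite !mulr0n mulr0 scale0r.
  by rewrite mulrnAr -exprS scaler_nat.
have := congr1 (fun q : {poly R} => q`_i) H; rewrite /= coefZ mulrBl coefB coefXM.
rewrite mul_polyC coefZ !coef_deriv => K.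
have {}K : i%:R * w`_i - 2 * (w`_i.+1 *+ i.+1) = n%:R * w`_i.
  have -> : i%:R * w`_i = if i == 0%N then 0 else w`_i.-1.+1 *+ i.-1.+1.
    by case: (i) => [|i'] /=; rewrite ?mul0r ?mulr_natl.
  exact: K.
have -> : 2 * (i%:R + 1) * w`_i.+1 = 2 * (w`_i.+1 *+ i.+1).
  by rewrite -[w`_i.+1 *+ i.+1]mulr_natl -[i.+1%:R]natr1; ring.
by rewrite mulNr mulrBl; move: K; move: (2 * _) (i%:R * _) (n%:R * _) => A B C; lra.
Qed.

(** In t = 1 - x, Rodrigues' formula differentiates t^n (t - 2)^n; the coefficients of the result
    obey the recurrence of [lcoef]. *)
Lemma legendre_comp n : legendre n \Po (1 - 'X) = legq n :> {poly R}.
Proof.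
pose q : {poly R} := 'X^n * ('X - 2%:P) ^+ n.
have E : ('X^2 - 1) ^+ n \Po (1 - 'X) = q :> {poly R}.
  rewrite rmorphXn /= rmorphB /= rmorphXn /= comp_polyX rmorph1 /q -exprMn.
  by congr (_ ^+ n); rewrite polyCD; ring.
have H : legendre n \Po (1 - 'X) = ((2 ^+ n * n`!%:R)^-1 * (-1) ^+ n) *: derivn n q.
  rewrite /legendre comp_polyZ -E derivn_comp1X scalerA -mulrA.
  by rewrite -exprMn mulN1r opprK expr1n mulr1.
have c i : (derivn n q)`_i = (('X - 2%:P) ^+ n : {poly R})`_i * ((n + i) ^_ n)%:R.
  by rewrite coef_derivn /q coefXnM ltnNge leq_addr/= addKn mulr_natr.
rewrite H; apply/polyP => i; rewrite coefZ c coef_legq; elim: i => [|i IH].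
  rewrite addn0 ffactnn -horner_coef0 horner_exp hornerD hornerN hornerX hornerC sub0r.
  rewrite [RHS]/= [(- 2) ^+ n]exprNn; have f0 : n`!%:R != 0 :> R by rewrite pnatr_eq0 -lt0n fact_gt0.
  have p0 : 2 ^+ n != 0 :> R by rewrite expf_neq0.
  have ee : (-1) ^+ n * (-1) ^+ n = 1 :> R by rewrite -exprMn mulrNN mulr1 expr1n.
  rewrite -[RHS]ee; move: (n`!%:R : R) (2 ^+ n : R) ((-1) ^+ n : R) f0 p0 => a b e a0 b0.
  by field; rewrite a0 b0.
have ff : ((n + i.+1) ^_ n)%:R * (i%:R + 1) = (n%:R + i%:R + 1) * ((n + i) ^_ n)%:R :> R.
  rewrite -natrD natr1 natr1 -!natrM; congr (_%:R).
  have := ffactnSr (n + i.+1) n; rewrite addKn => <-.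
  by rewrite addnS ffactSS.
have i1 := @nat1_neq0 R i.
have := @lcoefS R n i; have := coef_expXsub2 n i; rewrite -IH.
move: (((n + i.+1) ^_ n)%:R) (((n + i) ^_ n)%:R : R) (lcoef n i.+1) ff => F1 F0 L ff.
move: (_^-1 * _) (_`_i.+1) (_`_i) => C W1 W0 HW HL.
apply: (mulfI i1); apply: (mulfI i1); apply: (mulfI (x := 2)); first by [].
transitivity (2 * (i%:R + 1) ^+ 2 * L); last by ring.
rewrite HL; transitivity (C * (2 * (i%:R + 1) * W1) * (F1 * (i%:R + 1))); first by ring.
by rewrite HW ff; ring.
Qed.

Lemma legendreE n x : (legendre n).[x] = (legq n).[1 - x].
Proof.
by rewrite -legendre_comp horner_comp; congr (_.[_]); rewrite !hornerE /=; ring.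
Qed.

Lemma legq_parity n t : (legq n).[2 - t] = (-1) ^+ n * (legq n).[t].
Proof.
suff : (legq n).[2 - t] = (-1) ^+ n * (legq n).[t] /\
       (legq n.+1).[2 - t] = (-1) ^+ n.+1 * (legq n.+1).[t] by case.
elim: n => [|n [IH1 IH2]].
  by rewrite legq0 legq1 !hornerE /=; split; ring.
split => //; have n2 : (n%:R + 2 : R) != 0 by apply: lt0r_neq0; rewrite ltr_wpDl.
have rec y := congr1 (fun q : {poly R} => q.[y]) (legq_mulX n).
have e2 : (-1) ^+ n.+2 = (-1) ^+ n :> R by rewrite !exprS mulrA mulN1r opprK mul1r.
rewrite exprS mulN1r in IH2; apply: (mulfI n2); rewrite e2.
have := rec (2 - t); have := rec t; rewrite !(hornerD, hornerZ, hornerM, hornerN, hornerX, hornerC) IH1 IH2.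
move: (_ ^+ n) ((legq n).[t]) ((legq n.+1).[t]) ((legq n.+2).[t]) ((legq n.+2).[2 - t]) (n%:R : R).
clear; move=> e B A C D N H1 H2.
transitivity ((2 * N + 3) * ((1 - (2 - t)) * (- e * A)) - (N + 1) * (e * B)); first by rewrite H2; ring.
transitivity (e * ((2 * N + 3) * ((1 - t) * A)) - (N + 1) * (e * B)); first by ring.
by rewrite H1; ring.
Qed.

Lemma legq_at2 n : (legq n).[2] = (-1) ^+ n :> R.
Proof. by have := legq_parity n 0; rewrite subr0 legq_at0 mulr1. Qed.

Lemma fracp_legq_rec s n t :
  (2 * n%:R + 3) * fracp (s + 1) (legq n.+1) t = fracp s (legq n) t - fracp s (legq n.+2) t.
Proof.
have := @fracp_deriv R s (legq n.+2 - legq n) t.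
rewrite hornerD hornerN !legq_at0 subrr => /(_ erefl).
by rewrite legq_deriv fracpZ fracpB; lra.
Qed.

(** The relation [fracp_legq_rec] lowers the order while keeping it at most the degree, down to
    order 0, where the parity of P_n applies. Thus, up to sign, the k-fold integral may be started
    from either end. *)
Lemma fracp_legq_parity n k t : (k <= n)%N -> 0 <= t <= 2 ->
  fracp k%:R (legq n) (2 - t) = (-1) ^+ (n - k) * fracp k%:R (legq n) t.
Proof.
move=> kn /andP[t0 t2]; elim: k n kn => [|k IH] [|n] // kn; rewrite ?fracp0 ?subr_ge0// ?subn0.
- by rewrite legq_parity.
- by rewrite legq_parity.
have n3 : (2 * n%:R + 3 : R) != 0.
  by apply: lt0r_neq0; rewrite ltr_wpDl// mulr_ge0.
apply: (mulfI n3); rewrite [RHS]mulrCA -[k.+1%:R]natr1 !fracp_legq_rec !IH ?(leq_trans kn)//.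
  have -> : (n.+2 - k = n - k + 2)%N by rewrite addnBAC// addn2.
  by rewrite subSS exprD sqrrN expr1n mulr1 -mulrBr.
by rewrite (leq_trans (ltnW kn)).
Qed.

(** Removes the boundary terms at x = -1 in the repeated integrations by parts; those at x = 1
    vanish by [fracp_at0]. *)
Lemma fracp_legq_at2 n k : (0 < k <= n)%N -> fracp k%:R (legq n) 2 = 0 :> R.
Proof.
move=> /andP[k0 kn]; have := @fracp_legq_parity n k 0 kn.
by rewrite lexx ler0n subr0 fracp_at0 ?ltr0n// mulr0; exact.
Qed.

(* The integral over [-1, 1] in the variable t = 1 - x *)
Definition ipoly p : R := \int[leb]_(x in `[-1, 1]) p.[1 - x].

Lemma continuous_horner1 p : continuous (fun x : R => p.[1 - x]).
Proof.
move=> x; apply: (@is_derive_continuous R _ x (- p^`().[1 - x])).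
have -> : (fun x : R => p.[1 - x]) = horner (p \Po (1 - 'X)).
  by apply/funext => y; rewrite horner_comp !hornerE.
have -> : - p^`().[1 - x] = (p \Po (1 - 'X))^`().[x].
  by rewrite deriv_comp derivB derivC derivX sub0r mulrN1 !hornerE horner_comp !hornerE.
exact: is_derive_poly.
Qed.

Lemma integrable_horner1 p a b : leb.-integrable `[a, b] (EFin \o (fun x : R => p.[1 - x])).
Proof. by apply: continuous_integrable => x; exact: continuous_horner1. Qed.

Lemma ipolyD p q : ipoly (p + q) = ipoly p + ipoly q.
Proof.
rewrite /ipoly -RintegralD//; [|exact: integrable_horner1..].
by apply: eq_Rintegral => x _; rewrite hornerD.
Qed.

Lemma ipolyZ a p : ipoly (a *: p) = a * ipoly p.
Proof.
rewrite /ipoly -RintegralZl//; last exact: integrable_horner1.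
by apply: eq_Rintegral => x _; rewrite hornerZ.
Qed.

Lemma ipolyN p : ipoly (- p) = - ipoly p.
Proof. by rewrite -scaleN1r ipolyZ mulN1r. Qed.

Lemma ipoly_deriv p : ipoly p^`() = p.[2] - p.[0].
Proof.
have dF (x : R) : is_derive x 1 (fun x : R => - p.[1 - x]) p^`().[1 - x].
  have -> : (fun x : R => - p.[1 - x]) = horner (- (p \Po (1 - 'X))).
    by apply/funext => y; rewrite hornerN horner_comp !hornerE.
  have -> : p^`().[1 - x] = (- (p \Po (1 - 'X)))^`().[x].
    by rewrite derivN deriv_comp derivB derivC derivX sub0r mulrN1 opprK horner_comp !hornerE.
  exact: is_derive_poly.
have H := @Rintegral_FTC R (fun x => - p.[1 - x]) (fun x => p^`().[1 - x]) (-1) 1.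
rewrite /ipoly H //.
- by rewrite subrr opprK addrC; congr (p.[_] - _); ring.
- by apply: continuous_subspaceT => x; exact: continuous_horner1.
Qed.

Lemma ipoly_parts p q : ipoly (p^`() * q) = p.[2] * q.[2] - p.[0] * q.[0] - ipoly (p * q^`()).
Proof. by rewrite -!hornerM -ipoly_deriv derivM ipolyD addrK. Qed.

Lemma legq_orthogonal n m : n != m -> ipoly (legq n * legq m) = 0 :> R.
Proof.
move=> nm; set w : {poly R} := 'X * (2%:P - 'X).
set p := legq n; set q := legq m.
have dw : w^`() = 2%:P * (1 - 'X).
  by rewrite derivM derivB derivX derivC [2%:P]polyC_natr; ring.
have w2 : w.[2] = 0 by rewrite /w !hornerE /= subrr mulr0.
have w0 : w.[0] = 0 by rewrite /w hornerM hornerX mul0r.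
have H1 : w * q^`()^`() + 2 *: ((1 - 'X) * q^`()) + (m%:R * (m%:R + 1)) *: q = 0 by exact: legq_ode.
have H2 : w * p^`()^`() + 2 *: ((1 - 'X) * p^`()) + (n%:R * (n%:R + 1)) *: p = 0 by exact: legq_ode.
clearbody w p q.
(* Sturm-Liouville argument: w times the Wronskian of p and q, where w vanishes at both ends. *)
have E : (w * (p * q^`() - p^`() * q))^`() =
    (n%:R * (n%:R + 1) - m%:R * (m%:R + 1)) *: (p * q).
  rewrite derivM dw derivB !derivM -!mul_polyC polyCB in H1 H2 *.
  move: (n%:R * _)%:P (m%:R * _)%:P (p^`()) (q^`()) (p^`()^`()) (q^`()^`()) H1 H2.
  move=> c d p1 q1 p2 q2 H1 H2.
  transitivity (p * (w * q2 + 2%:P * ((1 - 'X) * q1)) - q * (w * p2 + 2%:P * ((1 - 'X) * p1))).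
    by ring.
  have -> : w * q2 + 2%:P * ((1 - 'X) * q1) = - (d * q) by apply/eqP; rewrite -addr_eq0 H1.
  have -> : w * p2 + 2%:P * ((1 - 'X) * p1) = - (c * p) by apply/eqP; rewrite -addr_eq0 H2.
  by ring.
have := ipoly_deriv (w * (p * q^`() - p^`() * q)); rewrite E ipolyZ !hornerM.
rewrite w2 w0 !mul0r subr0 => /eqP; rewrite mulf_eq0 => /orP[|/eqP//].
have -> : n%:R * (n%:R + 1) - m%:R * (m%:R + 1) = (n%:R - m%:R) * (n%:R + m%:R + 1) :> R by ring.
rewrite mulf_eq0 subr_eq0 eqr_nat (negbTE nm)/= => /eqP h.
by have : 0 < n%:R + m%:R + 1 :> R by []; rewrite h ltxx.
Qed.

Lemma legq_deriv_orthogonal j m : (j <= m)%N -> ipoly ((legq j)^`() * legq m) = 0 :> R.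
Proof.
have i0 : ipoly 0 = 0 by rewrite -(scale0r 0) ipolyZ mul0r.
elim/ltn_ind: j => -[|[|j]] IH jm; first by rewrite legq0 -polyC1 derivC mul0r.
  rewrite legq1 derivB derivX -polyC1 derivC sub0r mulN1r ipolyN.
  by have := @legq_orthogonal 0 m; rewrite legq0 mul1r => H; rewrite H ?oppr0// neq_ltn jm.
have -> : (legq j.+2)^`() = (legq j)^`() - (2 * j%:R + 3) *: legq j.+1 :> {poly R}.
  by have := @legq_deriv R j; rewrite derivB scaleNr => /eqP; rewrite subr_eq addrC => /eqP.
rewrite mulrBl ipolyD ipolyN -scalerAl ipolyZ (IH j); [|by []|exact/ltnW/ltnW].
by rewrite legq_orthogonal ?mulr0 ?subr0// ltn_eqF.
Qed.

(** (2 n + 3) [legq n.+1] is minus the derivative of [legq n.+2 - legq n], which vanishes at both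
    ends. After two integrations by parts, orthogonality leaves only the boundary values of
    [legq n.+1 * legq n]. *)
Lemma legq_norm n : ipoly (legq n * legq n) = 2 / (2 * n%:R + 1) :> R.
Proof.
case: n => [|n].
  by rewrite legq0 mul1r -(derivX R) ipoly_deriv !hornerX mulr0 add0r subr0 divr1.
have d2 : (legq n.+2 - legq n).[2] = 0 :> R.
  by rewrite !hornerE !legq_at2 -addn2 exprD sqrrN expr1n mulr1 subrr.
have d0 : (legq n.+2 - legq n).[0] = 0 :> R by rewrite !hornerE !legq_at0 subrr.
have := ipoly_parts (legq n.+2 - legq n) (legq n.+1).
rewrite d2 d0 !mul0r subrr sub0r legq_deriv -scalerAl ipolyZ.
rewrite mulrBl ipolyD ipolyN ![_ * (legq n.+1)^`()]mulrC legq_deriv_orthogonal// add0r opprK.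
rewrite ipoly_parts [legq n.+1 * _]mulrC legq_deriv_orthogonal// !legq_at0 !legq_at2 subr0.
rewrite exprS -mulrA -exprMn mulrNN !mulr1 expr1n mulr1 => H.
have n3 : 0 < 2 * n%:R + 3 :> R by rewrite ltr_wpDl// mulr_ge0.
have e : 2 * n.+1%:R + 1 = 2 * n%:R + 3 :> R by rewrite -[n.+1%:R]natr1; ring.
rewrite e; apply: (mulfI (lt0r_neq0 n3)); rewrite mulrCA mulfV ?lt0r_neq0//.
by move: H; rewrite mulNr; move: (_ * ipoly _) => z; lra.
Qed.

Lemma lcoef_diag_neq0 n : lcoef n n != 0 :> R.
Proof.
suff H i : (i <= n)%N -> lcoef n i != 0 :> R by apply: H.
elim: i => [|i IH] ni; first exact: oner_neq0.
rewrite /= mulf_neq0 ?IH ?(ltnW ni)// mulf_neq0//.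
  rewrite oppr_eq0 mulf_neq0// ?subr_eq0 ?eqr_nat ?gtn_eqF//.
Qed.

End legendre_relations.

(** * Pointwise bounds on Legendre polynomials *)

Section legendre_bounds.
Context {R : realType}.
Implicit Types (p q : {poly R}) (t x : R) (n m k : nat).

Lemma is_derive_horner p (x : R) : is_derive x 1 (horner p) p^`().[x].
Proof. exact: is_derive_poly. Qed.

Lemma legq_odeE n t : t * (2 - t) * (legq n)^`()^`().[t] + 2 * (1 - t) * (legq n)^`().[t]
  + (n%:R * (n%:R + 1)) * (legq n).[t] = 0 :> R.
Proof.
have := congr1 (fun q : {poly R} => q.[t]) (@legq_ode R n).
rewrite !(hornerD, hornerZ, hornerM, hornerN, hornerX, hornerC) => H.
by rewrite -[RHS]H; ring.
Qed.

Lemma legq_sqr_sym n t : (legq n).[2 - t] ^+ 2 = (legq n).[t] ^+ 2 :> R.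
Proof. by rewrite legq_parity exprMn sqrr_sign mul1r. Qed.

(** Sonin's function of the Legendre equation decreases from t = 0, where it equals 1, to the
    midpoint; parity covers the other half. *)
Lemma legq_le1 n t : 0 <= t <= 2 -> `|(legq n).[t]| <= 1 :> R.
Proof.
suff H y : 0 <= y <= 1 -> (legq n).[y] ^+ 2 <= 1 :> R.
  move=> /andP[t0 t2]; rewrite -(@ler_pXn2r _ 2) ?nnegrE ?normr_ge0// expr1n real_normK ?num_real//.
  have [t1|t1] := leP t 1; first by apply: H; rewrite t0.
  by rewrite -legq_sqr_sym; apply: H; apply/andP; split; lra.
move=> /andP[y0 y1]; case: n => [|n]; first by rewrite legq0 hornerE expr1n.
set p := legq n.+1; pose c : R := n.+1%:R * (n.+1%:R + 1).
have c0 : 0 < c by rewrite mulr_gt0// addr_gt0.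
pose S (x : R) := p.[x] ^+ 2 + x * (2 - x) * p^`().[x] ^+ 2 / c.
pose dS (x : R) := - (2 * (1 - x) * p^`().[x] ^+ 2 / c).
have dSE (x : R) : is_derive x 1 S (dS x).
  have d1 := is_derive_horner p x; have d2 := is_derive_horner p^`() x.
  have ode := legq_odeE n.+1 x; rewrite -/p -/c in ode.
  rewrite /S; apply: is_derive_eq; rewrite /GRing.scale/= /dS.
  move: (p.[x]) (p^`().[x]) (p^`()^`().[x]) ode => z z1 z2 ode.
  transitivity (2 * z * z1 + (2 * (1 - x) * z1 ^+ 2 + 2 * z1 * (x * (2 - x) * z2)) / c).
    by move: (c) (lt0r_neq0 c0) => c' h; field; rewrite h.
  have -> : x * (2 - x) * z2 = - (2 * (1 - x) * z1) - c * z by move: ode; clear; move=> ?; lra.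
  by move: (c) (lt0r_neq0 c0) => c' h; field; rewrite h.
have := @derive_nondecreasing R (- S) (- dS) 0 y y0; rewrite lerN2 => K.
have {}K : S y <= S 0.
  apply: K => [x _|x|]; first exact: is_deriveN.
    rewrite in_itv/= => /andP[x0 xy]; rewrite fctE /dS opprK.
    by rewrite divr_ge0 ?(ltW c0)// mulr_ge0 ?sqr_ge0// mulr_ge0//; lra.
  by apply: (@within_continuous_derive R _ (- dS)) => x _; exact: is_deriveN.
apply: (le_trans _ (le_trans K _)).
  by rewrite lerDl divr_ge0 ?(ltW c0)// mulr_ge0 ?sqr_ge0// mulr_ge0//; lra.
by rewrite /S /p legq_at0 mul0r !mul0r addr0 expr1n.
Qed.

Lemma legq_one_odd n : odd n -> (legq n).[1] = 0 :> R.
Proof.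
move=> on; have := @legq_parity R n 1; rewrite -signr_odd on expr1.
have -> : 2 - 1 = 1 :> R by ring.
by move=> h; lra.
Qed.

Lemma legq_deriv_one n : (legq n.+1)^`().[1] = - (n%:R + 1) * (legq n).[1] :> R.
Proof.
have rec m := congr1 (fun q : {poly R} => q.[1]) (@legq_mulX R m).
have drec m := congr1 (fun q : {poly R} => q.[1]) (@legq_deriv R m).
suff : (legq n.+1)^`().[1] = - (n%:R + 1) * (legq n).[1] :> R /\
  (legq n.+2)^`().[1] = - (n.+1%:R + 1) * (legq n.+1).[1] :> R by case.
elim: n => [|n [IH1 IH2]].
  split; first by rewrite legq1 legq0 derivB derivX -polyC1 derivC !hornerE; ring.
  have := drec 0%N; rewrite legq0 derivB -[1]polyC1 derivC subr0 => ->.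
  by rewrite hornerZ (legq_one_odd (n := 1))// !mulr0.
split => //; have := rec n.+1; have := drec n.+1.
rewrite derivB !(hornerD, hornerZ, hornerM, hornerN, hornerX, hornerC) IH1 subrr mul0r mulr0.
rewrite -[n.+2%:R]natr1 -[n.+1%:R]natr1.
have rn := rec n; rewrite !(hornerD, hornerZ, hornerM, hornerN, hornerX, hornerC) subrr mul0r mulr0 in rn.
move: ((legq n.+3)^`().[1]) ((legq n).[1]) ((legq n.+1).[1]) ((legq n.+2).[1]) ((legq n.+3).[1]) (n%:R : R) rn.
clear; move=> A B C D E N H1 H2 H3; lra.
Qed.

(** Case s = 0 of [legq_value], with the sine bounded by 1. The amplitude is estimated by
    [Gamma_half_ratio_lower] at x = (n+1)/2, where x - 1/4 = (2n+1)/4. *)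
Lemma legq_one_bound n : (legq n).[1] ^+ 2 <= 4 / (pi * (2 * n%:R + 1)) :> R.
Proof.
have pi0 : 0 < pi :> R by exact: pi_gt0.
have n0 : 0 <= n%:R :> R by [].
rewrite -(@fracp0 R (legq n) 1)// (@legq_value R n 0) ?ltrN10 ?ltr_wpDl//.
rewrite exprMn; apply: (@le_trans _ _ (legq_amp n 0 ^+ 2)).
  by rewrite ler_piMr ?sqr_ge0// -(cos2Dsin2 (pi * ((0 + 1 - n%:R) / 2))) lerDr sqr_ge0.
rewrite /legq_amp powRr0 mul1r subr0 addr0 exprMn exprVn sqr_sqrtr ?(ltW pi0)//.
have -> : (n%:R + 2) / 2 = (n%:R + 1) / 2 + 1 / 2 :> R by field.
have x0 : 1 / 4 < (n%:R + 1) / 2 :> R by lra.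
have := Gamma_half_ratio_lower x0.
have -> : 4 / (pi * (2 * n%:R + 1)) = pi^-1 * ((n%:R + 1) / 2 - 1 / 4)^-1 :> R.
  have -> : 2 * n%:R + 1 = 4 * ((n%:R + 1) / 2 - 1 / 4) :> R by field.
  have z0 : (n%:R + 1) / 2 - 1 / 4 != 0 :> R by rewrite subr_eq0 gt_eqF.
  by move: (_ - _) (pi : R) z0 (lt0r_neq0 pi0) => z q z0 q0; field; rewrite z0 q0.
have := @Gamma_gt0 R ((n%:R + 1) / 2 + 1 / 2); have := @Gamma_gt0 R ((n%:R + 1) / 2).
move: x0; move: (_ / 2) => x x0 /(_ ltac:(lra)) g0 /(_ ltac:(lra)) g1 H.
rewrite ler_pM2l ?invr_gt0// exprMn exprVn ler_pdivrMr ?exprn_gt0// mulrC.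
by rewrite ler_pdivlMr ?subr_gt0// mulrC.
Qed.

(** The algebra of the derivative of [S] in [legq_Bernstein], with r = 1 - x, v = w x, s the square
    root of v, m = M x, a = A x, z = p(x). Multiplied by 2 v, the derivatives of p and A are
    expressed through p and A. *)
Lemma Bernstein_derivative (r N v m a a1 s z z1 : R) :
  2 * v * z1 = a - r * z -> 8 * N * v = 2 * (m - 1) -> 2 * v * a1 = r * a - z * m ->
  v = s ^+ 2 -> m != 0 -> s != 0 ->
  r / s * (z ^+ 2 + a ^+ 2 / m) +
    s * (2 * z * z1 + 2 * a * a1 / m - a ^+ 2 * (8 * N * r) / m ^+ 2) =
  2 * r * a ^+ 2 / (s * m ^+ 2).
Proof.
move=> e1 e2 e3 vs m0 s0.
transitivity ((r * (z ^+ 2 + a ^+ 2 / m) + (z * (2 * v * z1) + a * (2 * v * a1) / m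
    - a ^+ 2 * (8 * N * v) * r / m ^+ 2)) / s).
  by rewrite vs; field; rewrite m0 s0.
by rewrite e1 e2 e3; field; rewrite m0 s0.
Qed.

Lemma legq_Bernstein n t : (0 < n)%N -> 0 <= t <= 2 ->
  Num.sqrt (t * (2 - t)) * (legq n).[t] ^+ 2 <= 2 / (pi * n%:R) :> R.
Proof.
move=> n1; have pi0 : 0 < pi :> R by exact: pi_gt0.
have n0 : 0 < n%:R :> R by rewrite ltr0n.
suff H y : 0 < y <= 1 -> Num.sqrt (y * (2 - y)) * (legq n).[y] ^+ 2 <= 2 / (pi * n%:R) :> R.
  move=> /andP[t0 t2]; have [t1|t1] := leP t 1.
    have [->|t0'] := eqVneq t 0; first by rewrite mul0r sqrtr0 mul0r divr_ge0// mulr_ge0// ltW.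
    by apply: H; rewrite lt_neqAle eq_sym t0' t0.
  have [->|t2'] := eqVneq t 2; first by rewrite subrr mulr0 sqrtr0 mul0r divr_ge0// mulr_ge0// ltW.
  have e : t * (2 - t) = (2 - t) * (2 - (2 - t)) by ring.
  by rewrite e -legq_sqr_sym; apply: H; rewrite subr_gt0 lt_neqAle t2' t2/=; lra.
move=> /andP[y0 y1]; set p := legq n.
pose N : R := (n%:R + 1 / 2) ^+ 2; have N0 : 0 < N by rewrite exprn_gt0// addr_gt0.
pose w (x : R) := x * (2 - x); pose M x := 4 * N * w x + 1.
have w0 x : 0 < x <= 1 -> 0 < w x by move=> /andP[x0 x1]; rewrite mulr_gt0//; lra.
have M0 x : 0 < x <= 1 -> 0 < M x.
  by move=> /w0 wx; rewrite /M addr_gt0// mulr_gt0// mulr_gt0.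
(* With x = 1 - cos(theta), the function y = w^(1/4) p satisfies y'' + (N + 1/(4 w)) y = 0 in theta.
   Here y' = w^(-1/4) A / 2 and N + 1/(4 w) = M / (4 w), so [S] is y^2 + y'^2 / (N + 1/(4 w)). It
   increases up to x = 1 because the potential decreases there. *)
pose A x := (1 - x) * p.[x] + 2 * w x * p^`().[x].
pose S x := Num.sqrt (w x) * (p.[x] ^+ 2 + A x ^+ 2 / M x).
pose dS x := 2 * (1 - x) * A x ^+ 2 / (Num.sqrt (w x) * M x ^+ 2).
have dSE (x : R) : 0 < x <= 1 -> is_derive x 1 S (dS x).
  move=> x01; have wx := w0 _ x01; have Mx := M0 _ x01.
  have swx : 0 < Num.sqrt (w x) by rewrite sqrtr_gt0.
  have d1 := is_derive_horner p x; have d2 := is_derive_horner p^`() x.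
  have dw : is_derive x 1 w (2 * (1 - x)).
    by rewrite /w; apply: is_derive_eq; rewrite /GRing.scale/=; ring.
  have dsq : is_derive x 1 (fun x => Num.sqrt (w x)) ((1 - x) / Num.sqrt (w x)).
    have ds := is_derive1_sqrt wx.
    have := @is_derive1_comp R Num.sqrt w x _ _ ds dw.
    move=> H; apply: is_derive_eq H _; rewrite /GRing.scale/=.
    by move: (Num.sqrt _) (lt0r_neq0 swx) => z hz; field.
  have dM : is_derive x 1 M (8 * N * (1 - x)).
    by rewrite /M; apply: is_derive_eq; rewrite /GRing.scale/=; ring.
  have ode := legq_odeE n x; rewrite -/p -/(w x) in ode.
  have dA : is_derive x 1 A ((1 - x) * p^`().[x] - (1 + 2 * (n%:R * (n%:R + 1))) * p.[x]).
    rewrite /A; apply: is_derive_eq; rewrite /GRing.scale/=.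
    move: (p.[x]) (p^`().[x]) (p^`()^`().[x]) (w x) ode => z z1 z2 v ode.
    have e : v * z2 = - (2 * (1 - x) * z1) - n%:R * (n%:R + 1) * z by lra.
    transitivity (- z + 5 * (1 - x) * z1 + 2 * (v * z2)); first by ring.
    by rewrite e; ring.
  have dMV := is_deriveV (lt0r_neq0 Mx) dM.
  rewrite /S; apply: is_derive_eq; rewrite /GRing.scale/= /dS.
  have e1 : 2 * w x * p^`().[x] = A x - (1 - x) * p.[x] by rewrite /A; ring.
  have e2 : 8 * N * w x = 2 * (M x - 1) by rewrite /M; ring.
  have e3 : 2 * w x * ((1 - x) * p^`().[x] - (1 + 2 * (n%:R * (n%:R + 1))) * p.[x]) =
      (1 - x) * A x - p.[x] * M x.
    by rewrite /A /M /N /w; field.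
  have sw : w x = Num.sqrt (w x) ^+ 2 by rewrite sqr_sqrtr// ltW.
  have := Bernstein_derivative e1 e2 e3 sw (lt0r_neq0 Mx) (lt0r_neq0 swx) => H.
  apply: etrans H; move: (lt0r_neq0 Mx) (lt0r_neq0 swx).
  move: (1 - x) (N) (Num.sqrt _) (M x) (A x) (p.[x]) (p^`().[x]) => r N' s' m a z z1 m0 s0.
  by field; rewrite m0 s0.
have S1 : S y <= S 1.
  apply: (@derive_nondecreasing R S dS y 1 y1).
  - by move=> x; rewrite in_itv/= => /andP[yx x1]; apply: dSE; rewrite (lt_trans y0 yx) ltW.
  - move=> x; rewrite in_itv/= => /andP[yx x1].
    have x1' : 0 <= 1 - x by rewrite subr_ge0 ltW.
    apply: divr_ge0; apply: mulr_ge0; rewrite ?sqr_ge0 ?sqrtr_ge0//; exact: mulr_ge0.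
  - apply: (@within_continuous_derive R _ dS) => x /=; rewrite in_itv/= => /andP[yx x1].
    by apply: dSE; rewrite x1 (lt_le_trans y0 yx).
apply: (le_trans _ (le_trans S1 _)).
  by rewrite ler_wpM2l ?sqrtr_ge0// lerDl divr_ge0 ?sqr_ge0// ltW// M0// y0.
have w1 : w 1 = 1 by rewrite /w; ring.
rewrite /S /M /A w1 sqrtr1 mul1r subrr mul0r add0r mulr1.
case: n n1 @p @N N0 n0 {dSE S1 w0 M0 w1 w M A S dS} => // m _ p N N0 n0.
rewrite legq_deriv_one natr1; have m0 : 0 <= m%:R :> R by [].
have := @legq_one_bound m; have := @legq_one_bound m.+1; rewrite -/p.
have e : m.+1%:R = m%:R + 1 :> R by rewrite natr1.
(* At the midpoint either p or p' vanishes, according to parity; [legq_one_bound] handles the other,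
   at degree m through p' or at degree m + 1. *)
have [om|em] := boolP (odd m.+1).
  rewrite {1 2}/p legq_one_odd// expr0n/= add0r => _.
  move: ((legq m).[1]) => z zb.
  have m1 : 0 < 2 * m%:R + 1 :> R by rewrite ltr_wpDl// mulr_ge0.
  have D0 : 0 < 4 * N * 1 + 1 by rewrite mulr1 addr_gt0// mulr_gt0.
  rewrite ler_pdivlMr ?mulr_gt0// in zb.
  rewrite ler_pdivrMr//.
  rewrite mulrAC ler_pdivlMr ?mulr_gt0// -(ler_pM2r m1) /N e.
  have m3 : 0 <= 4 * (m%:R + 1) ^+ 3 :> R by rewrite mulr_ge0// exprn_ge0// addr_ge0.
  have := ler_wpM2l m3 zb; have := sqr_ge0 (m%:R : R).
  move: (m%:R : R) (pi : R) m0 => M q M0 h0 h1.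
  apply: (@le_trans _ _ (4 * (M + 1) ^+ 3 * (z ^+ 2 * (q * (2 * M + 1))))).
    by rewrite le_eqVlt; apply/orP; left; apply/eqP; ring.
  by apply: (le_trans h1); rewrite -subr_ge0 (_ : _ - _ = 8 * M ^+ 2 + 16 * M + 4); [lra|field].
rewrite (legq_one_odd (n := m)) ?mulr0; last by move: em; rewrite /= negbK.
move=> zb _; rewrite expr0n/= mul0r addr0; apply: (le_trans zb).
rewrite ler_pdivlMr; last exact: mulr_gt0.
rewrite mulrAC ler_pdivrMr; last by rewrite mulr_gt0// addr_gt0// mulr_gt0.
by rewrite e; move: (m%:R : R) (pi : R) m0 pi0; clear => M q M0 q0; nra.
Qed.

End legendre_bounds.

(** * Integration against functions of bounded variation *)

Section bounded_variation_integral.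
Context {R : realType}.
Notation leb := (@lebesgue_measure R).
Implicit Types (v h H : R -> R) (a b x y M K : R).

Definition variation_fun a v x : R := fine (total_variation a x v).

Lemma variation_fun_bound a b v x y : bounded_variation a b v ->
  a <= x -> x <= y -> y <= b ->
  `|v y - v x| <= variation_fun a v y - variation_fun a v x.
Proof.
move=> bv ax xy yb.
have fin c d : a <= c -> c <= d -> d <= b -> total_variation c d v \is a fin_num.
  move=> ac cd db; apply/bounded_variationP => //.
  by apply: (bounded_variationr ac cd); apply: (bounded_variationl (le_trans ac cd) db).
have ay := le_trans ax xy; have xb := le_trans xy yb.
rewrite -lee_fin /variation_fun EFinB !fineK ?fin//.
rewrite (@total_variationD _ a y x)// addeAC subee ?add0e ?fin//.
exact: total_variation_ge.
Qed.

Lemma variation_fun_nondecreasing a b v : bounded_variation a b v ->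
  {in `[a, b] &, nondecreasing_fun (variation_fun a v)}.
Proof.
move=> bv x y; rewrite !in_itv/= => /andP[ax _] /andP[_ yb] xy.
by have := variation_fun_bound bv ax xy yb; have := normr_ge0 (v y - v x); lra.
Qed.

Lemma variation_funB_nondecreasing a b v : bounded_variation a b v ->
  {in `[a, b] &, nondecreasing_fun (fun x => variation_fun a v x - v x)}.
Proof.
move=> bv x y; rewrite !in_itv/= => /andP[ax _] /andP[_ yb] xy.
by have := variation_fun_bound bv ax xy yb; have := ler_norm (v y - v x); lra.
Qed.

Lemma BV_right_limit a b v : a < b -> bounded_variation a b v ->
  exists l : R, v x @[x --> a^'+] --> l.
Proof.
move=> ab bv.
have cv f : {in `[a, b] &, nondecreasing_fun f} -> exists l : R, f x @[x --> a^'+] --> l.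
  move=> nf; eexists; apply: (@nondecreasing_at_right_cvgr R f a (BLeft b)).
  - by rewrite bnd_simp.
  - by move=> x y xab yab; apply: nf; exact: subset_itv_oo_cc.
  - exists (f a) => _ [x xab <-]; apply: nf; rewrite ?bound_itvE ?(ltW ab)//.
      exact: subset_itv_oo_cc.
    by move: xab; rewrite /= in_itv/= => /andP[/ltW].
have [l1 h1] := cv _ (variation_fun_nondecreasing bv).
have [l2 h2] := cv _ (variation_funB_nondecreasing bv).
exists (l1 - l2); apply: (cvg_trans _ (cvgB h1 h2)).
apply: near_eq_cvg; apply: nearW => x /=; rewrite !fctE/=; ring.
Qed.

Lemma BV_measurable a b v : a <= b -> bounded_variation a b v ->
  measurable_fun (`[a, b] : set (measurableTypeR R)) v.
Proof.
move=> ab bv; pose c := clamp a b.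
have cab x : c x \in `[a, b].
  by rewrite in_itv/= /c; case: (clampE x ab) => -[h ->]; lra.
have cle x y : x <= y -> c x <= c y.
  by rewrite /c => xy; case: (clampE x ab) => -[h ->]; case: (clampE y ab) => -[h' ->]; lra.
have mm (f : R -> R) : {in `[a, b] &, nondecreasing_fun f} ->
    measurable_fun (`[a, b] : set (measurableTypeR R)) (fun x : R => f (c x)).
  move=> nf; apply: nondecreasing_measurable => // x y xy; apply: nf => //; exact: cle.
apply: (@eq_measurable_fun _ _ _ _ _ (fun x => (variation_fun a v \o c) x -
    ((fun x => variation_fun a v x - v x) \o c) x)).
  move=> x /set_mem/=; rewrite in_itv/= /c => xab.
  by case: (clampE x ab) => -[h ->]; rewrite opprB addrC subrK//; congr v; lra.
apply: measurable_funB; apply: mm.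
  exact: variation_fun_nondecreasing.
exact: variation_funB_nondecreasing.
Qed.

Lemma BV_bounded a b v x : bounded_variation a b v -> a <= x <= b ->
  `|v x| <= `|v a| + variation_fun a v b.
Proof.
move=> bv /andP[ax xb]; have := variation_fun_bound bv (lexx a) ax xb.
have bb := lexx b; have := variation_fun_bound bv ax xb bb.
have -> : variation_fun a v a = 0 by rewrite /variation_fun total_variationxx.
have := ler_normD (v a) (v x - v a); rewrite addrC subrK.
have := normr_ge0 (v b - v x); lra.
Qed.

(** Summation by parts with weights at the right endpoints: the weight at the left end, [w 0], never
    occurs. *)
Lemma abel_sum (w G : nat -> R) n :
  \sum_(i < n.+1) w i.+1 * (G i.+1 - G i) =
  w n.+1 * G n.+1 - w 1%N * G 0%N - \sum_(i < n) (w i.+2 - w i.+1) * G i.+1.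
Proof.
elim: n => [|n IH]; first by rewrite big_ord_recl !big_ord0 /= addr0 subr0; ring.
by rewrite big_ord_recr /= IH [in RHS]big_ord_recr/=; ring.
Qed.

Lemma bounded_integrable a b h M : measurable_fun (`[a, b] : set (measurableTypeR R)) h ->
  (forall x, a <= x <= b -> `|h x| <= M) -> leb.-integrable `[a, b] (EFin \o h).
Proof.
move=> mh hM; apply: measurable_bounded_integrable => //.
  by apply: compact_finite_measure; exact: segment_compact.
exists M; split; first exact: num_real.
move=> x Mx y /=; rewrite in_itv/= => yab; exact: le_trans (hM _ yab) (ltW Mx).
Qed.

Lemma integrable_funB (D : set (measurableTypeR R)) (f g : R -> R) : measurable D ->
  leb.-integrable D (EFin \o f) -> leb.-integrable D (EFin \o g) ->
  leb.-integrable D (EFin \o (fun t => f t - g t)).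
Proof. by move=> mD fi gi; have := integrableB mD fi gi; apply: eq_integrable. Qed.

(* Riemann-Stieltjes sums over uniform partitions, evaluated at the right
   endpoints so that only v(a+) remains at a. *)
Lemma BV_integral_bound a b v h H M K l : a < b -> bounded_variation a b v ->
  measurable_fun (`[a, b] : set (measurableTypeR R)) h ->
  (forall x, a <= x <= b -> `|h x| <= M) ->
  (forall x y, a <= x -> x <= y -> y <= b -> H y - H x = \int[leb]_(t in `]x, y]) h t) ->
  H b = 0 -> (forall x, a <= x <= b -> `|H x| <= K) ->
  v x @[x --> a^'+] --> l ->
  `|\int[leb]_(x in `[a, b]) (v x * h x)| <=
  `|l| * `|H a| + variation_fun a v b * K.
Proof.
move=> ab bv mh hM HE Hb HK vl; have ab' := ltW ab.
have mv := BV_measurable ab' bv.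
pose V := variation_fun a v; pose B := `|v a| + V b.
have vB x : a <= x <= b -> `|v x| <= B by move=> xab; exact: BV_bounded.
have ba0 : 0 < b - a by rewrite subr_gt0.
have M0 : 0 <= M by apply: le_trans (hM a _); rewrite ?lexx.
have K0 : 0 <= K by apply: le_trans (HK a _); rewrite ?lexx.
have sub x y : a <= x -> y <= b -> `]x, y]%classic `<=` `[a, b]%classic.
  by move=> ax yb t /=; rewrite !in_itv/= => /andP[/ltW xt ty]; rewrite (le_trans ax xt) (le_trans ty yb).
have iS (f : R -> R) (x y : R) : leb.-integrable `[a, b] (EFin \o f) -> a <= x -> y <= b ->
    leb.-integrable `]x, y] (EFin \o f).
  by move=> fi ax yb; apply: (@integrableS _ _ _ _ (`[a, b]%classic : set (measurableTypeR R))) => //; exact: sub.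
have ih : leb.-integrable `[a, b] (EFin \o h) by exact: bounded_integrable hM.
have ivh : leb.-integrable `[a, b] (EFin \o (fun x => v x * h x)).
  apply: (@bounded_integrable _ _ _ (B * M)); first exact: measurable_funM.
  by move=> x xab; rewrite normrM ler_pM ?vB ?hM.
have ich (c : R) : leb.-integrable `[a, b] (EFin \o (fun t => c * h t)).
  apply: (@bounded_integrable _ _ _ (`|c| * M)); first exact: measurable_funM.
  by move=> x xab; rewrite normrM ler_wpM2l ?hM.
have cell x y : a <= x -> x <= y -> y <= b ->
    `|\int[leb]_(t in `]x, y]) (v t * h t) - v y * (H y - H x)| <=
    (V y - V x) * M * (y - x).
  move=> ax xy yb; rewrite HE// -RintegralZl//; last exact: iS.
  rewrite -RintegralB//; [|exact: iS|]; last first.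
    exact: (iS (fun t => v y * h t) _ _ (ich _)).
  have id : leb.-integrable `]x, y] (EFin \o (fun t => v t * h t - v y * h t)).
    have i1 := iS _ x y ivh ax yb.
    have i2 : leb.-integrable `]x, y] (EFin \o (fun t => v y * h t)).
      exact: (iS (fun t => v y * h t) _ _ (ich _)).
    exact: integrable_funB.
  apply: (le_trans (le_normr_Rintegral _ id)) => //.
  have -> : (V y - V x) * M * (y - x) = \int[leb]_(t in `]x, y]) ((V y - V x) * M).
    rewrite Rintegral_cst// /= lebesgue_measure_itv/= lte_fin; congr (_ * _).
    move: xy; rewrite le_eqVlt => /predU1P[->|->]; first by rewrite ltxx subrr.
    by [].
  apply: le_Rintegral => //.
  - exact: (integrable_norm id).
  - apply: iS => //; apply: (@bounded_integrable _ _ _ `|(V y - V x) * M|) => //.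
  move=> t; rewrite /= in_itv/= => /andP[/ltW xt ty].
  have at_ := le_trans ax xt; have tb := le_trans ty yb.
  rewrite -mulrBl normrM ler_pM ?hM ?at_ ?tb//.
  rewrite distrC (le_trans (variation_fun_bound bv at_ ty yb))// lerD2l lerN2.
  by apply: (variation_fun_nondecreasing bv); rewrite ?in_itv/= ?ax ?at_ ?tb ?(le_trans xt tb)//.
(* Over the cells the errors add up to at most V b M times the mesh, which tends to 0. The remaining
   sum is treated by [abel_sum], where H b = 0 removes the last boundary term. *)
have main n : `|\int[leb]_(x in `[a, b]) (v x * h x)| <=
   `|v (a + (b - a) / n.+1%:R)| * `|H a| + V b * K + V b * M * ((b - a) / n.+1%:R).
  set d := (b - a) / n.+1%:R; pose x i : R := a + i%:R * d.
  have d0 : 0 < d by rewrite divr_gt0.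
  have xS i : x i <= x i.+1 by rewrite /x lerD2l ler_pM2r// ler_nat.
  have ax i : a <= x i by rewrite lerDl mulr_ge0// ltW.
  have xb i : (i <= n.+1)%N -> x i <= b.
    move=> ni; have -> : b = x n.+1 by rewrite /x /d mulrC divfK// addrC subrK.
    by rewrite lerD2l ler_pM2r// ler_nat.
  have xn : x n.+1 = b by rewrite /x /d mulrC divfK// addrC subrK.
  have x0 : x 0%N = a by rewrite /x mul0r addr0.
  have d1 i : x i.+1 - x i = d by rewrite /x -natr1; ring.
  pose I i := \int[leb]_(t in `]x i, x i.+1]) (v t * h t).
  have IE : \int[leb]_(t in `[a, b]) (v t * h t) = \sum_(i < n.+1) I i.
    pose Ph i := \int[leb]_(t in `[a, x i]) (v t * h t).
    have PhS i : (i < n.+1)%N -> Ph i.+1 - Ph i = I i.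
      move=> ni; rewrite /Ph /I Rintegral_itvB// ?bnd_simp ?ax ?xS//.
      by apply: (@integrableS _ _ _ _ (`[a, b]%classic : set (measurableTypeR R))) => // t /=; rewrite !in_itv/= => /andP[-> /le_trans ->]//; exact: xb.
    have -> : \sum_(i < n.+1) I i = \sum_(i < n.+1) (Ph i.+1 - Ph i).
      by apply: eq_bigr => i _; rewrite PhS.
    rewrite -(big_mkord xpredT (fun i => Ph i.+1 - Ph i)) telescope_sumr// /Ph xn x0.
    by rewrite set_itv1 Rintegral_set1 subr0.
  rewrite IE; have -> : \sum_(i < n.+1) I i =
     \sum_(i < n.+1) v (x i.+1) * (H (x i.+1) - H (x i)) +
     \sum_(i < n.+1) (I i - v (x i.+1) * (H (x i.+1) - H (x i))).
    by rewrite -big_split/=; apply: eq_bigr => i _; ring.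
  apply: (le_trans (ler_normD _ _)); apply: lerD; last first.
    apply: (le_trans (ler_norm_sum _ _ _)).
    apply: (@le_trans _ _ (\sum_(i < n.+1) (V (x i.+1) - V (x i)) * (M * d))).
      apply: ler_sum => i _; apply: (le_trans (cell _ _ (ax _) (xS _) (xb _ (ltn_ord i)))).
      by rewrite d1 mulrA.
    rewrite -mulr_suml -(big_mkord xpredT (fun i => V (x i.+1) - V (x i))) telescope_sumr//.
    by rewrite xn x0 /V {2}/variation_fun total_variationxx subr0 mulrA.
  rewrite (abel_sum (v \o x) (H \o x))/= xn Hb mulr0 sub0r x0.
  have -> : x 1%N = a + d by rewrite /x mul1r.
  apply: (le_trans (ler_normB _ _)); rewrite normrN normrM lerD2l.
  apply: (le_trans (ler_norm_sum _ _ _)).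
  apply: (@le_trans _ _ (\sum_(i < n) (V (x i.+2) - V (x i.+1)) * K)).
    apply: ler_sum => i _; have ni : (i.+2 <= n.+1)%N by rewrite !ltnS.
    rewrite normrM ler_pM ?HK ?ax ?xb ?(ltnW ni)//.
    by apply: variation_fun_bound bv _ _ _; rewrite ?ax ?xb.
  rewrite -mulr_suml ler_wpM2r// -(big_mkord xpredT (fun i => V (x i.+2) - V (x i.+1))).
  rewrite (telescope_sumr (fun i => V (x i.+1)))// xn lerBlDr lerDl.
  have := variation_fun_nondecreasing bv (x := a) (y := x 1%N).
  by rewrite !in_itv/= lexx ab' ax xb// {1}/variation_fun total_variationxx; apply.
pose e n : R := (b - a) / n.+1%:R.
have e0 : e n @[n --> \oo] --> (0 : R).
  by rewrite -[X in _ --> X](mulr0 (b - a)); apply: cvgMr; exact: cvg_harmonic.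
have ve : v (a + e n) @[n --> \oo] --> l.
  move/cvg_at_rightP : vl; apply; split=> [n|].
    by rewrite ltrDl divr_gt0.
  by rewrite -[X in _ --> X]addr0; apply: cvgD => //; exact: cvg_cst.
have c1 : `|v (a + e n)| * `|H a| @[n --> \oo] --> `|l| * `|H a|.
  by apply: cvgM_seq; [exact: cvg_norm ve|exact: cvg_cst].
have c2 : V b * M * e n @[n --> \oo] --> V b * M * 0.
  by apply: cvgM_seq => //; exact: cvg_cst.
have c3 : `|v (a + e n)| * `|H a| + V b * K + V b * M * e n @[n --> \oo] -->
    `|l| * `|H a| + V b * K + V b * M * 0.
  by apply: cvgD => //; apply: cvgD => //; exact: cvg_cst.
rewrite mulr0 addr0 in c3.
have c0 : `|\int[leb]_(x in `[a, b]) (v x * h x)| @[n --> \oo] -->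
  `|\int[leb]_(x in `[a, b]) (v x * h x)| by exact: cvg_cst.
by apply: (ler_cvg_to c0 c3); apply: nearW => n; exact: main.
Qed.

End bounded_variation_integral.

(** * Integration by parts for absolutely continuous functions *)

Section absolutely_continuous.
Context {R : realType}.
Notation leb := (@lebesgue_measure R).
Implicit Types (u f g q Q : R -> R) (a b x y L M : R).

Lemma integrable_mul_bounded (D : set (measurableTypeR R)) f g M : measurable D ->
  measurable_fun D f -> (forall x, D x -> `|f x| <= M) -> leb.-integrable D (EFin \o g) ->
  leb.-integrable D (EFin \o (fun x => f x * g x)).
Proof.
move=> mD mf fM gi; have mg := measurable_int _ gi.
have Mg : leb.-integrable D (fun x => (M%:E * (g x)%:E)%E).
  exact: (integrableZl mD M gi).
apply: (le_integrable mD _ _ Mg).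
  by apply/measurable_EFinP; apply: measurable_funM => //; apply/measurable_EFinP.
move=> x Dx /=; rewrite lee_fin !normrM ler_wpM2r//.
by rewrite (le_trans (fM x Dx))// ler_norm.
Qed.

Lemma abs_cont_BV a b u : a <= b -> abs_cont a b u -> bounded_variation a b u.
Proof. by move=> ab /abs_cont_ac_seq; exact: ac_seq_bounded_variation. Qed.

Lemma abs_cont_measurable a b u : a <= b -> abs_cont a b u ->
  measurable_fun (`[a, b] : set (measurableTypeR R)) u.
Proof. by move=> ab /(abs_cont_BV ab); exact: BV_measurable. Qed.

Lemma abs_cont_bounded a b u : a <= b -> abs_cont a b u ->
  exists2 M, 0 < M & forall x, a <= x <= b -> `|u x| <= M.
Proof.
move=> ab /(abs_cont_BV ab) bv; exists (`|u a| + variation_fun a u b + 1).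
  by rewrite ltr_pwDr// (le_trans _ (BV_bounded bv (x := a) _))// lexx.
by move=> x xab; rewrite (le_trans (BV_bounded bv xab))// lerDl.
Qed.

Lemma abs_cont_integrable a b u : a <= b -> abs_cont a b u ->
  leb.-integrable `[a, b] (EFin \o u).
Proof.
move=> ab acu; have [M _ uM] := abs_cont_bounded ab acu.
exact: bounded_integrable (abs_cont_measurable ab acu) uM.
Qed.

Lemma abs_contM a b u Q : a <= b -> abs_cont a b u -> abs_cont a b Q ->
  abs_cont a b (fun x => u x * Q x).
Proof.
move=> ab acu acQ; have [M M0 uM] := abs_cont_bounded ab acu.
have [L L0 QL] := abs_cont_bounded ab acQ.
move=> e e0.
have eL : 0 < e / (2 * L) by rewrite divr_gt0// mulr_gt0.
have eM : 0 < e / (2 * M) by rewrite divr_gt0// mulr_gt0.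
have [d1 d10 H1] := acu _ eL; have [d2 d20 H2] := acQ _ eM.
exists (Num.min d1 d2) => [|n x y xy txy]; first by rewrite lt_min d10.
rewrite lt_min => /andP[s1 s2].
have K1 := H1 _ _ _ xy txy s1; have K2 := H2 _ _ _ xy txy s2.
apply: (@le_lt_trans _ _ (L * \sum_i `|u (y i) - u (x i)| + M * \sum_i `|Q (y i) - Q (x i)|)).
  rewrite !mulr_sumr -big_split/=; apply: ler_sum => i _; have [ax xyi yb] := xy i.
  have -> : u (y i) * Q (y i) - u (x i) * Q (x i) =
    Q (y i) * (u (y i) - u (x i)) + u (x i) * (Q (y i) - Q (x i)) by ring.
  apply: (le_trans (ler_normD _ _)); rewrite !normrM lerD// ler_wpM2r//.
    by rewrite QL// yb (le_trans ax (ltW xyi)).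
  by rewrite uM// ax (le_trans (ltW xyi) yb).
have -> : e = L * (e / (2 * L)) + M * (e / (2 * M)).
  by field; rewrite !gt_eqF.
by apply: ltrD; rewrite ltr_pM2l.
Qed.

Lemma lipschitz_abs_cont a b Q L :
  (forall x y, a <= x -> x <= y -> y <= b -> `|Q y - Q x| <= L * (y - x)) ->
  abs_cont a b Q.
Proof.
move=> QL e e0; have L0 : 0 < `|L| + 1 by rewrite ltr_wpDl.
exists (e / (`|L| + 1)) => [|n x y xy _ s]; first exact: divr_gt0.
apply: (@le_lt_trans _ _ ((`|L| + 1) * \sum_i (y i - x i))).
  rewrite mulr_sumr; apply: ler_sum => i _; have [ax xyi yb] := xy i.
  rewrite (le_trans (QL _ _ ax (ltW xyi) yb))// ler_wpM2r ?subr_ge0 ?(ltW xyi)//.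
  by rewrite (le_trans (ler_norm _))// lerDl.
by move: s; rewrite ltr_pdivlMr// mulrC.
Qed.

Lemma ae_imply2 (P Q S : set (measurableTypeR R)) : (almost_everywhere leb) P ->
  (almost_everywhere leb) Q -> (forall x, P x -> Q x -> S x) -> (almost_everywhere leb) S.
Proof.
move=> [N1 [mN1 N10 sN1]] [N2 [mN2 N20 sN2]] PQS; exists (N1 `|` N2); split.
- exact: measurableU.
- exact: null_set_setU.
move=> x /= nS; have [Px|nP] := pselect (P x); last by left; apply: sN1.
by right; apply: sN2 => /= Qx; apply: nS; exact: PQS.
Qed.

Lemma ae_itv_closed (P : set R) a b : {ae leb, forall x, x \in `]a, b[ -> P x} ->
  {ae leb, forall x, `[a, b]%classic x -> P x}.
Proof.
move=> [N [mN N0 sN]]; exists (N `|` ([set a] `|` [set b])); split.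
- by apply: measurableU => //; apply: measurableU; exact: measurable_set1.
- apply: null_set_setU; [by []|by apply: measurableU; exact: measurable_set1|by []|].
  apply: null_set_setU; [exact: measurable_set1|exact: measurable_set1|
    exact: lebesgue_measure_set1|exact: lebesgue_measure_set1].
move=> x /= nP.
have [->|xa] := eqVneq x a; first by right; left.
have [->|xb] := eqVneq x b; first by right; right.
left; apply: sN => /= H; apply: nP => xab; apply: H; move: xab.
by rewrite !in_itv/= => /andP[ax bx]; rewrite !lt_neqAle eq_sym xa ax xb.
Qed.

Definition ae_derivative a b u g :=
  {ae leb, forall x, x \in `]a, b[ -> is_derive x 1 u (g x)}.

Lemma abs_cont_density a b u : a < b -> abs_cont a b u ->
  exists g : R -> R, leb.-integrable setT (EFin \o g) /\ ae_derivative a b u g.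
Proof.
move=> ab acu; have [g [ig _ dg]] := abs_cont_FTC ab acu; exists g; split => //.
apply: (ae_imply dg) => x H xab; have [du gE] := H xab.
by apply: DeriveDef => //; rewrite -derive1E.
Qed.

(** An almost everywhere derivative agrees almost everywhere with the density of [abs_cont_FTC] and
    may be integrated in its place, without regard to its own measurability. *)
Lemma abs_cont_integral a b u g x y : a < b -> abs_cont a b u -> ae_derivative a b u g ->
  a <= x -> x <= y -> y <= b -> u y - u x = \int[leb]_(t in `]x, y]) g t.
Proof.
move=> ab acu dg ax xy yb; have [f [fi fE df]] := abs_cont_FTC ab acu.
rewrite (fE y) ?yb ?(le_trans ax xy)// (fE x) ?ax ?(le_trans xy yb)//.
have -> : u a + \int[leb]_(t in `[a, y]) f t - (u a + \int[leb]_(t in `[a, x]) f t) =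
  \int[leb]_(t in `[a, y]) f t - \int[leb]_(t in `[a, x]) f t by ring.
rewrite Rintegral_itvB ?bnd_simp//; last exact: (@integrableS _ _ _ _ setT).
apply: ae_eq_RintegralT.
have dd : {ae leb, forall t, t \in `]a, b[ -> f t = g t}.
  apply: (ae_imply2 df dg) => t h1 h2 tab.
  have [d1 <-] := h1 tab; have := h2 tab => d2.
  by rewrite derive1E derive_val.
apply: (ae_imply (ae_itv_closed dd)) => t H; rewrite /= in_itv/= => /andP[xt ty].
by apply: H; rewrite /= in_itv/= (le_trans ax (ltW xt)) (le_trans ty yb).
Qed.

(** The product is absolutely continuous, so its increment is the integral of its density, which the
    product rule identifies almost everywhere. *)
Lemma abs_cont_parts a b u g Q q M : a < b -> abs_cont a b u -> abs_cont a b Q ->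
  leb.-integrable setT (EFin \o g) -> measurable_fun (`[a, b] : set (measurableTypeR R)) q ->
  (forall x, a <= x <= b -> `|q x| <= M) ->
  ae_derivative a b u g -> ae_derivative a b Q q ->
  \int[leb]_(x in `[a, b]) (u x * q x) =
  u b * Q b - u a * Q a - \int[leb]_(x in `[a, b]) (g x * Q x).
Proof.
move=> ab acu acQ gi mq qM dg dq; have ab' := ltW ab.
have acuQ := abs_contM ab' acu acQ.
have [G [Gi dG]] := abs_cont_density ab acuQ.
have [L _ uL] := abs_cont_bounded ab' acu; have [L' _ QL] := abs_cont_bounded ab' acQ.
rewrite (abs_cont_integral ab acuQ dG (lexx a) ab' (lexx b)).
rewrite Rintegral_itv_obnd_cbnd; last exact: (@integrableS _ _ _ _ setT).
have i1 : leb.-integrable `[a, b] (EFin \o (fun x => u x * q x)).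
  apply: (@bounded_integrable _ _ _ _ (L * M)).
    by apply: measurable_funM => //; exact: abs_cont_measurable.
  by move=> x xab; rewrite normrM ler_pM ?uL ?qM.
have i2 : leb.-integrable `[a, b] (EFin \o (fun x => Q x * g x)).
  apply: (@integrable_mul_bounded _ _ _ L') => //.
  - exact: abs_cont_measurable.
  - exact: (@integrableS _ _ _ _ setT).
have -> : \int[leb]_(x in `[a, b]) (g x * Q x) = \int[leb]_(x in `[a, b]) (Q x * g x).
  by apply: eq_Rintegral => x _; rewrite mulrC.
have -> : \int[leb]_(x in `[a, b]) G x = \int[leb]_(x in `[a, b]) (u x * q x + Q x * g x).
  apply: ae_eq_RintegralT; apply: ae_itv_closed.
  apply: (ae_imply2 dG (ae_imply2 dg dq (fun x h1 h2 => conj h1 h2))) => x h1 [h2 h3] xab.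
  have d1 := h1 xab; have d2 := h2 xab; have d3 := h3 xab.
  have d4 := is_deriveM d2 d3; rewrite -(@derive_val _ _ _ _ _ _ _ d1).
  by rewrite (@derive_val _ _ _ _ _ _ _ d4).
by rewrite RintegralD// addrK.
Qed.

Lemma fracp_bounded s (p : {poly R}) : 0 <= s ->
  exists M, forall t, 0 <= t <= 2 -> `|fracp s p t| <= M.
Proof.
move=> s0; exists (\sum_(i < size p) `|p`_i * i`!%:R / gam (i%:R + 1 + s)| * 2 `^ (i%:R + s)).
move=> t /andP[t0 t2]; apply: (le_trans (ler_norm_sum _ _ _)); apply: ler_sum => i _.
rewrite normrM ler_wpM2l// ger0_norm ?powR_ge0// ge0_ler_powR ?nnegrE//.
by rewrite addr_ge0.
Qed.

Lemma fracp_measurable s (p : {poly R}) (D : set (measurableTypeR R)) :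
  measurable_fun D (fun x : R => fracp s p (1 - x)).
Proof.
apply: measurable_sum => i; apply: measurable_funM => //.
apply: (measurableT_comp (measurable_powR _)).
exact: measurable_funB.
Qed.

Lemma fracp1B_is_derive s (p : {poly R}) x : 0 <= s -> x < 1 ->
  is_derive x 1 (fun x => fracp (s + 1) p (1 - x)) (- fracp s p (1 - x)).
Proof.
move=> s0 x1; have s1 : 0 < s + 1 by rewrite ltr_wpDl.
have t0 : 0 < 1 - x by rewrite subr_gt0.
have d1 := @fracp_is_derive R _ p _ s1 t0; rewrite addrK in d1.
have d2 : is_derive x 1 (fun x : R => 1 - x) (-1).
  by apply: is_derive_eq; rewrite /GRing.scale/=; ring.
have := @is_derive1_comp R _ _ x _ _ d1 d2; rewrite mulrN1.
by [].
Qed.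

Lemma fracp_abs_cont s (p : {poly R}) a b : 0 <= s -> -1 <= a -> b <= 1 ->
  abs_cont a b (fun x => fracp (s + 1) p (1 - x)).
Proof.
move=> s0 a1 b1; have [M HM] := fracp_bounded p s0.
apply: (@lipschitz_abs_cont _ _ _ M) => x y ax xy yb.
have s1 : 0 < s + 1 by rewrite ltr_wpDl.
move: xy; rewrite le_eqVlt => /predU1P[->|xy]; first by rewrite !subrr normr0 mulr0.
have ab : 1 - y < 1 - x by lra.
have [||c] := @MVT R (fracp (s + 1) p) (fracp s p) _ _ ab.
- move=> t; rewrite in_itv/= => /andP[t1 t2]; have t0 : 0 < t by lra.
  by have := @fracp_is_derive R _ p _ s1 t0; rewrite addrK.
- have cf := @fracp_continuous R (s + 1) p (1 - x) s1.
  by apply: continuous_subspaceW cf => t/=; rewrite !in_itv/= => /andP[t1 ->]; rewrite andbT; lra.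
rewrite in_itv/= => /andP[c1 c2] E; rewrite distrC E normrM.
have -> : 1 - x - (1 - y) = y - x by ring.
rewrite (ger0_norm (_ : 0 <= y - x)); last by lra.
by rewrite ler_wpM2r ?HM//; lra.
Qed.

(** Here [v] is u^(j) as an absolutely continuous function on the closed interval. The condition j <
    n is what makes the integral of order j + 1 vanish at x = -1. *)
Lemma legendre_parts_step j (u v : R -> R) : abs_cont (-1) 1 v ->
  {in `]-1, 1[, derive1n j u =1 v} ->
  (forall n, (j <= n)%N -> \int[leb]_(x in `[-1, 1]) (u x * (legendre n).[x]) =
     \int[leb]_(x in `[-1, 1]) (v x * fracp j%:R (legq n) (1 - x))) ->
  exists f : R -> R, [/\ leb.-integrable setT (EFin \o f),
    {ae leb, forall x, x \in `]-1, 1[ -> derive1n j.+1 u x = f x} &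
    forall n, (j < n)%N -> \int[leb]_(x in `[-1, 1]) (u x * (legendre n).[x]) =
     \int[leb]_(x in `[-1, 1]) (f x * fracp j.+1%:R (legq n) (1 - x))].
Proof.
move=> acv vE IH; have ab : -1 < 1 :> R by lra.
have [f [fi df]] := abs_cont_density ab acv; exists f; split => //.
  apply: (ae_imply df) => x H xab; have dv := H xab.
  have nv : \near x, v x = derive1n j u x.
    have := near_in_itvoo xab; apply: filterS => y yab; by rewrite vE.
  by rewrite derive1nS derive1E (near_eq_derive (f := derive1n j u) (g := v)) ?derive_val//;
    apply: filterS nv.
move=> n jn; rewrite (IH n (ltnW jn)).
have j0 : 0 <= j%:R :> R by [].
have [M HM] := fracp_bounded (legq n) j0.
pose Q x := fracp (j%:R + 1) (legq n) (1 - x).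
pose q x := - fracp j%:R (legq n) (1 - x).
have acQ : abs_cont (-1) 1 Q by apply: fracp_abs_cont.
have mq : measurable_fun (`[-1, 1] : set (measurableTypeR R)) q.
  apply: (@eq_measurable_fun _ _ _ _ _ (fun x : R => -1 * fracp j%:R (legq n) (1 - x))).
    by move=> x _; rewrite mulN1r.
  by apply: measurable_funM => //; exact: fracp_measurable.
have qM x : -1 <= x <= 1 -> `|q x| <= M.
  by move=> /andP[x1 x2]; rewrite normrN HM//; lra.
have dQ : ae_derivative (-1) 1 Q q.
  exists set0; split => // x/=; apply: contra_notP => _; rewrite in_itv/= => /andP[_ x1].
  exact: fracp1B_is_derive.
have := abs_cont_parts ab acv acQ fi mq qM df dQ.
have Q1 : Q 1 = 0 by rewrite /Q subrr fracp_at0// ltr_wpDl.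
have Qm : Q (-1) = 0.
  rewrite /Q (_ : 1 - -1 = 2); last by ring.
  by rewrite natr1 fracp_legq_at2.
rewrite Q1 Qm !mulr0 subrr sub0r => E.
rewrite -[in RHS]natr1 -[RHS]opprK -E.
suff -> : \int[leb]_(x in `[-1, 1]) (v x * q x) =
    - \int[leb]_(x in `[-1, 1]) (v x * fracp j%:R (legq n) (1 - x)) by rewrite opprK.
have iv : leb.-integrable `[-1, 1] (EFin \o (fun x => v x * fracp j%:R (legq n) (1 - x))).
  have [L _ vL] := abs_cont_bounded (ltW ab) acv.
  apply: (@bounded_integrable _ _ _ _ (L * M)).
    apply: measurable_funM; [exact: abs_cont_measurable (ltW ab) acv|exact: fracp_measurable].
  move=> x xab; rewrite normrM ler_pM ?vL//; have := qM _ xab; by rewrite normrN.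
rewrite -[RHS]mulN1r -RintegralZl//; apply: eq_Rintegral => x _.
by rewrite /q mulrN mulN1r.
Qed.

(** Each u^(j) with j < k has an absolutely continuous version and can be integrated by parts once
    more. For u^(k) only the integrable density [f] is left, and it represents u^(k) from here
    on. *)
Lemma legendre_parts k (u : R -> R) : (0 < k)%N -> AC_derivatives (-1) 1 k u ->
  exists f : R -> R, [/\ leb.-integrable setT (EFin \o f),
    {ae leb, forall x, x \in `]-1, 1[ -> derive1n k u x = f x} &
    forall n, (k <= n)%N -> \int[leb]_(x in `[-1, 1]) (u x * (legendre n).[x]) =
     \int[leb]_(x in `[-1, 1]) (f x * fracp k%:R (legq n) (1 - x))].
Proof.
move=> k0 [acu acd].
have H j : (j < k)%N -> exists v, [/\ abs_cont (-1) 1 v, {in `]-1, 1[, derive1n j u =1 v} &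
  (forall n, (j <= n)%N -> \int[leb]_(x in `[-1, 1]) (u x * (legendre n).[x]) =
     \int[leb]_(x in `[-1, 1]) (v x * fracp j%:R (legq n) (1 - x)))].
  elim: j => [_|j IH jk].
    exists u; split => // n _; apply: eq_Rintegral => x /set_mem/=; rewrite in_itv/= => /andP[_ x1].
    by rewrite fracp0 ?subr_ge0// legendreE.
  have [v [acv vE vn]] := IH (ltnW jk); have [_ [g acg gE]] := acd _ jk.
  have [f [fi fE fn]] := legendre_parts_step acv vE vn.
  exists g; split => // n jn; rewrite (fn n jn); apply: ae_eq_RintegralT; apply: ae_itv_closed.
  by apply: (ae_imply fE) => x h xab; rewrite -h// gE.
case: k k0 acd H => // k _ acd H; have [v [acv vE vn]] := H k (ltnSn k).
exact: legendre_parts_step acv vE vn.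
Qed.

End absolutely_continuous.

(** * Bounds on the Legendre coefficients *)

Section fractional_moments.
Context {R : realType}.
Notation leb := (@lebesgue_measure R).
Local Notation RT := (measurableTypeR R).
Implicit Types (f g : R -> R) (a b c x y theta rho mu : R).

Lemma eq_integrableR (D : set RT) f g : (forall x, f x = g x) ->
  leb.-integrable D (EFin \o f) -> leb.-integrable D (EFin \o g).
Proof. by move=> fg; have -> : g = f by apply/funext => x; rewrite fg. Qed.

Definition beta_const rho b : R := gam rho * gam b / gam (rho + b).

Lemma measurable_beta_kernel (y c rho b : R) (D : set RT) :
  measurable_fun D (fun x : R => (x - y) `^ (rho - 1) * (c - x) `^ (b - 1)).
Proof.
apply: measurable_funM.
  by apply: (measurableT_comp (measurable_powR _)); exact: measurable_funB.
by apply: (measurableT_comp (measurable_powR _)); exact: measurable_funB.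
Qed.

Lemma integral_beta_shift y c rho b : y < c -> 0 < rho -> 0 < b ->
  (\int[leb]_(x in `[y, c]) ((x - y) `^ (rho - 1) * (c - x) `^ (b - 1))%:E =
   ((c - y) `^ (rho + b - 1) * beta_const rho b)%:E)%E.
Proof.
move=> yc rho0 b0.
have mk (D : set RT) : measurable_fun D
    (fun x : R => ((x - y) `^ (rho - 1) * (c - x) `^ (b - 1))%:E).
  by apply/measurable_EFinP; exact: measurable_beta_kernel.
pose F (x : R) := ((x - y) `^ (rho - 1) * (c - x) `^ (b - 1))%:E.
rewrite -(@integral_itv_obnd_cbnd R y (BRight c) F (mk _)).
rewrite -(@integral_itv_bndo_bndc R (BRight y) c F (mk _)) /F.
rewrite (@ge0_integral_affine R 1 y (`]y, c[%classic : set RT))//;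
  [|exact: mk|by move=> x _; rewrite lee_fin mulr_ge0 ?powR_ge0].
have cy0 : 0 < c - y by rewrite subr_gt0.
have IB := integral_beta rho0 b0 cy0; rewrite mul1e /beta_const -IB.
have -> : [set x : R | `]y, c[%classic (1 * x + y)] = `]0, (c - y)[%classic.
  by apply/seteqP; split => x /=; rewrite !in_itv/= mul1r => /andP[h1 h2]; lra.
apply: eq_integral => x _; rewrite mul1r addrK; congr (_ * _ `^ _)%:E; ring.
Qed.

Lemma beta_kernel_integrable y c rho b : y < c -> 0 < rho -> 0 < b ->
  leb.-integrable `[y, c] (EFin \o (fun x : R => (x - y) `^ (rho - 1) * (c - x) `^ (b - 1))).
Proof.
move=> yc rho0 b0; apply/integrableP; split.
  by apply/measurable_EFinP; exact: measurable_beta_kernel.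
rewrite (_ : (\int[_]_(x in _) _)%E = ((c - y) `^ (rho + b - 1) * beta_const rho b)%:E) ?ltry//.
rewrite -integral_beta_shift//; apply: eq_integral => x _ /=.
by rewrite ger0_norm// mulr_ge0 ?powR_ge0.
Qed.

Lemma ae_neq (c : R) (P : set RT) : (forall x, x != c -> P x) -> (almost_everywhere leb) P.
Proof.
move=> H; exists [set c]; split.
- exact: measurable_set1.
- exact: lebesgue_measure_set1.
by move=> x /= nP; apply: contrapT => xc; apply: nP; apply: H; apply/eqP.
Qed.

(** Dirichlet's exchange: for fixed y the inner integral in x is a Beta integral. As 1 <= b, the
    exponent rho + b - 1 is positive and the power of c - y is bounded, so its product with f is
    integrable. *)
Lemma fubini_beta theta c rho b f : theta < c -> 0 < rho -> 1 <= b ->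
  leb.-integrable setT (EFin \o f) ->
  [/\ leb.-integrable `[theta, c] (fun x => (\int[leb]_(y in `[theta, x])
        (f y * ((x - y) `^ (rho - 1) * (c - x) `^ (b - 1))))%:E),
    {ae leb, forall x, `[theta, c]%classic x -> leb.-integrable `[theta, x]
        (fun y => (f y * ((x - y) `^ (rho - 1) * (c - x) `^ (b - 1)))%:E)} &
    \int[leb]_(x in `[theta, c]) \int[leb]_(y in `[theta, x])
        (f y * ((x - y) `^ (rho - 1) * (c - x) `^ (b - 1))) =
    beta_const rho b * \int[leb]_(y in `[theta, c]) (f y * (c - y) `^ (rho + b - 1))].
Proof.
move=> tc rho0 b1 fi; have b0 : 0 < b by lra.
have mf : measurable_fun setT f by apply/measurable_EFinP; exact: measurable_int fi.
pose k (x y : R) := (x - y) `^ (rho - 1) * (c - x) `^ (b - 1).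
pose A : set (RT * RT) := [set z : R * R | (theta <= z.1) && (z.1 <= z.2) && (z.2 <= c)].
have k0 x y : 0 <= k x y by rewrite mulr_ge0 ?powR_ge0.
have B0 : 0 <= beta_const rho b.
  by rewrite divr_ge0 ?mulr_ge0// ltW// Gamma_gt0// addr_gt0.
have m1 : measurable_fun setT (fst : RT * RT -> RT) by exact: measurable_fst.
have m2 : measurable_fun setT (snd : RT * RT -> RT) by exact: measurable_snd.
have mA : measurable A.
  rewrite (_ : A = [set z : RT * RT | theta <= z.1] `&` [set z : RT * RT | z.1 <= z.2]
     `&` [set z : RT * RT | z.2 <= c]); last first.
    apply/seteqP; split => z /=; first by move=> /andP[/andP[]].
    by move=> [[h1 h2] h3]; rewrite /A /= h1 h2 h3.
  apply: measurableI; first apply: measurableI.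
  - by apply: (measurable_le (f := cst theta)).
  - exact: measurable_le.
  - by apply: (measurable_le (g := cst c)).
have mk : measurable_fun setT (fun z : RT * RT => k z.2 z.1).
  apply: measurable_funM; apply: (measurableT_comp (measurable_powR _)); exact: measurable_funB.
have mh : measurable_fun setT (fun z : RT * RT => f z.1 * k z.2 z.1).
  by apply: measurable_funM => //; exact: measurableT_comp.
have fT : leb.-integrable `[theta, c] (EFin \o (fun y => (c - y) `^ (rho + b - 1) * beta_const rho b * f y)).
  apply: (@integrable_mul_bounded _ _ _ _ ((c - theta) `^ (rho + b - 1) * beta_const rho b)) => //.
  - apply: measurable_funM => //; apply: (measurableT_comp (measurable_powR _)).
    exact: measurable_funB.
  - move=> y /=; rewrite in_itv/= => /andP[ty yc].
    rewrite (ger0_norm (mulr_ge0 (powR_ge0 _ _) B0)) ler_wpM2r// ge0_ler_powR ?nnegrE//; lra.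
  - exact: (@integrableS _ _ _ _ setT).
have iF2 : leb.-integrable `[theta, c] (EFin \o (fun y => f y * (c - y) `^ (rho + b - 1))).
  apply: (@eq_integrableR _ (fun y => (c - y) `^ (rho + b - 1) * f y)).
    by move=> y; rewrite mulrC.
  apply: (@integrable_mul_bounded _ _ _ _ ((c - theta) `^ (rho + b - 1))) => //.
  - by apply: (measurableT_comp (measurable_powR _)); exact: measurable_funB.
  - move=> y /=; rewrite in_itv/= => /andP[ty yc].
    by rewrite ger0_norm ?powR_ge0// ge0_ler_powR ?nnegrE//; lra.
  - exact: (@integrableS _ _ _ _ setT).
have fin : (\int[leb]_(y in `[theta, c]) \int[leb]_(x in `[y, c]) `|f y * k x y|%:E < +oo)%E.
  rewrite (@ae_eq_integralT _ _ _ leb _ _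
    (fun y => `|(c - y) `^ (rho + b - 1) * beta_const rho b * f y|%:E)).
    by have /integrableP[_] := fT.
  (* At y = c the segment [y, c] is a single point and the Beta formula does not apply. *)
  apply: (@ae_neq c) => y /= yc'; rewrite in_itv/= => /andP[ty yc].
  have ycl : y < c by rewrite lt_neqAle yc'.
  transitivity (\int[leb]_(x in `[y, c]) (`|f y|%:E * (k x y)%:E))%E.
    by apply: eq_integral => x _; rewrite normrM (ger0_norm (k0 _ _)) EFinM.
  rewrite ge0_integralZl//.
  - rewrite integral_beta_shift// -EFinM normrM mulrC (ger0_norm (mulr_ge0 _ _)) ?powR_ge0//.
  - by apply/measurable_EFinP; exact: measurable_beta_kernel.
  - by move=> x _; rewrite lee_fin.
pose T : set RT := `[theta, c]%classic; pose Ex (y : RT) : set RT := `[y, c]%classic.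
pose Ey (x : RT) : set RT := `[theta, x]%classic.
have mT : measurable T by exact: measurable_itv.
have mEy x : measurable (Ey x) by exact: measurable_itv.
have AD y x : A (y, x) <-> T y /\ Ex y x.
  rewrite /A /T /Ex /= !in_itv/=; split=> [/andP[/andP[h1 h2] h3]|[/andP[h1 h2] /andP[h3 h4]]].
    by rewrite h1 h2 h3 (le_trans h2 h3).
  by rewrite h1 h3 h4.
have AE y x : A (y, x) <-> T x /\ Ey x y.
  rewrite /A /T /Ey /= !in_itv/=; split=> [/andP[/andP[h1 h2] h3]|[/andP[h1 h2] /andP[h3 h4]]].
    by rewrite h1 h2 h3 (le_trans h1 h2).
  by rewrite h3 h4 h2.
have [I1 I2 I3] := @fubini_region R (fun y x => f y * k x y) A T T Ex Ey mA mT mT mh mEy AD AE fin.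
split; [exact: I1|exact: I2|]; apply: (etrans (esym I3)).
have E2 : \int[leb]_(y in T) (beta_const rho b * (f y * (c - y) `^ (rho + b - 1))) =
    beta_const rho b * \int[leb]_(y in T) (f y * (c - y) `^ (rho + b - 1)).
  exact: (RintegralZl _ mT iF2).
apply: etrans E2; apply: ae_eq_RintegralT; apply: (@ae_neq c) => y /= yc'.
rewrite /T /= in_itv/= => /andP[ty yc]; have ycl : y < c by rewrite lt_neqAle yc'.
have E3 : \int[leb]_(x in Ex y) (f y * k x y) = f y * \int[leb]_(x in Ex y) k x y.
  have mEx : measurable (Ex y) by exact: measurable_itv.
  have ki : leb.-integrable (Ex y) (EFin \o (fun x => k x y)) by exact: beta_kernel_integrable.
  exact: (RintegralZl (f y) mEx ki).
rewrite E3 /Rintegral (integral_beta_shift ycl rho0 b0) /=.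
by rewrite mulrA mulrC.
Qed.

(* frac_int_left, for the locked gam *)
Definition rl_int rho a f x : R :=
  (gam rho)^-1 * \int[leb]_(y in `[a, x]) (f y / (x - y) `^ (1 - rho)).

Lemma rl_intE rho a f x : rl_int rho a f x =
  (gam rho)^-1 * \int[leb]_(y in `[a, x]) (f y * (x - y) `^ (rho - 1)).
Proof.
by congr (_ * _); apply: eq_Rintegral => y _; rewrite -powRN opprB.
Qed.

Lemma rl_int_moment theta c rho b f : theta < c -> 0 < rho -> 1 <= b ->
  leb.-integrable setT (EFin \o f) ->
  \int[leb]_(x in `[theta, c]) (rl_int rho theta f x * (c - x) `^ (b - 1)) =
  gam b / gam (rho + b) * \int[leb]_(y in `[theta, c]) (f y * (c - y) `^ (rho + b - 1)).
Proof.
move=> tc rho0 b1 fi; have g0 := Gamma_gt0 rho0.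
have [I1 _ I3] := fubini_beta tc rho0 b1 fi.
(* With b = 1 the weight is constantly 1. This gives, for almost every x, the integrability of the
   kernel of [rl_int] alone, so that (c - x)^(b-1) can be moved through the inner integral. *)
have [_ J2 _] := fubini_beta tc rho0 (lexx 1) fi.
transitivity ((gam rho)^-1 * \int[leb]_(x in `[theta, c]) \int[leb]_(y in `[theta, x])
        (f y * ((x - y) `^ (rho - 1) * (c - x) `^ (b - 1)))); last first.
  rewrite I3 mulrA /beta_const; congr (_ * _).
  by move: (gam rho) (gam b) (gam _) (lt0r_neq0 g0) (lt0r_neq0 (Gamma_gt0 (s := rho + b) ltac:(lra))) => x y z x0 z0; field; rewrite x0 z0.
rewrite -RintegralZl//; apply: ae_eq_RintegralT.
apply: (ae_imply J2) => x H xtc; have {}H := H xtc.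
rewrite rl_intE -mulrA; congr (_ * _).
rewrite -RintegralZr//; last first.
  by apply: eq_integrableR H => y; rewrite subrr powRr0 mulr1.
by apply: eq_Rintegral => y _; rewrite mulrA.
Qed.

Lemma Rintegral_sum (D : set RT) (F : nat -> R -> R) n : measurable D ->
  (forall i, leb.-integrable D (EFin \o F i)) ->
  leb.-integrable D (EFin \o (fun x => \sum_(i < n) F i x)) /\
  \int[leb]_(x in D) (\sum_(i < n) F i x) = \sum_(i < n) \int[leb]_(x in D) F i x.
Proof.
move=> mD Fi; elim: n => [|n [I1 I2]].
  split; last by rewrite big_ord0 /Rintegral integral0_eq// => x _; rewrite big_ord0.
  apply: (@eq_integrableR _ (cst 0)); first by move=> x; rewrite big_ord0.
  exact: integrable0.
have E (x : R) : \sum_(i < n.+1) F i x = \sum_(i < n) F i x + F n x by rewrite big_ord_recr.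
split.
  apply: (@eq_integrableR _ (fun x => \sum_(i < n) F i x + F n x)); first by move=> x; rewrite E.
  exact: (integrableD mD I1 (Fi n)).
rewrite big_ord_recr/= -I2 -RintegralD//; apply: eq_Rintegral => x _; exact: E.
Qed.

(** Fractional integration by parts: left and right integrals are adjoint, and their orders add. For
    a polynomial p it reduces, power by power, to [rl_int_moment]. *)
Lemma rl_int_fracp theta rho mu f (p : {poly R}) (v : R -> R) : theta < 1 -> 0 < rho -> 0 <= mu ->
  leb.-integrable setT (EFin \o f) -> bounded_variation theta 1 v ->
  {ae leb, forall x, `[theta, 1]%classic x -> v x = rl_int rho theta f x} ->
  \int[leb]_(x in `[theta, 1]) (v x * fracp mu p (1 - x)) =
  \int[leb]_(x in `[theta, 1]) (f x * fracp (mu + rho) p (1 - x)).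
Proof.
move=> t1 rho0 mu0 fi bv vE.
have pM s x : 0 <= s -> theta <= x <= 1 -> `|(1 - x) `^ s| <= (1 - theta) `^ s.
  by move=> s0 xt; rewrite ger0_norm ?powR_ge0// ge0_ler_powR ?nnegrE//; lra.
have mp s (D : set RT) : measurable_fun D (fun x : R => (1 - x) `^ s).
  by apply: (measurableT_comp (measurable_powR _)); exact: measurable_funB.
have iv s c : 0 <= s -> leb.-integrable `[theta, 1] (EFin \o (fun x => c * (v x * (1 - x) `^ s))).
  move=> s0; apply: (@bounded_integrable _ _ _ _ (`|c| * ((`|v theta| + variation_fun theta v 1) * (1 - theta) `^ s))).
    by apply: measurable_funM => //; apply: measurable_funM => //; exact: BV_measurable (ltW t1) bv.
  move=> x xt; rewrite !normrM ler_wpM2l// ler_pM ?pM//; exact: BV_bounded.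
have if_ s c : 0 <= s -> leb.-integrable `[theta, 1] (EFin \o (fun x => c * (f x * (1 - x) `^ s))).
  move=> s0; apply: (@eq_integrableR _ (fun x => (c * (1 - x) `^ s) * f x)).
    by move=> x; rewrite [f x * _]mulrC mulrA.
  apply: (@integrable_mul_bounded _ _ _ _ (`|c| * (1 - theta) `^ s)) => //.
  - exact: measurable_funM.
  - by move=> x /=; rewrite in_itv/= => xt; rewrite normrM ler_wpM2l ?pM.
  - exact: (@integrableS _ _ _ _ setT).
pose c i : R := p`_i * i`!%:R / gam (i%:R + 1 + mu).
pose d i : R := p`_i * i`!%:R / gam (i%:R + 1 + (mu + rho)).
have i0 i s : 0 <= s -> 0 <= i%:R + s :> R by move=> s0; rewrite addr_ge0.
transitivity (\int[leb]_(x in `[theta, 1]) (\sum_(i < size p) c i * (v x * (1 - x) `^ (i%:R + mu)))).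
  by apply: eq_Rintegral => x _; rewrite /fracp mulr_sumr; apply: eq_bigr => i _; rewrite mulrCA.
transitivity (\int[leb]_(x in `[theta, 1]) (\sum_(i < size p) d i * (f x * (1 - x) `^ (i%:R + (mu + rho))))); last first.
  by apply: eq_Rintegral => x _; rewrite /fracp mulr_sumr; apply: eq_bigr => i _; rewrite mulrCA.
have [_ ->] := @Rintegral_sum `[theta, 1]%classic (fun i x => c i * (v x * (1 - x) `^ (i%:R + mu)))
  (size p) (measurable_itv _) (fun i => iv _ _ (i0 i _ mu0)).
have mr0 : 0 <= mu + rho by lra.
have [_ ->] := @Rintegral_sum `[theta, 1]%classic (fun i x => d i * (f x * (1 - x) `^ (i%:R + (mu + rho))))
  (size p) (measurable_itv _) (fun i => if_ _ _ (i0 i _ mr0)).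
apply: eq_bigr => i _.
have b1 : 1 <= i%:R + 1 + mu by have : 0 <= i%:R :> R by []; lra.
have Zl (e : R) (F : R -> R) : leb.-integrable `[theta, 1] (EFin \o F) ->
    \int[leb]_(x in `[theta, 1]) (e * F x) = e * \int[leb]_(x in `[theta, 1]) F x.
  by move=> iF; exact: RintegralZl.
rewrite (Zl (c i) (fun x => v x * (1 - x) `^ (i%:R + mu))); last first.
  by have := iv _ 1 (i0 i _ mu0); apply: eq_integrableR => x; rewrite mul1r.
rewrite (Zl (d i) (fun x => f x * (1 - x) `^ (i%:R + (mu + rho)))); last first.
  by have := if_ _ 1 (i0 i _ mr0); apply: eq_integrableR => x; rewrite mul1r.
have -> : \int[leb]_(x in `[theta, 1]) (v x * (1 - x) `^ (i%:R + mu)) =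
    \int[leb]_(x in `[theta, 1]) (rl_int rho theta f x * (1 - x) `^ (i%:R + 1 + mu - 1)).
  have -> : i%:R + 1 + mu - 1 = i%:R + mu :> R by ring.
  by apply: ae_eq_RintegralT; apply: (ae_imply vE) => x vx xt; rewrite vx.
apply: etrans (congr1 (GRing.mul (c i)) (rl_int_moment t1 rho0 b1 fi)) _.
apply: etrans (mulrA _ _ _) _; congr (_ * _).
  rewrite /c /d; have -> : rho + (i%:R + 1 + mu) = i%:R + 1 + (mu + rho) by ring.
  have h1 := lt0r_neq0 (Gamma_gt0 (s := i%:R + 1 + mu) ltac:(lra)).
  have h2 := lt0r_neq0 (Gamma_gt0 (s := i%:R + 1 + (mu + rho)) ltac:(lra)).
  by move: (p`_i) (_ %:R : R) (gam _) (gam _) h1 h2 => A B C D h1 h2; field; rewrite h1 h2.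
by apply: eq_Rintegral => x _; congr (_ * _ `^ _); ring.
Qed.

End fractional_moments.

(** * The two sides of theta *)

Section coefficient_bounds.
Context {R : realType}.
Notation leb := (@lebesgue_measure R).
Local Notation RT := (measurableTypeR R).
Implicit Types (f g u v : R -> R) (a b x theta rho mu l : R).

Lemma Rintegral_oppr a b (F : R -> R) : measurable_fun (`[a, b] : set RT) F ->
  \int[leb]_(x in `[a, b]) F x = \int[leb]_(x in `[- b, - a]) F (- x).
Proof.
move=> mF.
have E (f : R -> \bar R) : measurable_fun (`[a, b] : set RT) f -> (forall x, 0 <= f x)%E ->
    (\int[leb]_(x in `[a, b]) f x = \int[leb]_(x in `[(- b)%R, (- a)%R]) f (- x)%R)%E.
  move=> mf f0; rewrite (@ge0_integral_oppr R (`[a, b]%classic : set RT) f)//.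
  congr (integral _ _ _); apply/seteqP; split => x /=; rewrite !in_itv/= => /andP[h1 h2]; lra.
have mE : measurable_fun (`[a, b] : set RT) (EFin \o F) by exact/measurable_EFinP.
rewrite /Rintegral; congr fine; rewrite integralE [RHS]integralE; congr (_ - _)%E.
  rewrite (E (EFin \o F)^\+%E)//; last exact: measurable_funepos.
  by apply: eq_integral => x _; rewrite !funeposE.
rewrite (E (EFin \o F)^\-%E)//; last exact: measurable_funeneg.
by apply: eq_integral => x _; rewrite !funenegE.
Qed.

(** The value at a is kept apart from its bound [legq_amp]: for an integer order and a = -1 it
    vanishes, and the one-sided limit l disappears with it. *)
Lemma BV_fracp_bound a mu n v l : -1 <= a -> a < 1 -> 0 < mu -> mu < n%:R ->
  bounded_variation a 1 v -> v x @[x --> a^'+] --> l ->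
  `|\int[leb]_(x in `[a, 1]) (v x * fracp mu (legq n) (1 - x))| <=
  `|l| * `|fracp (mu + 1) (legq n) (1 - a)| + variation_fun a v 1 * legq_amp n (mu + 1).
Proof.
move=> a1 a2 mu0 mun bv vl; have mu0' := ltW mu0.
pose h x := - fracp mu (legq n) (1 - x); pose H x := fracp (mu + 1) (legq n) (1 - x).
have [M HM] := fracp_bounded (legq n) mu0'.
have mh : measurable_fun (`[a, 1] : set RT) h.
  apply: (@eq_measurable_fun _ _ _ _ _ (fun x : R => -1 * fracp mu (legq n) (1 - x))).
    by move=> x _; rewrite mulN1r.
  by apply: measurable_funM => //; exact: fracp_measurable.
have hM x : a <= x <= 1 -> `|h x| <= M by move=> x1; rewrite normrN HM//; lra.
have acH : abs_cont a 1 H by exact: fracp_abs_cont.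
have dH : ae_derivative a 1 H h.
  exists set0; split => // x/=; apply: contra_notP => _; rewrite in_itv/= => /andP[_ x1].
  exact: fracp1B_is_derive.
have HE x y : a <= x -> x <= y -> y <= 1 -> H y - H x = \int[leb]_(t in `]x, y]) h t.
  exact: abs_cont_integral dH.
have H1 : H 1 = 0 by rewrite /H subrr fracp_at0//; lra.
have HK x : a <= x <= 1 -> `|H x| <= legq_amp n (mu + 1).
  by move=> x1; apply: fracp_legq_bound; lra.
have := BV_integral_bound a2 bv mh hM HE H1 HK vl.
have iv : leb.-integrable `[a, 1] (EFin \o (fun x => v x * fracp mu (legq n) (1 - x))).
  apply: (@bounded_integrable _ _ _ _ ((`|v a| + variation_fun a v 1) * M)).
    by apply: measurable_funM; [exact: BV_measurable (ltW a2) bv|exact: fracp_measurable].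
  move=> x x1; rewrite normrM ler_pM ?(BV_bounded bv)//.
  by have := hM _ x1; rewrite normrN.
have -> : \int[leb]_(x in `[a, 1]) (v x * h x) =
    -1 * \int[leb]_(x in `[a, 1]) (v x * fracp mu (legq n) (1 - x)).
  rewrite -RintegralZl//.
  by apply: eq_Rintegral => x _; rewrite /h mulrN mulN1r.
by rewrite mulN1r normrN.
Qed.

Lemma rl_int_coeff_bound theta rho mu f n v l : -1 <= theta -> theta < 1 -> 0 < rho ->
  0 < mu -> mu < n%:R -> leb.-integrable setT (EFin \o f) ->
  bounded_variation theta 1 v ->
  {ae leb, forall x, `[theta, 1]%classic x -> v x = rl_int rho theta f x} ->
  v x @[x --> theta^'+] --> l ->
  `|\int[leb]_(x in `[theta, 1]) (f x * fracp (mu + rho) (legq n) (1 - x))| <=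
  (`|l| + variation_fun theta v 1) * legq_amp n (mu + 1).
Proof.
move=> t1 t2 rho0 mu0 mun fi bv vE vl; have mu0' := ltW mu0.
rewrite -(rl_int_fracp (legq n) t2 rho0 mu0' fi bv vE).
apply: (le_trans (BV_fracp_bound t1 t2 mu0 mun bv vl)).
rewrite mulrDl lerD2r ler_wpM2l// fracp_legq_bound//; lra.
Qed.

Lemma BV_oppr a b v : a <= b -> bounded_variation a b v ->
  bounded_variation (- b) (- a) (v \o -%R) /\
  variation_fun (- b) (v \o -%R) (- a) = variation_fun a v b.
Proof.
move=> ab bv; have E := total_variation_opp a b v.
split; last by rewrite /variation_fun E.
apply/bounded_variationP; first by rewrite lerN2.
by rewrite -E; apply/bounded_variationP.
Qed.

(* Reflected by x |-> - x, the integral over [-1, theta] becomes one over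
   [- theta, 1]. *)
Lemma right_coeff_bound theta rho k f n v l : -1 < theta -> theta <= 1 -> 0 < rho -> rho < k%:R ->
  k%:R - rho < n%:R -> (k <= n)%N -> leb.-integrable setT (EFin \o f) ->
  bounded_variation (-1) theta v ->
  {ae leb, forall x, `[-1, theta]%classic x ->
     v x = (-1) ^+ k * ((gam rho)^-1 * \int[leb]_(y in `[x, theta]) (f y / (y - x) `^ (1 - rho)))} ->
  v x @[x --> theta^'-] --> l ->
  `|\int[leb]_(x in `[-1, theta]) (f x * fracp k%:R (legq n) (1 - x))| <=
  (`|l| + variation_fun (-1) v theta) * legq_amp n (k%:R - rho + 1).
Proof.
move=> t1 t2 rho0 rhok mun kn fi bv vE vl; have t1' := ltW t1.
pose f' x := f (- x); pose v' x := (-1) ^+ k * v (- x).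
have mf : measurable_fun setT f by apply/measurable_EFinP; exact: measurable_int fi.
have mN : measurable_fun setT (-%R : RT -> RT) by [].
have f'i : leb.-integrable setT (EFin \o f').
  apply/integrableP; split; first by apply/measurable_EFinP; exact: measurableT_comp.
  have /integrableP[_] := fi; rewrite (@ge0_integral_oppr R setT)//.
  by apply: measurableT_comp => //; apply/measurable_EFinP.
have [bv1 tv1] := BV_oppr t1' bv; rewrite opprK in bv1 tv1.
have sgn2 : (-1) ^+ k * (-1) ^+ k = 1 :> R by rewrite -exprMn mulrNN mulr1 expr1n.
have vv' x y : `|v' y - v' x| = `|(v \o -%R) y - (v \o -%R) x|.
  by rewrite /v' -mulrBr normrM normrX normrN1 expr1n mul1r.
have tv' : total_variation (- theta) 1 v' = total_variation (- theta) 1 (v \o -%R).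
  rewrite /total_variation /variations; congr (ereal_sup [set x%:E | x in _]).
  have VE s : variation (- theta) 1 v' s = variation (- theta) 1 (v \o -%R) s.
    by apply: eq_bigr => i _ /=; exact: vv'.
  by apply/seteqP; split => _ [s sp <-]; exists s.
have bv' : bounded_variation (- theta) 1 v'.
  apply/bounded_variationP; first by rewrite -(opprK 1) lerN2.
  by rewrite tv'; apply/bounded_variationP => //; rewrite -(opprK 1) lerN2.
have vE' : {ae leb, forall x, `[- theta, 1]%classic x -> v' x = rl_int rho (- theta) f' x}.
  have H : {ae leb, forall x, `[-1, theta]%classic (- x) ->
     v (- x) = (-1) ^+ k * ((gam rho)^-1 * \int[leb]_(y in `[- x, theta]) (f y / (y + x) `^ (1 - rho)))}.
    have [N [mN' N0 sN]] := vE; exists [set x | N (- x)]; split.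
    - by rewrite -[X in measurable X]setTI; exact: mN.
    - by rewrite -N0; exact: (lebesgue_measureN mN').
    move=> x /= nx; apply: sN => /= h; apply: nx => /h ->.
    by under eq_Rintegral do rewrite opprK.
  apply: (ae_imply H) => x hx; rewrite /= in_itv/= => /andP[x1 x2].
  rewrite /v' hx; last by rewrite /= in_itv/= lerN2 x2 lerNl x1.
  rewrite mulrA sgn2 mul1r.
  suff -> : \int[leb]_(y in `[- x, theta]) (f y / (y + x) `^ (1 - rho)) =
    \int[leb]_(y in `[- theta, x]) (f' y / (x - y) `^ (1 - rho)) by [].
  have pE (r y : R) : y / r `^ (1 - rho) = y * r `^ (rho - 1) by rewrite -powRN opprB.
  under eq_Rintegral do rewrite pE; under [RHS]eq_Rintegral do rewrite pE.
  rewrite (@Rintegral_oppr (- x) theta).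
    by rewrite opprK; apply: eq_Rintegral => y _; rewrite /f' addrC.
  apply: measurable_funM; first exact: measurable_funTS.
  by apply: (measurableT_comp (measurable_powR _)); exact: measurable_funD.
have vl' : v' x @[x --> (- theta)^'+] --> (-1) ^+ k * l.
  by apply: cvgMr; move/cvg_at_leftNP : vl.
have t1n : -1 <= - theta by rewrite lerN2.
have t2n : - theta < 1 by rewrite ltrNl.
have mu0 : 0 < k%:R - rho by rewrite subr_gt0.
have B := rl_int_coeff_bound t1n t2n rho0 mu0 mun f'i bv' vE' vl'.
rewrite subrK in B.
have -> : variation_fun (-1) v theta = variation_fun (- theta) v' 1.
  by rewrite -tv1 /variation_fun tv'.
have -> : `|l| = `|(-1) ^+ k * l| by rewrite normrM normrX normrN1 expr1n mul1r.
apply: le_trans B; rewrite (@Rintegral_oppr (-1) theta); last first.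
  by apply: measurable_funM; [exact: measurable_funTS|exact: fracp_measurable].
rewrite opprK.
(* Reflection replaces 1 - x by 1 + x = 2 - (1 - x). Since the order k is an integer at most n,
   [fracp_legq_parity] restores 1 - x up to a sign; the descent to the fractional order mu comes
   only afterwards. *)
have -> : \int[leb]_(x in `[- theta, 1]) (f (- x) * fracp k%:R (legq n) (1 - - x)) =
    (-1) ^+ (n - k) * \int[leb]_(x in `[- theta, 1]) (f' x * fracp k%:R (legq n) (1 - x)).
  have [M HM] := fracp_bounded (legq n) (ler0n R k).
  have iF : leb.-integrable `[- theta, 1] (EFin \o (fun x => f' x * fracp k%:R (legq n) (1 - x))).
    apply: (@eq_integrableR _ _ (fun x => fracp k%:R (legq n) (1 - x) * f' x)).
      by move=> x; rewrite mulrC.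
    apply: (@integrable_mul_bounded _ _ _ _ M) => //.
    - exact: fracp_measurable.
    - by move=> x /=; rewrite in_itv/= => /andP[x1 x2]; rewrite HM//; lra.
    - exact: (@integrableS _ _ _ _ setT).
  have mI : measurable (`[- theta, 1]%classic : set RT) by exact: measurable_itv.
  apply: etrans (RintegralZl _ mI iF).
  apply: eq_Rintegral => x /set_mem/=; rewrite in_itv/= => /andP[x1 x2].
  rewrite (_ : 1 - - x = 2 - (1 - x)); last by ring.
  by rewrite fracp_legq_parity//; [rewrite /f'; ring|lra].
by rewrite normrM normrX normrN1 expr1n mul1r.
Qed.

End coefficient_bounds.

(** * Convergence of the Legendre series *)

Section legendre_expansion.
Context {R : realType}.
Notation leb := (@lebesgue_measure R).
Local Notation RT := (measurableTypeR R).
Implicit Types (u w K : R -> R) (p q : {poly R}) (x e eta : R) (n m M N : nat).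
Local Notation D := (`]-1, 1[%classic : set RT).

Lemma bernoulli_ge (z : R) j : 0 <= z -> j%:R * z <= (1 + z) ^+ j.
Proof.
move=> z0; elim: j => [|j IH]; first by rewrite mul0r expr0.
have h : 1 <= (1 + z) ^+ j by apply: exprn_ege1; rewrite lerDl.
rewrite exprS mulrDl mul1r -[j.+1%:R]natr1 mulrDl mul1r lerD// ler_peMr//.
Qed.

(* Powers of a quadratic polynomial concentrate at x0, where w M is larger than
   2 eta, while all the w m with m >= M stay above eta near x0. *)
Lemma concentration (w : nat -> R -> R) (W : R) M (x0 eta : R) : 0 < eta ->
  (forall m, leb.-integrable D (EFin \o w m)) ->
  (forall m p, (size p <= m.+1)%N -> \int[leb]_(x in D) (w m x * p.[1 - x]) = 0) ->
  (forall m, (M <= m)%N -> \int[leb]_(x in D) `|w m x| <= W) ->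
  (exists2 d, 0 < d & forall x, `|x - x0| < d -> -1 < x < 1 /\
     forall m, (M <= m)%N -> eta <= w m x) -> False.
Proof.
move=> eta0 wi worth wW [d d0 near].
have x01 : -1 < x0 < 1 by have [] := near x0; rewrite ?subrr ?normr0.
(* Chosen so that Q(1 - x) = 1 + (d^2 - (x - x0)^2) / 4. This is at least r = 1 + 3 d^2 / 16 within
   d / 2 of x0, at least 1 within d, and in [0, 1] beyond, because |x - x0| <= 2. *)
pose Q : {poly R} := (1 + d ^+ 2 / 4)%:P - 4^-1%:P * ('X - (1 - x0)%:P) ^+ 2.
have QE x : Q.[1 - x] = 1 + (d ^+ 2 - (x - x0) ^+ 2) / 4.
  by rewrite /Q !(hornerD, hornerN, hornerM, hornerC, horner_exp, hornerX); field.
have sQ j : (size (Q ^+ j) <= (2 * j).+1)%N.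
  have s3 : (size Q <= 3)%N.
    rewrite (leq_trans (size_polyD _ _))// geq_max (leq_trans (size_polyC_leq1 _))//=.
    rewrite size_polyN mul_polyC (leq_trans (size_scale_leq _ _))//.
    by rewrite (leq_trans (size_poly_exp_leq _ _))// size_XsubC.
  by rewrite (leq_trans (size_poly_exp_leq _ _))// ltnS leq_mul2r -[2%N]/(3.-1) -!subn1 leq_sub2r// orbT.
pose r := 1 + 3 / 16 * d ^+ 2; have r0 : 0 <= 3 / 16 * d ^+ 2 by rewrite mulr_ge0// sqr_ge0.
have d20 : 0 < 3 / 16 * d ^+ 2 by rewrite mulr_gt0// exprn_gt0.
pose B : set RT := `](x0 - d / 2), (x0 + d / 2)[%classic.
have BE x : (x \in B) = (`|x - x0| < d / 2).
  rewrite ltr_distl; apply/idP/idP => [/set_mem|h]; first by rewrite /B/= in_itv.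
  by apply/mem_set; rewrite /B/= in_itv.
(* For m >= 2 j the integral of w m Q^j is zero. The integrand dominates eta r^j on the inner
   interval, which has length d, minus |w m|. *)
have main j : eta * (r ^+ j * d) <= W.
  pose m := maxn M (2 * j); have Mm : (M <= m)%N by exact: leq_maxl.
  have sQm : (size (Q ^+ j) <= m.+1)%N by rewrite (leq_trans (sQ j))// ltnS leq_maxr.
  have E0 := worth m _ sQm.
  have mB : measurable B by exact: measurable_itv.
  have mD : measurable D by exact: measurable_itv.
  have iB : leb.-integrable D (EFin \o (fun x => eta * r ^+ j * \1_B x)).
    apply: (@integrableS _ _ _ _ (`[-1, 1]%classic : set RT)) => //.
      by move=> x /=; rewrite !in_itv/= => /andP[/ltW-> /ltW->].
    apply: (@bounded_integrable _ _ _ _ `|eta * r ^+ j|); first by apply: measurable_funM.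
    move=> x _; rewrite normrM ler_piMr// indicE; case: (_ \in _); by rewrite ?normr1 ?normr0.
  have iw : leb.-integrable D (EFin \o (fun x => `|w m x|)) by exact: (integrable_norm (wi m)).
  have iq : leb.-integrable D (EFin \o (fun x => w m x * (Q ^+ j).[1 - x])).
    apply: (@eq_integrableR _ _ (fun x => (Q ^+ j).[1 - x] * w m x)); first by move=> x; rewrite mulrC.
    have [L HL] : exists L, forall x, -1 < x < 1 -> `|(Q ^+ j).[1 - x]| <= L.
      have [L HL] := @fracp_bounded R 0 (Q ^+ j) (lexx 0); exists L => x x1.
      by rewrite -fracp0 ?HL//; clear -x1; lra.
    apply: (@integrable_mul_bounded _ _ _ _ L) => //.
    by apply: measurable_funTS; apply: continuous_measurable_fun; exact: continuous_horner1.
  have : \int[leb]_(x in D) (eta * r ^+ j * \1_B x - `|w m x|) <=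
         \int[leb]_(x in D) (w m x * (Q ^+ j).[1 - x]).
    apply: le_Rintegral => //; first exact: integrable_funB.
    move=> x /=; rewrite in_itv/= => x1; rewrite horner_exp QE indicE BE.
    have x2 : (x - x0) ^+ 2 <= 4.
      rewrite (_ : 4 = 2 ^+ 2); last by ring.
      rewrite -[leLHS]real_normK ?num_real// ler_pXn2r ?nnegrE ?normr_ge0//.
      by rewrite ler_norml; clear -x1 x01; lra.
    have [xd|xd] := ltP `|x - x0| d.
      have wm := (near x xd).2 m Mm; have wm0 : 0 <= w m x := le_trans (ltW eta0) wm.
      have q1 : 1 <= 1 + (d ^+ 2 - (x - x0) ^+ 2) / 4.
        rewrite lerDl divr_ge0// subr_ge0 -real_normK ?num_real//.
        by rewrite ler_pXn2r ?nnegrE// ltW.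
      have qj0 : 0 <= (1 + (d ^+ 2 - (x - x0) ^+ 2) / 4) ^+ j by rewrite exprn_ge0// (le_trans ler01 q1).
      have [xd2|xd2] := ltP `|x - x0| (d / 2).
        rewrite mulr1 (le_trans (_ : _ <= eta * r ^+ j))//; first by rewrite gerBl.
        apply: ler_pM => //; first exact: ltW.
          by rewrite exprn_ge0// addr_ge0.
        apply: lerXn2r; [exact: addr_ge0|exact: le_trans ler01 q1|].
        rewrite /r lerD2l; have : (x - x0) ^+ 2 <= (d / 2) ^+ 2.
          by rewrite -real_normK ?num_real// ler_pXn2r ?nnegrE ?divr_ge0 ?(ltW d0)// ltW.
        by rewrite expr_div_n; clear; lra.
      rewrite mulr0 sub0r (le_trans (_ : _ <= 0)) ?oppr_le0// mulr_ge0//.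
    rewrite (_ : `|x - x0| < d / 2 = false); last by apply/negbTE; rewrite -leNgt; clear -d0 xd; lra.
    rewrite mulr0 sub0r.
    have q0 : 0 <= 1 + (d ^+ 2 - (x - x0) ^+ 2) / 4.
      have := sqr_ge0 d; clear -x2; lra.
    have q1 : 1 + (d ^+ 2 - (x - x0) ^+ 2) / 4 <= 1.
      rewrite gerDl pmulr_lle0 ?invr_gt0// subr_le0 -[leRHS]real_normK ?num_real//.
      by rewrite ler_pXn2r ?nnegrE// ltW.
    rewrite lerNl -mulNr; apply: (le_trans (ler_norm _)); rewrite normrM normrN ler_piMr//.
    by rewrite ger0_norm ?exprn_ge0// exprn_ile1.
  rewrite E0 RintegralB// RintegralZl//; last first.
    apply: (@integrableS _ _ _ _ (`[-1, 1]%classic : set RT)) => //.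
      by move=> x /=; rewrite !in_itv/= => /andP[/ltW-> /ltW->].
    apply: (@bounded_integrable _ _ _ _ 1) => //.
    by move=> x _; rewrite indicE; case: (_ \in _); rewrite ?normr1 ?normr0.
  have -> : \int[leb]_(x in D) \1_B x = d.
    rewrite /Rintegral integral_indic// setIidl; last first.
      move=> x /= xB; have := near x; rewrite /= in_itv/=; case=> //.
      by have := BE x; rewrite mem_set// => /esym h; rewrite (lt_trans h)//; clear -d0; lra.
    have := @lebesgue_measure_itv R `]x0 - d / 2, x0 + d / 2[; rewrite /= lte_fin ifT; last by lra.
    rewrite -EFinD => h; transitivity (fine (x0 + d / 2 - (x0 - d / 2))%:E); last by rewrite /=; field.
    by congr fine.
  rewrite subr_le0 mulrA => /le_trans; apply; exact: wW.
have c0 : 0 < eta * d by rewrite mulr_gt0.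
(* W does not depend on j, while r^j grows at least linearly by Bernoulli's inequality. *)
pose j := (Num.truncn (W / (eta * d * (3 / 16 * d ^+ 2)))).+1.
have := truncnS_gt (W / (eta * d * (3 / 16 * d ^+ 2))); rewrite -/j ltr_pdivrMr ?mulr_gt0//.
have := main j; have := bernoulli_ge j r0; rewrite -/r.
move: (_ * d ^+ 2) (r ^+ j) c0 => z rj c0 h1 h2 h3.
have : eta * d * (j%:R * z) <= eta * d * rj by rewrite ler_wpM2l// ltW.
rewrite (_ : eta * d * rj = eta * (rj * d)); last by ring.
rewrite (_ : eta * d * (j%:R * z) = j%:R * (eta * d * z)); last by ring.
by move=> /le_trans/(_ h2); rewrite leNgt h3.
Qed.

End legendre_expansion.

(** * Pointwise convergence on the open interval *)

Section legendre_convergence.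
Context {R : realType}.
Notation leb := (@lebesgue_measure R).
Local Notation RT := (measurableTypeR R).
Implicit Types (u K : R -> R) (p q : {poly R}) (x e : R) (n m M N : nat).
Local Notation D := (`]-1, 1[%classic : set RT).

(** An induction principle for degree at most m: a multiple of [legq n] removes the leading term,
    its own leading coefficient being nonzero. *)
Lemma legq_span_le m (P : {poly R} -> Prop) : P 0 ->
  (forall a p n, (n <= m)%N -> P p -> P (a *: legq n + p)) ->
  forall p, (size p <= m.+1)%N -> P p.
Proof.
move=> P0 Pl p; have [n] := ubnP (size p); elim: n p => // n IH p sp pm.
have [sn|] := ltnP (size p) n; first exact: IH.
rewrite ltnS in sp => np; have {np}sp : size p = n by apply/eqP; rewrite eqn_leq sp.
case: n sp IH => [|n] sp IH; first by move/eqP: sp; rewrite size_poly_eq0 => /eqP ->.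
set a := p`_n / lcoef n n.
have spq : (size (p - a *: legq n)%R < n.+1)%N.
  rewrite ltnS; apply/leq_sizeP => i.
  rewrite leq_eqVlt coefB coefZ coef_legq => /predU1P[<-|ni].
    by rewrite /a divfK ?subrr// lcoef_diag_neq0.
  by rewrite lcoef_gt// mulr0 subr0 nth_default// sp.
have -> : p = a *: legq n + (p - a *: legq n) by rewrite addrC subrK.
have nm : (n <= m)%N by rewrite -ltnS -sp.
by apply: Pl => //; apply: IH => //; rewrite (leq_trans (ltnW spq)).
Qed.

Definition bernstein_const n : R := Num.sqrt (2 / (pi * n%:R)).

(** (1 - x^2)^(-1/4), written as a Beta kernel with both parameters 3/4 so that its integrability is
    already known. *)
Definition bernstein_weight x : R := (x - -1) `^ (3 / 4 - 1) * (1 - x) `^ (3 / 4 - 1).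

Lemma bernstein_weight_ge0 x : 0 <= bernstein_weight x.
Proof. by rewrite mulr_ge0 ?powR_ge0. Qed.

Lemma bernstein_weight_sqr x : -1 < x < 1 ->
  bernstein_weight x ^+ 2 * Num.sqrt ((1 - x) * (2 - (1 - x))) = 1.
Proof.
move=> /andP[x1 x2]; have a0 : 0 < x - -1 by lra.
have b0 : 0 < 1 - x by lra.
have -> : 2 - (1 - x) = x - -1 by ring.
rewrite sqrtrM ?(ltW b0)// exprMn -(powR12_sqrt (ltW b0)) -(powR12_sqrt (ltW a0)).
have h (a : R) : 0 < a -> (a `^ (3 / 4 - 1)) ^+ 2 * a `^ 2^-1 = 1.
  move=> a0'; rewrite expr2 -!gt0_powRD//.
  have -> : 3 / 4 - 1 + (3 / 4 - 1) + 2^-1 = 0 :> R by field.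
  by rewrite powRr0.
by rewrite [(1 - x) `^ 2^-1 * _]mulrC mulrACA (h _ a0) (h _ b0) mulr1.
Qed.

Lemma legendre_bernstein n x : (0 < n)%N -> -1 < x < 1 ->
  `|(legendre n).[x]| <= bernstein_weight x * bernstein_const n.
Proof.
move=> n0 x1; have pn : 0 <= 2 / (pi * n%:R) :> R by rewrite divr_ge0// mulr_ge0// pi_ge0.
have KB := mulr_ge0 (bernstein_weight_ge0 x) (sqrtr_ge0 (2 / (pi * n%:R) : R)).
rewrite -(@ler_pXn2r _ 2) ?nnegrE//.
rewrite exprMn sqr_sqrtr// real_normK ?num_real// legendreE.
have t1 : 0 <= 1 - x <= 2 by lra.
have := legq_Bernstein n0 t1; have := bernstein_weight_sqr x1.
move: (Num.sqrt _) (bernstein_weight x ^+ 2) (sqr_ge0 (bernstein_weight x)) => s k k0 ks h.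
by have := ler_wpM2l k0 h; rewrite mulrA ks mul1r.
Qed.

Lemma bernstein_weight_integrable : leb.-integrable `[-1, 1] (EFin \o bernstein_weight).
Proof. by apply: beta_kernel_integrable; lra. Qed.

Lemma bernstein_weight_continuous x : -1 < x < 1 -> {for x, continuous bernstein_weight}.
Proof.
move=> /andP[x1 x2]; apply: cvgM.
  apply: (@continuous_comp _ _ _ (fun x => x - -1) (fun y => y `^ (3 / 4 - 1))).
    by apply: cvgB; [exact: cvg_id|exact: cvg_cst].
  by apply: continuous_powR_gt0; lra.
apply: (@continuous_comp _ _ _ (fun x => 1 - x) (fun y => y `^ (3 / 4 - 1))).
  by apply: cvgB; [exact: cvg_cst|exact: cvg_id].
by apply: continuous_powR_gt0; lra.
Qed.

Lemma abs_cont_continuous a b u x : abs_cont a b u -> a < x < b -> {for x, continuous u}.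
Proof.
move=> /abs_cont_ac_seq acu /andP[ax xb]; apply/cvgrPdist_le => e e0; have [d d0 H] := acu e e0.
near=> y.
have xyd : `|x - y| < d by near: y; apply/nbhs_ballP; exists d.
have ay : a <= y by apply/ltW; near: y; exact: lt_nbhsr.
have yb : y <= b by apply/ltW; near: y; exact: lt_nbhsl.
have [xy|yx|->] := ltgtP x y; last by rewrite subrr normr0 ltW.
  have := H [:: (x, y)]; rewrite !big_seq1/= /itv_family/= xy (ltW ax) yb/= distrC; apply => //.
  by rewrite (le_lt_trans _ xyd)// distrC ler_norm.
have := H [:: (y, x)]; rewrite !big_seq1/= /itv_family/= yx ay (ltW xb)/=; apply => //.
by rewrite (le_lt_trans _ xyd)// ler_norm.
Unshelve. all: by end_near. Qed.

Definition proj_poly u m : {poly R} := \sum_(i < m.+1) legendre_coef u i *: legq i.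

Lemma legendre_projE m u x : legendre_proj m u x = (proj_poly u m).[1 - x].
Proof.
by rewrite /legendre_proj /proj_poly horner_sum; apply: eq_bigr => i _; rewrite legendreE hornerZ.
Qed.

Lemma ipoly_sum (F : nat -> {poly R}) m : ipoly (\sum_(i < m) F i) = \sum_(i < m) ipoly (F i).
Proof.
elim: m => [|m IH]; last by rewrite !big_ord_recr/= ipolyD IH.
by rewrite !big_ord0 -(scale0r 0) ipolyZ mul0r.
Qed.

Lemma Rintegral_oo_cc (F : R -> R) : leb.-integrable `[-1, 1] (EFin \o F) ->
  \int[leb]_(x in D) F x = \int[leb]_(x in `[-1, 1]) F x.
Proof.
move=> iF; rewrite Rintegral_itv_bndo_bndc; last first.
  apply: (@integrableS _ _ _ _ (`[-1, 1]%classic : set RT)) => //.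
  by move=> x /=; rewrite !in_itv/= => /andP[/ltW-> /ltW->].
rewrite Rintegral_itv_obnd_cbnd//.
apply: (@integrableS _ _ _ _ (`[-1, 1]%classic : set RT)) => //.
by move=> x /=; rewrite !in_itv/= => /andP[/ltW-> ->].
Qed.

Section remainder.
Context (u : R -> R).
Context (acu : abs_cont (-1) 1 u).

Let m11 : -1 <= 1 :> R. Proof. lra. Qed.

Let w m x := u x - legendre_proj m u x.

Let mul_poly_integrable (v : R -> R) p : leb.-integrable `[-1, 1] (EFin \o v) ->
  leb.-integrable `[-1, 1] (EFin \o (fun x => v x * p.[1 - x])).
Proof.
move=> iv; apply: (@eq_integrableR _ _ (fun x => p.[1 - x] * v x)); first by move=> x; rewrite mulrC.
have [L HL] := @fracp_bounded R 0 p (lexx 0).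
apply: (@integrable_mul_bounded _ _ _ _ L) => //.
  by apply: measurable_funTS; apply: continuous_measurable_fun; exact: continuous_horner1.
by move=> x /=; rewrite in_itv/= => x1; rewrite -fracp0 ?HL//; lra.
Qed.

Let w_integrable m : leb.-integrable `[-1, 1] (EFin \o w m).
Proof.
apply: (@eq_integrableR _ _ (fun x => u x - (proj_poly u m).[1 - x])).
  by move=> x; rewrite /w legendre_projE.
apply: integrable_funB => //; first exact: abs_cont_integrable.
exact: integrable_horner1.
Qed.

Lemma legendre_remainder_orthogonal m p : (size p <= m.+1)%N ->
  \int[leb]_(x in `[-1, 1]) (w m x * p.[1 - x]) = 0.
Proof.
move: p; apply: legq_span_le => [|a p n nm IH].
  rewrite /Rintegral integral0_eq// => x _; by rewrite horner0 mulr0.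
transitivity (a * \int[leb]_(x in `[-1, 1]) (w m x * (legq n).[1 - x]) +
  \int[leb]_(x in `[-1, 1]) (w m x * p.[1 - x])).
  have i1 := mul_poly_integrable (legq n) (w_integrable m).
  have i2 := mul_poly_integrable p (w_integrable m).
  have i3 : leb.-integrable `[-1, 1] (EFin \o (fun x => a * (w m x * (legq n).[1 - x]))).
    apply: (@eq_integrableR _ _ (fun x => w m x * (a *: legq n).[1 - x])).
      by move=> x; rewrite hornerZ mulrCA.
    exact: mul_poly_integrable.
  have E1 : \int[leb]_(x in `[-1, 1]) (a * (w m x * (legq n).[1 - x])) =
     a * \int[leb]_(x in `[-1, 1]) (w m x * (legq n).[1 - x]) by exact: RintegralZl.
  rewrite -E1 -RintegralD//; apply: eq_Rintegral => x _.
  by rewrite hornerD hornerZ; ring.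
rewrite IH addr0; apply/eqP; rewrite mulf_eq0; apply/orP; right; apply/eqP.
transitivity (\int[leb]_(x in `[-1, 1]) (u x * (legq n).[1 - x]) - ipoly (proj_poly u m * legq n)).
  rewrite /ipoly -RintegralB//; [|exact: mul_poly_integrable (abs_cont_integrable m11 acu)|exact: integrable_horner1].
  by apply: eq_Rintegral => x _; rewrite /w legendre_projE hornerM mulrBl.
have -> : ipoly (proj_poly u m * legq n) = legendre_coef u n * (2 / (2 * n%:R + 1)).
  rewrite /proj_poly mulr_suml.
  have := ipoly_sum (fun i => legendre_coef u i *: legq i * legq n) m.+1 => ->.
  have nm' : (n < m.+1)%N by rewrite ltnS.
  rewrite (bigD1 (Ordinal nm'))//= big1 ?addr0.
    by rewrite -scalerAl ipolyZ legq_norm.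
  move=> i /eqP ni; rewrite -scalerAl ipolyZ legq_orthogonal ?mulr0//.
  by apply/eqP => /= E; apply: ni; apply/val_inj.
rewrite /legendre_coef; have n1 : 2 * n%:R + 1 != 0 :> R by rewrite gt_eqF// ltr_wpDl// mulr_ge0.
have -> : \int[leb]_(x in `[-1, 1]) (u x * (legendre n).[x]) =
    \int[leb]_(x in `[-1, 1]) (u x * (legq n).[1 - x]).
  by apply: eq_Rintegral => x _; rewrite legendreE.
by move: (\int[leb]_(x in _) _) (2 * n%:R + 1) n1 => I c c0; field.
Qed.

Lemma legendre_proj_diff x M m (B : nat -> R) : (M <= m)%N ->
  (forall n, (M < n)%N -> `|legendre_coef u n * (legendre n).[x]| <= B n) ->
  `|legendre_proj m u x - legendre_proj M u x| <= \sum_(M.+1 <= n < m.+1) B n.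
Proof.
move=> Mm HB; rewrite /legendre_proj.
rewrite -(big_mkord xpredT (fun n => legendre_coef u n * (legendre n).[x])).
rewrite -(big_mkord xpredT (fun n => legendre_coef u n * (legendre n).[x])).
rewrite (@big_cat_nat _ _ _ M.+1)//= addrAC subrr add0r.
apply: (le_trans (ler_norm_sum _ _ _)); rewrite [leLHS]big_nat [leRHS]big_nat.
by apply: ler_sum => n /andP[Mn _]; exact: HB.
Qed.

(** By Bernstein's bound the partial sums are uniformly Cauchy up to the weight. If they missed u at
    x0, some remainder and all later ones would keep one sign and a definite size near x0 while
    staying bounded in L^1, against [concentration]. *)
Lemma legendre_convergence (S : R) :
  (forall m, \sum_(1 <= n < m.+1) `|legendre_coef u n| * bernstein_const n <= S) ->
  forall x, -1 < x < 1 -> forall e, 0 < e -> exists M, forall m, (M <= m)%N ->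
  `|u x - legendre_proj m u x| <= e.
Proof.
move=> HS x0 x01 e e0; apply: contrapT => nconv.
have {}nconv M : exists2 m, (M <= m)%N & e < `|w m x0|.
  apply: contrapT => h; apply: nconv; exists M => m Mm; rewrite leNgt; apply/negP => wm.
  by apply: h; exists m.
pose s m := \sum_(1 <= n < m.+1) `|legendre_coef u n| * bernstein_const n.
have b0 n : 0 <= `|legendre_coef u n| * bernstein_const n by rewrite mulr_ge0 ?sqrtr_ge0.
have sB M m : (M <= m)%N -> s m - s M = \sum_(M.+1 <= n < m.+1) `|legendre_coef u n| * bernstein_const n.
  by move=> Mm; rewrite /s (@big_cat_nat _ _ _ M.+1)//= addrAC subrr add0r.
pose K0 := bernstein_weight x0 + 1.
have K00 : 0 < K0 by rewrite ltr_wpDl ?bernstein_weight_ge0.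
(* Later remainders differ from [w M] by at most the weight times e', that is e / 8 where the weight
   is below K0. With e / 4 spent on continuity, more than e / 2 of the initial e is left. *)
pose e' := e / (8 * K0); have e'0 : 0 < e' by rewrite divr_gt0// mulr_gt0.
have [M1 HM1] : exists M, forall m, (M <= m)%N -> s m - s M <= e'.
  have hs : has_sup (range s) by split; [exists (s 0%N); exists 0%N|exists S => _ [m _ <-]; exact: HS].
  have [_ [M _ <-] HM] := sup_adherent e'0 hs; exists M => m Mm.
  have : s m <= sup (range s) by apply: ub_le_sup; [exact: (proj2 hs)|exists m].
  by move: HM; lra.
have [M M1M wM] := nconv M1.
have HM m : (M <= m)%N -> s m - s M <= e'.
  move=> Mm; have := HM1 _ (leq_trans M1M Mm); have : s M1 <= s M.
    by rewrite -subr_ge0 sB// sumr_ge0.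
  by lra.
have diff m x : (M <= m)%N -> -1 < x < 1 -> `|w m x - w M x| <= bernstein_weight x * e'.
  move=> Mm x1; rewrite /w opprB addrC addrA subrK distrC.
  apply: (le_trans (@legendre_proj_diff x M m (fun n => bernstein_weight x * (`|legendre_coef u n| * bernstein_const n)) Mm _)).
    move=> n Mn; rewrite normrM mulrCA ler_wpM2l// legendre_bernstein//.
    exact: leq_ltn_trans Mn.
  by rewrite -mulr_sumr -sB// ler_wpM2l ?HM ?bernstein_weight_ge0.
(* Turns all the remainders by the sign of [w M x0], as [concentration] asks for positive values
   near the point. *)
pose sg : R := (-1) ^+ (w M x0 < 0)%R.
have sgn : `|sg| = 1 by rewrite /sg normrX normrN1 expr1n.
have sgw : sg * w M x0 = `|w M x0|.
  rewrite /sg; case: ltP => h; first by rewrite expr1 mulN1r ltr0_norm.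
  by rewrite expr0 mul1r ger0_norm.
have sgb (y : R) : `|sg * y| = `|y| by rewrite normrM sgn mul1r.
(* A bound in L^1 uniform in m >= M: the drift away from [w M] is at most e' times the integrable
   weight. *)
pose W := \int[leb]_(x in D) `|w M x| + e' * \int[leb]_(x in D) bernstein_weight x.
have sub : D `<=` `[-1, 1]%classic by move=> x /=; rewrite !in_itv/= => /andP[/ltW-> /ltW->].
have iwD m : leb.-integrable D (EFin \o w m).
  by apply: (@integrableS _ _ _ _ (`[-1, 1]%classic : set RT)).
have iKD : leb.-integrable D (EFin \o bernstein_weight).
  apply: (@integrableS _ _ _ _ (`[-1, 1]%classic : set RT)) => //.
  exact: bernstein_weight_integrable.
have iaD m : leb.-integrable D (EFin \o (fun x => `|w m x|)) by exact: (integrable_norm (iwD m)).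
have mD : measurable D by exact: measurable_itv.
have mC : measurable (`[-1, 1]%classic : set RT) by exact: measurable_itv.
have ieK : leb.-integrable D (EFin \o (fun x => e' * bernstein_weight x)).
  by have := integrableZl mD e' iKD; apply: eq_integrable.
have h := @concentration R (fun m x => sg * w m x) W M x0 (e / 2).
apply: h.
- by rewrite divr_gt0.
- move=> m; have := integrableZl mD sg (iwD m); exact: eq_integrable.
- move=> m p sp; rewrite Rintegral_oo_cc; last first.
    apply: mul_poly_integrable.
    have := integrableZl mC sg (w_integrable m); exact: eq_integrable.
  transitivity (sg * \int[leb]_(x in `[-1, 1]) (w m x * p.[1 - x])).
    rewrite -RintegralZl//; last exact: mul_poly_integrable.
    by apply: eq_Rintegral => x _; rewrite mulrA.
  by rewrite legendre_remainder_orthogonal// mulr0.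
- move=> m Mm; rewrite /W -RintegralZl// -RintegralD//.
  apply: le_Rintegral => //.
  + have := integrableZl mD sg (iwD m) => i1.
    by apply: (@eq_integrableR _ _ (fun x => `|w m x|)) => // x; rewrite sgb.
  + by have := integrableD mD (iaD M) ieK; apply: eq_integrable.
  move=> x xD; rewrite sgb -lerBlDl; apply: (le_trans (lerB_dist _ _)).
  by rewrite mulrC; apply: diff => //; move: xD; rewrite /= in_itv.
have cw : {for x0, continuous (w M)}.
  have -> : w M = (fun x => u x - (proj_poly u M).[1 - x]).
    by apply/funext => y; rewrite /w legendre_projE.
  by apply: cvgB; [exact: abs_cont_continuous acu x01|exact: continuous_horner1].
have e4 : 0 < e / 4 by rewrite divr_gt0.
have : \forall x \near x0, [/\ -1 < x, x < 1, `|w M x0 - w M x| <= e / 4 &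
    `|bernstein_weight x0 - bernstein_weight x| <= 1].
  near=> x; split.
  - by near: x; apply: lt_nbhsr; case/andP: x01.
  - by near: x; apply: lt_nbhsl; case/andP: x01.
  - by near: x; move/cvgrPdist_le : cw; exact.
  - by near: x; move/cvgrPdist_le : (bernstein_weight_continuous x01); exact.
move/nbhs_ballP => [d /= d0 Hd]; exists d => // x xd.
have /Hd[x1 x2 h1 h2] : ball x0 d x by rewrite /ball/= distrC.
split; first by rewrite x1.
move=> m Mm; have dm := diff m x Mm ltac:(by rewrite x1).
have Kx : bernstein_weight x <= K0.
  by rewrite /K0; have := ler_norm (bernstein_weight x - bernstein_weight x0); rewrite distrC; lra.
have Ke : bernstein_weight x * e' <= e / 8.
  apply: (@le_trans _ _ (K0 * e')); first by rewrite ler_wpM2r// ltW.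
  by rewrite /e' le_eqVlt; apply/orP; left; apply/eqP; field; rewrite gt_eqF.
have g1 := ler_norm (sg * (w M x0 - w M x)); rewrite sgb mulrBr sgw in g1.
have g2 := ler_norm (sg * (w M x - w m x)); rewrite sgb distrC mulrBr in g2.
by move: e0 wM g1 g2 h1 dm Ke; clear; move=> *; lra.
Unshelve. all: by end_near. Qed.

End remainder.

End legendre_convergence.

(** * Tails of the series *)

Section tail_sums.
Context {R : realType}.
Notation leb := (@lebesgue_measure R).
Implicit Types (u : R -> R) (x e mu nu V C : R) (n m M N : nat).

(** The step is two because n enters the Gamma values through n / 2. Two initial terms survive, and
    monotonicity replaces them by twice the first. *)
Lemma telescope2_le (T a : nat -> R) C N : 0 <= C ->
  (forall n, (N < n)%N -> 0 <= T n) -> (forall n, (N < n)%N -> T n.+1 <= T n) ->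
  (forall n, (N < n)%N -> a n <= C * (T n - T n.+2)) ->
  forall m, \sum_(N.+1 <= n < m.+1) a n <= 2 * C * T N.+1.
Proof.
move=> C0 T0 Td aT m; rewrite -[N.+1]add0n big_addn big_mkord add0n.
move: (m.+1 - N.+1)%N => {m} k.
apply: (@le_trans _ _ (\sum_(i < k) C * (T (i + N.+1)%N - T (i + N.+1).+2))).
  by apply: ler_sum => i _; apply: aT; rewrite addnS ltnS leq_addl.
rewrite -mulr_sumr.
have -> : \sum_(i < k) (T (i + N.+1)%N - T (i + N.+1).+2) =
    T N.+1 + T N.+2 - T (k + N.+1)%N - T (k + N.+1).+1.
  elim: k => [|k IH]; first by rewrite big_ord0 add0n; ring.
  by rewrite big_ord_recr/= IH !addSn; ring.
rewrite [2 * C]mulrC -mulrA ler_wpM2l//.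
have h1 := Td _ (ltnSn N); have h2 := T0 (k + N.+1)%N ltac:(by rewrite addnS ltnS leq_addl).
have h3 := T0 (k + N.+1).+1 ltac:(by rewrite ltnW// ltnS addnS ltnS leq_addl).
by lra.
Qed.

(** The telescoping sequence: nu = mu - 1 serves for (A), nu = mu for (B), and at n = N + 1 it is
    the Gamma quotient of the estimate. *)
Definition gamma_ratio mu nu n : R := gam ((n%:R - mu) / 2) / gam ((n%:R + nu) / 2).

Lemma gamma_ratio_gt0 mu nu n : mu < n%:R -> 0 < n%:R + nu -> 0 < gamma_ratio mu nu n.
Proof. by move=> h1 h2; rewrite divr_gt0// Gamma_gt0//; lra. Qed.

Lemma gamma_ratio_diff mu nu n : mu < n%:R -> 0 < n%:R + nu ->
  gamma_ratio mu nu n - gamma_ratio mu nu n.+2 =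
  gamma_ratio mu nu n * ((mu + nu) / (n%:R + nu)).
Proof.
move=> h1 h2; rewrite /gamma_ratio.
have e2 : n.+2%:R = n%:R + 2 :> R by rewrite -addn2 natrD.
have -> : (n.+2%:R - mu) / 2 = (n%:R - mu) / 2 + 1 by rewrite e2; field.
have -> : (n.+2%:R + nu) / 2 = (n%:R + nu) / 2 + 1 by rewrite e2; field.
rewrite !GammaS; [|lra|lra].
have := lt0r_neq0 (Gamma_gt0 (s := (n%:R + nu) / 2) ltac:(lra)).
have h3 := lt0r_neq0 h2; move: (gam ((n%:R - mu) / 2)) (gam ((n%:R + nu) / 2)) => A B h4.
by field; rewrite h3 h4.
Qed.

Lemma gamma_ratio_le mu nu n : mu < n%:R -> 0 <= mu + nu ->
  gamma_ratio mu nu n.+1 <= gamma_ratio mu nu n.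
Proof.
move=> h1 h2; have a0 : 0 < (n%:R - mu) / 2 by lra.
have ab : (n%:R - mu) / 2 <= (n%:R + nu) / 2 by lra.
have h := Gamma_half_ratio_le a0 ab; rewrite /gamma_ratio -[n.+1%:R]natr1.
have -> : (n%:R + 1 - mu) / 2 = (n%:R - mu) / 2 + 1 / 2 by field.
have -> : (n%:R + 1 + nu) / 2 = (n%:R + nu) / 2 + 1 / 2 by field.
have A0 := Gamma_gt0 (s := (n%:R - mu) / 2) a0.
have B0 := Gamma_gt0 (s := (n%:R + nu) / 2) ltac:(lra).
have C0 := Gamma_gt0 (s := (n%:R + nu) / 2 + 1 / 2) ltac:(lra).
rewrite ler_pdivrMr// mulrAC ler_pdivlMr//.
by move: h; rewrite ler_pdivrMr// mulrAC ler_pdivlMr// [leRHS]mulrC.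
Qed.

(** The functional equation reduces the comparison to n + 1/2 <= n + mu + 1. The condition mu > 1/2
    enters through mu + nu = 2 mu - 1, the factor by which the telescoping sequence decreases. *)
Lemma legq_amp_term_le mu n : 1 / 2 < mu -> mu < n%:R ->
  (2 * n%:R + 1) / 2 * legq_amp n (mu + 1) <=
  2 / (2 `^ (mu + 1) * Num.sqrt pi * (mu - 1 / 2)) *
  (gamma_ratio mu (mu - 1) n - gamma_ratio mu (mu - 1) n.+2).
Proof.
move=> mu2 mun; have n1 : 1 <= n%:R :> R.
  by rewrite ler1n -(ltr0n R); lra.
rewrite gamma_ratio_diff//; last by lra.
rewrite /legq_amp /gamma_ratio; set y := (n%:R + (mu - 1)) / 2.
have y0 : 0 < y by rewrite /y; lra.
have -> : (n%:R + 1 - (mu + 1)) / 2 = (n%:R - mu) / 2 by field.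
have -> : (n%:R + (mu + 1) + 2) / 2 = y + 1 + 1 by rewrite /y; field.
rewrite !GammaS//; last by rewrite addr_gt0.
have -> : mu + (mu - 1) = 2 * (mu - 1 / 2) by field.
have -> : n%:R + (mu - 1) = 2 * y by rewrite /y; field.
have G0 := Gamma_gt0 (s := y) y0; have A0 := Gamma_gt0 (s := (n%:R - mu) / 2) ltac:(lra).
have P0 : 0 < 2 `^ (mu + 1) * Num.sqrt pi :> R by rewrite mulr_gt0 ?powR_gt0 ?sqrt_pi_gt0.
have hn : (2 * n%:R + 1) / 2 <= 2 * (y + 1) by rewrite /y; lra.
move: (2 `^ (mu + 1) * Num.sqrt pi) (gam y) (gam ((n%:R - mu) / 2)) P0 G0 A0 => P G A P0 G0 A0.
have m0 : 0 < mu - 1 / 2 by lra.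
have -> : 2 / (P * (mu - 1 / 2)) * (A / G * (2 * (mu - 1 / 2) / (2 * y))) =
    2 * (y + 1) * (P^-1 * (A / ((y + 1) * (y * G)))).
  by field; rewrite !gt_eqF//; move: y0 m0; clear; clearbody y; lra.
clearbody y; apply: ler_wpM2r hn; apply: ltW; rewrite mulr_gt0 ?invr_gt0// divr_gt0// !mulr_gt0//.
by rewrite addr_gt0.
Qed.

Lemma legq_amp_bernstein_term_le mu n : 0 < mu -> mu < n%:R ->
  (2 * n%:R + 1) / 2 * legq_amp n (mu + 1) * bernstein_const n <=
  (2 `^ mu * pi * mu)^-1 * (gamma_ratio mu mu n - gamma_ratio mu mu n.+2).
Proof.
move=> mu0 mun; have n1 : 1 <= n%:R :> R by rewrite ler1n -(ltr0n R); lra.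
rewrite gamma_ratio_diff//; last by lra.
rewrite /legq_amp /gamma_ratio; set y := (n%:R + mu) / 2.
have y0 : 0 < y by rewrite /y; lra.
have -> : (n%:R + 1 - (mu + 1)) / 2 = (n%:R - mu) / 2 by field.
have -> : (n%:R + (mu + 1) + 2) / 2 = y + 1 + 1 / 2 by rewrite /y; field.
have -> : n%:R + mu = 2 * y by rewrite /y; field.
have A0 := Gamma_gt0 (s := (n%:R - mu) / 2) ltac:(lra).
have H := @Gamma_half_ratio_lower R (y + 1) ltac:(lra).
have E := GammaS y0; have G0 := Gamma_gt0 y0.
have Z0 := Gamma_gt0 (s := y + 1) ltac:(lra).
have W0 := Gamma_gt0 (s := y + 1 + 1 / 2) ltac:(lra).
have p0 := @sqrt_pi_gt0 R.
have pE : pi = Num.sqrt pi ^+ 2 :> R by rewrite sqr_sqrtr// pi_ge0.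
rewrite powRD ?pnatr_eq0 ?implybT// powRr1// /bernstein_const.
have P0 : 0 < 2 `^ mu :> R by rewrite powR_gt0.
have -> : 2 / (pi * n%:R) = (Num.sqrt pi)^-1 ^+ 2 * (2 / n%:R) :> R.
  by rewrite {1}pE; field; rewrite !gt_eqF//; lra.
rewrite sqrtrM ?sqr_ge0// sqrtr_sqr ger0_norm ?invr_ge0 ?(ltW p0)//.
set r := Num.sqrt (2 / n%:R).
have r0 : 0 <= r by exact: sqrtr_ge0.
have rE : r ^+ 2 = 2 / n%:R by rewrite sqr_sqrtr// divr_ge0.
(* After squaring, n/2 + 1/2 + 1/(8n) has to be at most y + 3/4 = n/2 + mu/2 + 3/4, the constant
   that [Gamma_half_ratio_lower] provides at y + 1. *)
have key : (2 * n%:R + 1) / 4 * r * gam (y + 1) <= gam (y + 1 + 1 / 2).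
  have c0 : 0 <= (2 * n%:R + 1) / 4 * r * gam (y + 1).
    by rewrite !mulr_ge0 ?(ltW Z0)// addr_ge0// mulr_ge0.
  rewrite -(ler_pXn2r (n := 2))// ?nnegrE ?(ltW W0)//.
  apply: le_trans H; rewrite exprMn [(_ / 4 * r) ^+ 2]exprMn rE ler_wpM2r ?sqr_ge0//.
  rewrite -subr_ge0; have -> : y + 1 - 1 / 4 - ((2 * n%:R + 1) / 4) ^+ 2 * (2 / n%:R) =
      (2 * n%:R - 1 + 4 * mu * n%:R) / (8 * n%:R).
    by rewrite /y; field; rewrite gt_eqF//; lra.
  have m0 : 0 <= mu * n%:R by rewrite mulr_ge0// ltW.
  by rewrite divr_ge0//; lra.
rewrite [X in (_ * X * mu)^-1]pE.
have -> : (2 `^ mu * Num.sqrt pi ^+ 2 * mu)^-1 * (gam ((n%:R - mu) / 2) / gam y * ((mu + mu) / (2 * y))) =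
   (2 `^ mu * Num.sqrt pi ^+ 2)^-1 * gam ((n%:R - mu) / 2) * (gam (y + 1))^-1.
  rewrite E; move: (Num.sqrt pi) (gam ((n%:R - mu) / 2)) (gam y) p0 A0 G0 => p A G p0 A0 G0.
  by move: P0; move: (2 `^ mu) => P P0; field; rewrite !gt_eqF.
have -> : (2 * n%:R + 1) / 2 * ((2 `^ mu * 2 * Num.sqrt pi)^-1 * (gam ((n%:R - mu) / 2) / gam (y + 1 + 1 / 2))) *
    ((Num.sqrt pi)^-1 * r) =
   (2 `^ mu * Num.sqrt pi ^+ 2)^-1 * gam ((n%:R - mu) / 2) * ((2 * n%:R + 1) / 4 * r / gam (y + 1 + 1 / 2)).
  move: (Num.sqrt pi) (gam ((n%:R - mu) / 2)) (gam (y + 1 + 1 / 2)) p0 A0 W0 => p A W p0 A0 W0.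
  by move: P0; move: (2 `^ mu) => P P0; field; rewrite !gt_eqF.
apply: ler_wpM2l; first by rewrite mulr_ge0 ?(ltW A0)// invr_ge0 mulr_ge0 ?(ltW P0) ?sqr_ge0.
by rewrite ler_pdivrMr// [leRHS]mulrC ler_pdivlMr.
Qed.

Section remainder_bounds.
Context (u : R -> R) (mu V : R) (N : nat).
Context (acu : abs_cont (-1) 1 u) (mu0 : 0 < mu) (muN : mu <= N%:R) (V0 : 0 <= V).
Context (coef : forall n, (N < n)%N ->
  `|legendre_coef u n| <= (2 * n%:R + 1) / 2 * (V * legq_amp n (mu + 1))).

Let mun n : (N < n)%N -> mu < n%:R.
Proof. by move=> Nn; apply: (le_lt_trans muN); rewrite ltr_nat. Qed.

Let sum_coef_sup : 1 / 2 < mu -> forall m, \sum_(N.+1 <= n < m.+1) `|legendre_coef u n| <=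
  1 / (2 `^ (mu - 1) * (mu - 1 / 2) * Num.sqrt pi) *
    (gam ((N%:R - mu + 1) / 2) / gam ((N%:R + mu) / 2)) * V.
Proof.
move=> mu2 m; pose c := 2 / (2 `^ (mu + 1) * Num.sqrt pi * (mu - 1 / 2)) : R.
have c0 : 0 <= c * V.
  by rewrite mulr_ge0// divr_ge0// ?mulr_ge0 ?powR_ge0 ?sqrtr_ge0//; lra.
have p n : (N < n)%N -> 0 < n%:R + (mu - 1).
  move=> /mun h; have : 1 <= n%:R :> R by rewrite ler1n -(ltr0n R) (lt_trans mu0).
  by lra.
have := @telescope2_le (gamma_ratio mu (mu - 1)) (fun n => `|legendre_coef u n|) (c * V) N c0.
move=> /(_ _ _ _ m) h; apply: le_trans (h _ _ _) _.
- by move=> n Nn; apply/ltW/gamma_ratio_gt0; [exact: mun|exact: p].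
- by move=> n Nn; apply: gamma_ratio_le; [exact: mun|lra].
- move=> n Nn; apply: (le_trans (coef Nn)).
  have := ler_wpM2r V0 (legq_amp_term_le mu2 (mun Nn)); rewrite -/c.
  by rewrite [c * _ * V]mulrAC; apply: le_trans; rewrite le_eqVlt; apply/orP; left; apply/eqP; ring.
rewrite /gamma_ratio -[N.+1%:R]natr1.
have -> : N%:R + 1 - mu = N%:R - mu + 1 by ring.
have -> : N%:R + 1 + (mu - 1) = N%:R + mu by ring.
rewrite /c; have -> : mu + 1 = (mu - 1) + 2 by ring.
rewrite powRD ?pnatr_eq0 ?implybT// powR_mulrn//.
have P0 : 0 < 2 `^ (mu - 1) :> R by rewrite powR_gt0.
have p0 := @sqrt_pi_gt0 R; have m0 : 0 < mu - 1 / 2 by lra.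
have Nmu : 0 < N%:R + mu by rewrite addr_gt0// (lt_le_trans mu0).
have G0 := Gamma_gt0 (s := (N%:R + mu) / 2) ltac:(by rewrite divr_gt0).
move: (gam ((N%:R - mu + 1) / 2)) (gam ((N%:R + mu) / 2)) G0 (Num.sqrt pi) p0 (2 `^ (mu - 1)) P0 => A G G0 q q0 P P0.
rewrite le_eqVlt; apply/orP; left; apply/eqP; field.
by rewrite !gt_eqF//; lra.
Qed.

Let sum_coef_bernstein m :
  \sum_(N.+1 <= n < m.+1) `|legendre_coef u n| * bernstein_const n <=
  1 / (2 `^ (mu - 1) * mu * pi) *
    (gam ((N%:R - mu + 1) / 2) / gam ((N%:R + mu + 1) / 2)) * V.
Proof.
pose c := (2 `^ mu * pi * mu)^-1 : R.
have c0 : 0 <= c * V by rewrite mulr_ge0// invr_ge0 !mulr_ge0 ?powR_ge0 ?pi_ge0// ltW.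
have p n : (N < n)%N -> 0 < n%:R + mu by move=> /mun h; rewrite addr_gt0// (lt_trans mu0).
have := @telescope2_le (gamma_ratio mu mu) (fun n => `|legendre_coef u n| * bernstein_const n) (c * V) N c0.
move=> /(_ _ _ _ m) h; apply: le_trans (h _ _ _) _.
- by move=> n Nn; apply/ltW/gamma_ratio_gt0; [exact: mun|exact: p].
- by move=> n Nn; apply: gamma_ratio_le; [exact: mun|by rewrite addr_ge0// ltW].
- move=> n Nn.
  have b0 : 0 <= bernstein_const n :> R by rewrite sqrtr_ge0.
  apply: (le_trans (ler_wpM2r b0 (coef Nn))).
  have := ler_wpM2r V0 (legq_amp_bernstein_term_le mu0 (mun Nn)); rewrite -/c [c * _ * V]mulrAC.
  by apply: le_trans; rewrite le_eqVlt; apply/orP; left; apply/eqP; ring.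
rewrite /gamma_ratio -[N.+1%:R]natr1.
have -> : N%:R + 1 - mu = N%:R - mu + 1 by ring.
have -> : N%:R + 1 + mu = N%:R + mu + 1 by ring.
rewrite /c; have -> : 2 `^ mu = 2 `^ (mu - 1) * 2 :> R.
  have -> : 2 `^ mu = 2 `^ (mu - 1 + 1) :> R by rewrite subrK.
  by rewrite powRD ?pnatr_eq0 ?implybT// powRr1.
have P0 : 0 < 2 `^ (mu - 1) :> R by rewrite powR_gt0.
have p0 := pi_gt0 R.
have Nmu : 0 < N%:R + mu + 1 by rewrite addr_gt0// addr_gt0// (lt_le_trans mu0).
have G0 := Gamma_gt0 (s := (N%:R + mu + 1) / 2) ltac:(by rewrite divr_gt0).
move: (gam ((N%:R - mu + 1) / 2)) (gam ((N%:R + mu + 1) / 2)) G0 (pi : R) p0 (2 `^ (mu - 1)) P0 => A G G0 q q0 P P0.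
by rewrite le_eqVlt; apply/orP; left; apply/eqP; field; rewrite !gt_eqF.
Qed.

(** The majorant B is left open: it is |u_n| for (A), since |P_n| <= 1, and Bernstein's bound for
    (B). Convergence relies on the Bernstein sums in both cases, so mu > 1/2 is not assumed. *)
Let remainder_le x (B : nat -> R) C : -1 < x < 1 ->
  (forall n, (N < n)%N -> `|legendre_coef u n * (legendre n).[x]| <= B n) ->
  (forall m, \sum_(N.+1 <= n < m.+1) B n <= C) ->
  `|u x - legendre_proj N u x| <= C.
Proof.
move=> x1 hB hC; apply/ler_addgt0Pr => e e0.
have b0 n : 0 <= `|legendre_coef u n| * bernstein_const n.
  by rewrite mulr_ge0// sqrtr_ge0.
pose S := \sum_(1 <= n < N.+1) `|legendre_coef u n| * bernstein_const n +
  1 / (2 `^ (mu - 1) * mu * pi) *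
    (gam ((N%:R - mu + 1) / 2) / gam ((N%:R + mu + 1) / 2)) * V.
have hS m : \sum_(1 <= n < m.+1) `|legendre_coef u n| * bernstein_const n <= S.
  apply: (@le_trans _ _ (\sum_(1 <= n < (maxn m N).+1) `|legendre_coef u n| * bernstein_const n)).
    rewrite [leRHS](@big_cat_nat _ _ _ m.+1)//= ?ltnS ?leq_maxl//.
    by rewrite lerDl sumr_ge0.
  rewrite (@big_cat_nat _ _ _ N.+1)//= ?ltnS ?leq_maxr//.
  by rewrite lerD2l sum_coef_bernstein.
have [M HM] := legendre_convergence acu hS x1 e0.
have d1 := HM (maxn M N) (leq_maxl _ _).
have d2 := le_trans (legendre_proj_diff (leq_maxr M N) hB) (hC _).
have -> : u x - legendre_proj N u x = (u x - legendre_proj (maxn M N) u x) +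
  (legendre_proj (maxn M N) u x - legendre_proj N u x) by ring.
by apply: (le_trans (ler_normD _ _)); rewrite addrC lerD.
Qed.

Lemma legendre_remainder_sup x : 1 / 2 < mu -> -1 < x < 1 ->
  `|u x - legendre_proj N u x| <=
  1 / (2 `^ (mu - 1) * (mu - 1 / 2) * Num.sqrt pi) *
    (gam ((N%:R - mu + 1) / 2) / gam ((N%:R + mu) / 2)) * V.
Proof.
move=> mu2 x1; apply: (@remainder_le _ (fun n => `|legendre_coef u n|)) => //.
  move=> n Nn; rewrite normrM ler_piMr// legendreE legq_le1//; lra.
exact: sum_coef_sup.
Qed.

Lemma legendre_remainder_bernstein x : -1 < x < 1 ->
  `|(1 - x ^+ 2) `^ (1 / 4) * (u x - legendre_proj N u x)| <=
  1 / (2 `^ (mu - 1) * mu * pi) *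
    (gam ((N%:R - mu + 1) / 2) / gam ((N%:R + mu + 1) / 2)) * V.
Proof.
move=> x1; pose K := bernstein_weight x.
have K0 : 0 <= K := bernstein_weight_ge0 x.
have N0 : (0 < N)%N by rewrite -(ltr0n R) (lt_le_trans mu0).
have h : `|u x - legendre_proj N u x| <= K * (1 / (2 `^ (mu - 1) * mu * pi) *
    (gam ((N%:R - mu + 1) / 2) / gam ((N%:R + mu + 1) / 2)) * V).
  apply: (@remainder_le _ (fun n => K * (`|legendre_coef u n| * bernstein_const n))) => //.
    move=> n Nn; rewrite normrM mulrCA ler_wpM2l//.
    by rewrite legendre_bernstein// (ltn_trans N0).
  move=> m; rewrite -mulr_sumr; apply: ler_wpM2l => //; exact: sum_coef_bernstein.
have p4 : 0 <= (1 - x ^+ 2) `^ (1 / 4) by exact: powR_ge0.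
have x2 : 0 <= 1 - x ^+ 2 by nra.
(* The prefactor of (B) is the inverse of Bernstein's weight, so it cancels exactly. *)
have E : (1 - x ^+ 2) `^ (1 / 4) * K = 1.
  apply/eqP; rewrite -(@eqrXn2 _ 2)// ?(mulr_ge0 p4 K0)//.
  rewrite expr1n exprMn -[(_ `^ _) ^+ 2]powR_mulrn// -powRrM.
  have -> : 1 / 4 * 2 = 2^-1 :> R by field.
  rewrite powR12_sqrt// mulrC; apply/eqP; apply: etrans (bernstein_weight_sqr x1).
  by congr (_ * Num.sqrt _); ring.
rewrite normrM ger0_norm//; apply: (le_trans (ler_wpM2l p4 h)).
by rewrite [leLHS]mulrA E [leLHS]mul1r.
Qed.

End remainder_bounds.
End tail_sums.

(** * From coefficient bounds to the estimates *)

Section remainder_estimates.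
Context {R : realType}.
Notation leb := (@lebesgue_measure R).
Local Notation RT := (measurableTypeR R).
Implicit Types (u f g v h : R -> R) (x e mu rho theta V C l : R) (n m M N k : nat).

Lemma Linfty_norm_le f C : 0 <= C -> (forall x, -1 < x < 1 -> `|f x| <= C) ->
  (Linfty_norm f <= C%:E)%E.
Proof.
move=> C0 hf; rewrite /Linfty_norm unlock; case: ifP => // _.
apply/ess_supP; apply: nearW => x /=; rewrite lee_fin patchE; case: ifPn; last by rewrite normr0.
by move=> /set_mem; rewrite /= in_itv/=; exact: hf.
Qed.

Lemma estimates_of_coef u mu V N : abs_cont (-1) 1 u -> 0 < mu -> mu <= N%:R -> 0 <= V ->
  (forall n, (N < n)%N ->
    `|\int[leb]_(x in `[-1, 1]) (u x * (legendre n).[x])| <= V * legq_amp n (mu + 1)) ->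
  (1 / 2 < mu -> estimateA mu N u V%:E) /\ estimateB mu N u V%:E.
Proof.
move=> acu mu0 muN V0 hc.
have coef n : (N < n)%N ->
    `|legendre_coef u n| <= (2 * n%:R + 1) / 2 * (V * legq_amp n (mu + 1)).
  move=> Nn; rewrite /legendre_coef normrM ger0_norm; last by rewrite divr_ge0// addr_ge0// mulr_ge0.
  by rewrite ler_wpM2l ?hc// divr_ge0// addr_ge0// mulr_ge0.
have gE s : Gamma s = gam s :> R by rewrite gam.unlock.
have g0 s : 0 < s -> 0 <= gam s :> R by move=> s0; rewrite ltW// Gamma_gt0.
split=> [mu2|]; rewrite /estimateA /estimateB -EFinM !gE.
- apply: Linfty_norm_le => [|x x1]; last exact: legendre_remainder_sup.
  rewrite !mulr_ge0 ?invr_ge0 ?mulr_ge0 ?sqrtr_ge0 ?powR_ge0 ?g0//; lra.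
- apply: Linfty_norm_le => [|x x1]; last exact: legendre_remainder_bernstein.
  rewrite !mulr_ge0 ?invr_ge0 ?mulr_ge0 ?pi_ge0 ?powR_ge0 ?g0//; lra.
Qed.

Lemma BV_left_limit a b v : a < b -> bounded_variation a b v ->
  exists l : R, v x @[x --> b^'-] --> l.
Proof.
move=> ab bv; have [] := @BV_right_limit R (- b) (- a) (v \o -%R).
- by rewrite ltrN2.
- by have [] := BV_oppr (ltW ab) bv.
by move=> l hl; exists l; exact/cvg_at_leftNP.
Qed.

Lemma UthetaE theta h g l1 l2 : -1 < theta < 1 ->
  bounded_variation (-1) theta h -> bounded_variation theta 1 g ->
  h x @[x --> theta^'-] --> l1 -> g x @[x --> theta^'+] --> l2 ->
  Utheta theta h g =
  ((`|l1| + variation_fun (-1) h theta) + (`|l2| + variation_fun theta g 1))%:E.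
Proof.
move=> /andP[t1 t2] bh bg hl gl; rewrite /Utheta.
rewrite (cvg_lim (@Rhausdorff R) hl) (cvg_lim (@Rhausdorff R) gl).
rewrite -[total_variation (-1) theta h]fineK; last exact/(bounded_variationP _ (ltW t1)).
rewrite -[total_variation theta 1 g]fineK; last exact/(bounded_variationP _ (ltW t2)).
by rewrite -!EFinD; congr EFin; rewrite /variation_fun; ring.
Qed.

Lemma ae_setT_itv (P : set R) a b : -1 <= a -> b <= 1 ->
  {ae leb, forall x, x \in `]-1, 1[ -> P x} -> {ae leb, forall x, `[a, b]%classic x -> P x}.
Proof.
move=> a1 b1 /ae_itv_closed H; apply: (ae_imply H) => x h /=.
rewrite in_itv/= => /andP[ax xb]; apply: h.
by rewrite /= in_itv/= (le_trans a1)//= (le_trans xb).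
Qed.

Lemma variation_fun_ge0 a b v : a <= b -> 0 <= variation_fun a v b.
Proof. by move=> ab; rewrite fine_ge0// total_variation_ge0. Qed.

Lemma caputo_estimates k u mu theta h g N : (0 < k)%N -> AC_derivatives (-1) 1 k u ->
  k%:R - 1 < mu < k%:R -> -1 < theta < 1 ->
  BV_version theta 1 (caputo_left k mu theta u) g ->
  BV_version (-1) theta (caputo_right k mu theta u) h -> mu <= N%:R ->
  (1 / 2 < mu -> estimateA mu N u (Utheta theta h g)) /\
  estimateB mu N u (Utheta theta h g).
Proof.
move=> k0 acu /andP[mu1 mu2] /andP[t1 t2] [bg gE] [bh hE] muN.
have [f [fi fE fP]] := legendre_parts k0 acu.
have [l1 hl1] := BV_left_limit t1 bh; have [l2 hl2] := BV_right_limit t2 bg.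
rewrite (UthetaE (theta := theta) _ bh bg hl1 hl2) ?t1//.
have k1 : 1 <= k%:R :> R by rewrite ler1n.
have mu0 : 0 < mu by lra.
have rho0 : 0 < k%:R - mu by lra.
have rhoN : (k%:R - mu == 0) = false by rewrite gt_eqF.
have gamE : Gamma (k%:R - mu) = gam (k%:R - mu) :> R by rewrite gam.unlock.
have gE' : {ae leb, forall x, `[theta, 1]%classic x -> g x = rl_int (k%:R - mu) theta f x}.
  (* For each x the integrand in [derive1n k u] is replaced by the one in f; they agree almost
     everywhere on the range of integration, and no measurability of the former is required. *)
  apply: (ae_imply gE) => x H xt; rewrite -(H xt) /caputo_left /frac_int_left rhoN gamE.
  congr (_ * _); apply: ae_eq_RintegralT.
  move: xt; rewrite /= in_itv/= => /andP[_ x1].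
  by apply: (ae_imply (ae_setT_itv (ltW t1) x1 fE)) => y Hy yt; rewrite Hy.
have hE' : {ae leb, forall x, `[-1, theta]%classic x -> h x = (-1) ^+ k *
    ((gam (k%:R - mu))^-1 * \int[leb]_(y in `[x, theta]) (f y / (y - x) `^ (1 - (k%:R - mu))))}.
  apply: (ae_imply hE) => x H xt; rewrite -(H xt) /caputo_right /frac_int_right rhoN gamE.
  congr (_ * (_ * _)); apply: ae_eq_RintegralT.
  move: xt; rewrite /= in_itv/= => /andP[x1 _].
  by apply: (ae_imply (ae_setT_itv x1 (ltW t2) fE)) => y Hy yt; rewrite Hy.
apply: estimates_of_coef => //.
- by case: acu.
- by rewrite !addr_ge0// variation_fun_ge0// ltW.
move=> n Nn; have mun : mu < n%:R by apply: (le_lt_trans muN); rewrite ltr_nat.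
(* From k - 1 < mu < n: although N may be smaller than k, every index past N allows the k
   integrations by parts. *)
have kn : (k <= n)%N by rewrite -ltnS -(ltr_nat R) -[n.+1%:R]natr1; lra.
rewrite fP//.
have mF : leb.-integrable (`[-1, 1]%classic : set RT) (EFin \o (fun x => f x * fracp k%:R (legq n) (1 - x))).
  have [M HM] := @fracp_bounded R k%:R (legq n) (ler0n _ _).
  have mD : measurable (`[-1, 1]%classic : set RT) by exact: measurable_itv.
  have fiD : leb.-integrable (`[-1, 1]%classic : set RT) (EFin \o f).
    by apply: (@integrableS _ _ _ _ setT).
  apply: (@eq_integrableR _ _ (fun x => fracp k%:R (legq n) (1 - x) * f x)).
    by move=> x; rewrite mulrC.
  apply: (@integrable_mul_bounded _ _ _ _ M) => //; first exact: fracp_measurable.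
  by move=> x /=; rewrite in_itv/= => /andP[x1 x2]; apply: HM; lra.
set F := (fun x => f x * fracp k%:R (legq n) (1 - x)) in mF *.
(* Splitting at theta only after the integrations by parts creates no boundary term at theta. *)
have -> : \int[leb]_(x in `[-1, 1]) F x =
    \int[leb]_(x in `[-1, theta]) F x + \int[leb]_(x in `[theta, 1]) F x.
  have mD : measurable (`]theta, 1]%classic : set RT) by exact: measurable_itv.
  have h1 : leb.-integrable (`]theta, 1]%classic : set RT) (EFin \o F).
    apply: (@integrableS _ _ _ _ (`[-1, 1]%classic : set RT)) => //.
    by move=> x /=; rewrite !in_itv/= => /andP[/ltW x1 ->]; rewrite (le_trans (ltW t1)).
  have := @Rintegral_itvB R F (BLeft (-1)) (BRight 1) theta mF.
  rewrite !bnd_simp => /(_ (ltW t1) (ltW t2)); rewrite (Rintegral_itv_obnd_cbnd h1) => <-.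
  by rewrite addrC subrK.
rewrite /F => {mF}; clear F.
apply: (le_trans (ler_normD _ _)); rewrite mulrDl; apply: lerD.
- have := @right_coeff_bound R theta (k%:R - mu) k f n h l1 t1 (ltW t2) rho0.
  have -> : k%:R - (k%:R - mu) = mu by ring.
  by apply => //; lra.
- have := @rl_int_coeff_bound R theta (k%:R - mu) mu f n g l2 (ltW t1) t2 rho0 mu0 mun.
  have -> : mu + (k%:R - mu) = k%:R by ring.
  by apply.
Qed.

(** The whole interval is treated as the part to the right of -1. The order is already k, so no
    fractional integral intervenes, and the term in l vanishes because k + 1 <= n; only the total
    variation remains. *)
Lemma integer_estimates k u g N : (0 < k)%N -> AC_derivatives (-1) 1 k u ->
  BV_version (-1) 1 (derive1n k u) g -> (k <= N)%N ->
  (1 / 2 < (k%:R : R) -> estimateA k%:R N u (total_variation (-1) 1 g)) /\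
  estimateB k%:R N u (total_variation (-1) 1 g).
Proof.
move=> k0 acu [bg gE] kN; have [f [fi fE fP]] := legendre_parts k0 acu.
have lt11 : -1 < 1 :> R by lra.
have [l hl] := BV_right_limit lt11 bg.
rewrite -[total_variation (-1) 1 g]fineK; last exact/(bounded_variationP _ (ltW lt11)).
apply: estimates_of_coef => //.
- by case: acu.
- by rewrite ltr0n.
- by rewrite ler_nat.
- by rewrite (@variation_fun_ge0 (-1) 1 g)// ltW.
move=> n Nn; have kn : (k < n)%N by rewrite (leq_ltn_trans kN).
rewrite fP ?(ltnW kn)//.
have -> : \int[leb]_(x in `[-1, 1]) (f x * fracp k%:R (legq n) (1 - x)) =
    \int[leb]_(x in `[-1, 1]) (g x * fracp k%:R (legq n) (1 - x)).
  apply: ae_eq_RintegralT; have H := ae_setT_itv (lexx (-1)) (lexx 1) fE.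
  by apply: (ae_imply2 H gE) => x h1 h2 x1; rewrite -h1// h2.
have := @BV_fracp_bound R (-1) k%:R n g l (lexx _) lt11 ltac:(by rewrite ltr0n) ltac:(by rewrite ltr_nat) bg hl.
have -> : 1 - -1 = 2 :> R by ring.
by rewrite natr1 fracp_legq_at2// normr0 mulr0 add0r.
Qed.

End remainder_estimates.

Theorem theorem2 (R : realType) (k : nat) (u : R -> R) :
  (1 <= k)%N ->
  AC_derivatives (-1) 1 k u ->
  (forall (mu theta : R) (h g : R -> R),
     k%:R - 1 < mu < k%:R ->
     -1 < theta < 1 ->
     BV_version theta 1 (caputo_left k mu theta u) g ->
     BV_version (-1) theta (caputo_right k mu theta u) h ->
     (1 / 2 < mu ->
      forall N : nat, mu <= N%:R -> estimateA mu N u (Utheta theta h g)) /\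
     (forall N : nat, mu <= N%:R -> estimateB mu N u (Utheta theta h g))) /\
  (forall g : R -> R,
     BV_version (-1) 1 (derive1n k u) g ->
     forall N : nat, (k <= N)%N ->
       estimateA k%:R N u (total_variation (-1) 1 g) /\
       estimateB k%:R N u (total_variation (-1) 1 g)).
Proof.
move=> k0 acu; split=> [mu theta h g hmu ht bg bh|g bg N kN].
  by split=> [mu2|] N muN; have [A B] := caputo_estimates k0 acu hmu ht bg bh muN; [exact: A|].
have [A B] := integer_estimates k0 acu bg kN; split; [apply: A|exact: B].
have k1 : 1 <= k%:R :> R by rewrite ler1n.
by lra.
Qed.
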